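(* Let $B=\operatorname{diag}(b_1,\dots,b_n)$ be nonsingular, let $Q=(q_{jk})\in L^1([0,1];\mathbb C^{n\times n})$, and let $q_{jk}$ be continuous at the points $0$ and $1$ whenever $b_j\neq b_k$. Let $\Delta(\cdot)$ be the characteristic determinant and let $p\in\{1,\dots,\nu\}$. Then for sufficiently small $\varepsilon>0$ the characteristic determinant admits the asymptotic expansion $$\Delta(\lambda)=\gamma_p\left(\omega_0(z_p)(1+o(1))+\frac{\omega_1(z_p)+o(1)}{\lambda}\right)e^{i\tau_p\lambda}\quad\text{as }\lambda\to\infty,\ \lambda\in S_{p,\varepsilon}.$$ Here $z_p$ is a fixed point in $S_{p,\varepsilon}$, $$\gamma_p=\exp\Bigl(-\sum_{\operatorname{Re}(ib_jz_p)>0}ib_j\int_0^1q_{jj}(t)\,dt\Bigr),\qquad\tau_p=\sum_{\operatorname{Re}(ib_jz_p)>0}b_j,\qquad\omega_0(z_p)=\det T_{iz_pB}(C,D),$$ $$\omega_1(z_p)=\sum_{\substack{j,k:\ \operatorname{Re}(ib_jz_p)<0,\\ \operatorname{Re}(ib_kz_p)>0}}\frac{\det T_{iz_pB}^{c_j\to c_k}\,b_kq_{kj}(0)-\det T_{iz_pB}^{d_k\to d_j}\,b_jq_{jk}(1)}{b_k-b_j}.$$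
   Context: $C,D\in\mathbb C^{n\times n}$ satisfy $\operatorname{rank}\begin{pmatrix}C&D\end{pmatrix}=n$. The characteristic determinant is $\Delta(\lambda)=\det(C+D\Phi(1,\lambda))$, where $\Phi(x,\lambda)$ is the fundamental matrix solution of $-iB^{-1}y'+Q(x)y=\lambda y$, $x\in[0,1]$, with $\Phi(0,\lambda)=I_n$. Let $\beta_1,\dots,\beta_r$ be all distinct values among $b_1,\dots,b_n$. The lines $\{\lambda:\operatorname{Re}(i\beta_j\lambda)=\operatorname{Re}(i\beta_k\lambda)\}$, $1\le j<k\le r$, and $\{\lambda:\operatorname{Re}(i\beta_j\lambda)=0\}$, $1\le j\le r$, divide $\mathbb C$ into open sectors $S_1,\dots,S_\nu$ with vertex at the origin, $S_p=\{z:\varphi_{1p}<\arg z<\varphi_{2p}\}$; put $S_{p,\varepsilon}=\{z:\varphi_{1p}+\varepsilon<\arg z<\varphi_{2p}-\varepsilon\}$. For $z\in S_p$, $T_{izB}(C,D)$ is the $n\times n$ matrix whose $k$th column is the $k$th column of $C$ if $\operatorname{Re}(ib_kz)<0$ and the $k$th column of $D$ if $\operatorname{Re}(ib_kz)>0$. $T_{izB}^{c_j\to c_k}$ (resp. $T_{izB}^{d_j\to d_k}$) is obtained from $T_{izB}(C,D)$ by replacing its $j$th column by the $k$th column of $C$ (resp. of $D$). *)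

(* Defs.v *)
From HB Require Import structures.
From mathcomp Require Import all_boot all_order all_algebra.
From mathcomp Require Export complex.
From mathcomp Require Import all_classical all_reals all_analysis.

Set Implicit Arguments.
Unset Strict Implicit.
Unset Printing Implicit Defensive.

Import Order.TTheory GRing.Theory Num.Theory.
Import numFieldNormedType.Exports.

Local Open Scope classical_set_scope.
Local Open Scope ring_scope.
Local Open Scope complex_scope.

Section ComplexAnalysis.
Context {R : realType}.
Implicit Types (A : set R) (f : R -> R[i]).

Definition cexp (z : R[i]) : R[i] :=
  (expR (complex.Re z))%:C * (cos (complex.Im z) +i* sin (complex.Im z)).

Definition cintegrable A f : Prop :=
  lebesgue_measure.-integrable A (fun t => (complex.Re (f t))%:E) /\
  lebesgue_measure.-integrable A (fun t => (complex.Im (f t))%:E).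

Definition cintegral A f : R[i] :=
  (\int[lebesgue_measure]_(t in A) complex.Re (f t))%R +i*
  (\int[lebesgue_measure]_(t in A) complex.Im (f t))%R.

(* [a] and [b] may be any real representatives of the bounding arguments, so
   the condition [a < arg z < b] is independent of a choice of branch. *)
Definition sector (a b : R) : set R[i] :=
  [set z | exists r theta : R,
     [/\ 0 < r, a < theta, theta < b & z = r%:C * (cos theta +i* sin theta)]].

(* The filter "z tends to infinity along S". *)
Definition infty_within (S : set R[i]) : set_system R[i] :=
  filter_from [set: R] (fun M => [set z | S z /\ M%:C < `|z|]).

Lemma infty_within_filter (S : set R[i]) : Filter (infty_within S).
Proof.
apply: filter_from_filter; first by exists 0.
move=> M N _ _; exists (Num.max M N) => // z [Sz].
case: (leP M N) => MN lz; split; split=> //; apply: le_lt_trans lz.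
  by rewrite lecR.
by rewrite lecR ltW.
Qed.

End ComplexAnalysis.

#[global] Existing Instance infty_within_filter.

Section System.
Context {R : realType} {n : nat}.
Implicit Types (b : 'rV[R[i]]_n) (Q : R -> 'M[R[i]]_n) (C D : 'M[R[i]]_n).

(* [Y] is absolutely continuous on [0, 1], i.e. it is the indefinite Lebesgue
   integral of a summable [Y'], it satisfies -i B^-1 Y' + Q Y = lam Y almost
   everywhere, and Y(0) = I. *)
Definition fundamental_matrix b Q (lam : R[i]) (Y : R -> 'M[R[i]]_n) : Prop :=
  Y 0 = 1%:M /\
  exists Y' : R -> 'M[R[i]]_n,
    [/\ forall j k, cintegrable `[0, 1] (fun t => Y' t j k),
        forall x, 0 <= x <= 1 ->
          Y x = Y 0 + \matrix_(j, k) cintegral `[0, x] (fun t => Y' t j k) &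
        {ae lebesgue_measure, forall x, 0 <= x <= 1 ->
          - 'i%C *: (invmx (diag_mx b) *m Y' x) + Q x *m Y x = lam *: Y x}].

Definition char_det C D (Phi : R -> R[i] -> 'M[R[i]]_n) (lam : R[i]) : R[i] :=
  \det (C + D *m Phi 1 lam).

Definition re_ibz b (j : 'I_n) (z : R[i]) : R := complex.Re ('i%C * b 0 j * z).

Definition separating_lines b : set R[i] :=
  [set z | (exists j k, b 0 j != b 0 k /\ re_ibz b j z = re_ibz b k z) \/
           (exists j, re_ibz b j z = 0)].

(* [sector a c] is one of the sectors S_1, ..., S_nu into which the lines
   divide the plane. *)
Definition is_sector b (a c : R) : Prop :=
  exists2 z : R[i]^o, (~` separating_lines b) z &
    sector a c = connected_component (~` separating_lines b : set R[i]^o) z.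

(* Used only off [separating_lines b], where no [re_ibz b k z] vanishes. *)
Definition Tmx b C D (z : R[i]) : 'M[R[i]]_n :=
  \matrix_(i, k) if re_ibz b k z < 0 then C i k else D i k.

(* [A] with its [j]th column replaced by the [k]th column of [E]. *)
Definition replace_col (A : 'M[R[i]]_n) (j : 'I_n) (E : 'M[R[i]]_n) (k : 'I_n) :
    'M[R[i]]_n :=
  \matrix_(i, l) if l == j then E i k else A i l.

Definition gamma b Q (z : R[i]) : R[i] :=
  cexp (- \sum_(j | 0 < re_ibz b j z)
            'i%C * b 0 j * cintegral `[0, 1] (fun t => Q t j j)).

Definition tau b (z : R[i]) : R[i] := \sum_(j | 0 < re_ibz b j z) b 0 j.

Definition omega0 b C D (z : R[i]) : R[i] := \det (Tmx b C D z).

Definition omega1 b Q C D (z : R[i]) : R[i] :=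
  \sum_(j | re_ibz b j z < 0) \sum_(k | 0 < re_ibz b k z)
    (\det (replace_col (Tmx b C D z) j C k) * b 0 k * Q 0 k j
     - \det (replace_col (Tmx b C D z) k D j) * b 0 j * Q 1 j k)
    / (b 0 k - b 0 j).

End System.

(* Main.v *)
(* The indices are split into growing and decaying ones according to the sign of
   Re(i b_j lambda), which is constant on the sector; there
   |Re(i b_j lambda)| >= dl |lambda| with dl > 0. Let A(t) be the matrix whose growing
   rows are those of Phi(t, lambda) and whose decaying rows are those of the
   identity. If A(1) is invertible, the columns of Phi(., lambda) A(1)^-1 are the
   solutions with prescribed decaying components at 0 and growing components at
   1, so that Delta = det A(1) det(T + E), where T = T_{izB}(C,D) and E collects
   the remaining boundary values of those solutions. Gronwall estimates for this
   two-point problem, whose coupling terms carry the kernel e^{-2k(s-x)} with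
   k = dl |lambda|, give invertibility and E = E1 / lambda + o(1 / lambda): the
   entries of E1 are b_m q_ml / (b_m - b_l) at the end points, where continuity of
   q_ml is used. Expanding det(T + E) to first order yields omega0 + omega1 / lambda.
   Finally (log det A)' is the sum over the growing k of i b_k lambda - i b_k q_kk plus
   an error term of small integral, hence det A(1) ~ gamma e^{i tau lambda}. *)

Require Import Defs.
From HB Require Import structures.
From mathcomp Require Import all_boot all_order all_algebra all_fingroup.
From mathcomp Require Import all_classical all_reals all_analysis.
From mathcomp Require Import measurable_realfun.
From mathcomp Require Import ring lra.

Set Implicit Arguments.
Unset Strict Implicit.
Unset Printing Implicit Defensive.

Import Order.TTheory GRing.Theory Num.Theory.
Import numFieldNormedType.Exports.

Local Open Scope classical_set_scope.
Local Open Scope ring_scope.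
Local Open Scope complex_scope.

(** * Absolutely continuous functions and Gronwall's inequality *)

(** The potential is only summable, so kernel integrals of its entries merely tend to 0 as k grows,
    without a rate. This shapes the estimates twice. First, the coefficients by which decaying
    components drive growing ones are kept apart from the rest ([mnorm] against [pnorm]): Gronwall's
    inequality handles the rest at the price of a factor e^L, L being an integral of [pnorm],
    whereas the feedback loop between the two classes closes only because the kernel makes this
    coupling small. Secondly, the rate 1 / lambda is obtained by cutting the interval at a small h
    that does not depend on lambda: on [0, 2h] the coupling coefficients are bounded by continuity
    and the kernel integrates to at most 1 / (2k), and farther away the kernel is exponentially
    small. Coupling involves one growing and one decaying index, hence b_j different from b_k, so
    continuity at the end points is available. What concerns the end point 1 follows from the end
    point 0 by s -> t - s, which exchanges the two classes. Liouville's formula for det A(t)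
    requires A(t) to be invertible for every t with a single threshold on k; hence the care for
    bounds uniform in t. *)

Section real_integrals.
Context {R : realType}.
Local Notation mu := (@lebesgue_measure R).
Implicit Types (f g p : R -> R) (a b c x y e : R).

Definition L1 a b f := mu.-integrable `[a, b] (EFin \o f).
Definition Rint a b f : R := \int[mu]_(t in `[a, b]) f t.
Definition cont a b f := {within `[a, b], continuous (f : R -> R)}.

Lemma sub_itv a b c d : a <= c -> d <= b -> `[c, d] `<=` `[a, b].
Proof. by move=> ac db; apply: subset_itv; rewrite bnd_simp. Qed.

Lemma L1_sub a b c d f : a <= c -> d <= b -> L1 a b f -> L1 c d f.
Proof.
by move=> ac db; apply: integrableS => //=; exact: sub_itv.
Qed.

Lemma cont_sub a b c d f : a <= c -> d <= b -> cont a b f -> cont c d f.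
Proof. by move=> ac db; apply: continuous_subspaceW; exact: sub_itv. Qed.

Lemma L1D a b f g : L1 a b f -> L1 a b g -> L1 a b (fun t => f t + g t).
Proof. by move=> hf hg; exact: (integrableD _ hf hg). Qed.

Lemma L1N a b f : L1 a b f -> L1 a b (fun t => - f t).
Proof. by move=> hf; exact: (integrableN hf). Qed.

Lemma L1B a b f g : L1 a b f -> L1 a b g -> L1 a b (fun t => f t - g t).
Proof. by move=> hf hg; apply: L1D => //; exact: L1N. Qed.

Lemma L1_norm a b f : L1 a b f -> L1 a b (fun t => `|f t|).
Proof. by move=> hf; exact: (integrable_norm hf). Qed.

Lemma cont_measurable a b f : cont a b f -> measurable_fun `[a, b] f.
Proof. by move=> cf; apply: subspace_continuous_measurable_fun. Qed.

Lemma cont_bounded a b f : cont a b f ->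
  exists2 M : R, 0 < M & forall x, a <= x <= b -> `|f x| <= M.
Proof.
move=> cf.
have := compact_bounded (continuous_compact cf (segment_compact (a := a) (b := b))).
move=> [M [Mr HM]]; exists (`|M| + 1); first by rewrite ltr_wpDl.
move=> x xab; apply: (HM (`|M| + 1)) => //.
by rewrite (le_lt_trans (ler_norm _))// ltrDl.
Qed.

Lemma L1Mcont a b f g : cont a b f -> L1 a b g -> L1 a b (fun t => f t * g t).
Proof.
move=> cf hg; rewrite /L1.
have [M M0 HM] := cont_bounded cf.
suff : mu.-integrable `[a, b] ((EFin \o f) \* (EFin \o g))%E by [].
apply: integrableMr => //; first exact: cont_measurable.
exists M; split; first exact: num_real.
move=> N MN x /=; rewrite in_itv/= => xab.
by rewrite (le_trans (HM _ xab))// ltW.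
Qed.

Lemma L1_cst a b c : L1 a b (fun=> c).
Proof.
apply: measurable_bounded_integrable => //.
  by rewrite /= lebesgue_measure_itv /=; case: ifP => _; rewrite ?ltry// -EFinB ltry.
exists `|c|; split; first exact: num_real.
by move=> N cN x _ /=; exact: ltW.
Qed.

Lemma cont_cst a b c : cont a b (fun=> c).
Proof. by move=> x; exact: cvg_cst. Qed.

Lemma cont_cts a b f : continuous f -> cont a b f.
Proof. exact: continuous_subspaceT. Qed.

Lemma contM a b f g : cont a b f -> cont a b g -> cont a b (fun t => f t * g t).
Proof. by move=> cf cg x; apply: cvgM; [exact: cf|exact: cg]. Qed.

Lemma contD a b f g : cont a b f -> cont a b g -> cont a b (fun t => f t + g t).
Proof. by move=> cf cg x; apply: cvgD; [exact: cf|exact: cg]. Qed.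

Lemma contN a b f : cont a b f -> cont a b (fun t => - f t).
Proof. by move=> cf x; apply: cvgN; exact: cf. Qed.

Lemma cont_comp a b f g : continuous g -> cont a b f -> cont a b (g \o f).
Proof.
by move=> cg cf x; apply: (@continuous_comp _ _ _ _ g); [exact: cf|exact: cg].
Qed.

Lemma L1_cont a b f : cont a b f -> L1 a b f.
Proof.
move=> cf; have := L1Mcont cf (L1_cst a b 1); congr (mu.-integrable _ _).
by apply/funext => x /=; rewrite mulr1.
Qed.

Lemma L1Z a b c f : L1 a b f -> L1 a b (fun t => c * f t).
Proof. by apply: L1Mcont; exact: cont_cst. Qed.

Lemma RintD a b f g : L1 a b f -> L1 a b g ->
  Rint a b (fun t => f t + g t) = Rint a b f + Rint a b g.
Proof. exact: RintegralD. Qed.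

Lemma RintB a b f g : L1 a b f -> L1 a b g ->
  Rint a b (fun t => f t - g t) = Rint a b f - Rint a b g.
Proof. exact: RintegralB. Qed.

Lemma RintZ a b c f : L1 a b f -> Rint a b (fun t => c * f t) = c * Rint a b f.
Proof. by move=> hf; exact: RintegralZl. Qed.

Lemma RintN a b f : L1 a b f -> Rint a b (fun t => - f t) = - Rint a b f.
Proof.
move=> hf; rewrite -mulN1r -RintZ//; apply: eq_Rintegral => x _.
by rewrite mulN1r.
Qed.

Lemma eq_Rint a b f g : (forall t, a <= t <= b -> f t = g t) ->
  Rint a b f = Rint a b g.
Proof. by move=> fg; apply: eq_Rintegral => x; rewrite inE/= in_itv/=; exact: fg. Qed.

Lemma eq_L1 a b f g : (forall t, a <= t <= b -> f t = g t) -> L1 a b f -> L1 a b g.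
Proof.
move=> fg; apply: eq_integrable => // x; rewrite inE/= in_itv/= => /fg /= ->.
by [].
Qed.

Lemma le_Rint a b f g : L1 a b f -> L1 a b g ->
  (forall t, a <= t <= b -> f t <= g t) -> Rint a b f <= Rint a b g.
Proof.
by move=> hf hg fg; apply: le_Rintegral => // x /=; rewrite in_itv/=; exact: fg.
Qed.

Lemma Rint_ge0 a b f : (forall t, a <= t <= b -> 0 <= f t) -> 0 <= Rint a b f.
Proof.
by move=> f0; apply: Rintegral_ge0 => x /=; rewrite in_itv/=; exact: f0.
Qed.

Lemma Rint_norm a b f : L1 a b f -> `|Rint a b f| <= Rint a b (fun t => `|f t|).
Proof. by move=> hf; exact: le_normr_Rintegral. Qed.

Lemma Rint_cst a b c : a <= b -> Rint a b (fun=> c) = c * (b - a).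
Proof.
move=> ab; rewrite /Rint Rintegral_cst//= lebesgue_measure_itv/=.
case: ltP => //=; rewrite ?lte_fin ?lee_fin => h.
have -> : b = a by apply/eqP; rewrite eq_le ab h.
by rewrite subrr.
Qed.

Lemma Rint_pt a f : Rint a a f = 0.
Proof. by rewrite /Rint set_itv1 Rintegral_set1. Qed.

Lemma Rint_chasles a b c f : a <= b -> b <= c -> L1 a c f ->
  Rint a c f = Rint a b f + Rint b c f.
Proof.
move=> ab bc hf; apply/eqP; rewrite addrC -subr_eq; apply/eqP.
rewrite /Rint Rintegral_itvB// Rintegral_itv_obnd_cbnd//.
by apply: integrableS hf => //=; apply: subset_itvr; rewrite bnd_simp.
Qed.

Lemma Rint_sub_le a b c d f : a <= c -> c <= d -> d <= b -> L1 a b f ->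
  (forall t, a <= t <= b -> 0 <= f t) -> Rint c d f <= Rint a b f.
Proof.
move=> ac cd db hf f0.
rewrite (@Rint_chasles a c b)//; last exact: le_trans db.
rewrite (@Rint_chasles c d b)//; last by apply: L1_sub hf.
rewrite addrCA lerDl addr_ge0// Rint_ge0// => t /andP[t1 t2]; apply: f0.
  by rewrite t1 (le_trans t2)// (le_trans cd).
by rewrite t2 andbT (le_trans _ t1)// (le_trans ac).
Qed.

Lemma Rint_small a b p : L1 a b p -> forall e, 0 < e -> exists2 d : R, 0 < d &
  forall x y, a <= x -> x <= y -> y <= b -> y - x < d -> Rint x y (fun t => `|p t|) < e.
Proof.
(* Extension by zero, so that the absolute continuity of the integral on the whole line applies. *)
move=> hp e e0; pose q := p \_ `[a, b].
have hq : mu.-integrable setT (EFin \o q).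
  by rewrite -restrict_EFin; apply/integrable_restrict => //=; rewrite setTI.
have [d [d0 Hd]] := integral_normr_continuous hq e0.
exists d => // x y ax xy yb xyd.
rewrite (@eq_Rint _ _ _ (fun t => `|q t|)); last first.
  move=> t /andP[xt ty]; rewrite /q patchE mem_set//= in_itv/=.
  by rewrite (le_trans ax)//= (le_trans ty).
apply: Hd => //; rewrite /= lebesgue_measure_itv/=; case: ifP => _.
  by rewrite -EFinD lte_fin.
by rewrite lte_fin.
Qed.

Lemma cont_uniform a b f : cont a b f -> forall e, 0 < e ->
  exists2 d : R, 0 < d & forall x y, a <= x <= b -> a <= y <= b -> `|x - y| < d ->
    `|f x - f y| < e.
Proof.
move=> cf e e0; have := segment_compact (a := a) (b := b).
move=> /compact_near_coveringP/near_covering_withinP.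
move=> /(_ R (0^'+) (fun d x => forall y, a <= y <= b ->
  `|x - y| < d -> `|f x - f y| < e)) H.
have [d /= d0 Hd] : \forall d \near 0^'+, forall x, a <= x <= b ->
    forall y, a <= y <= b -> `|x - y| < d -> `|f x - f y| < e.
  apply: filterS (H _ _) => [d Hd x xab|x xab].
    by apply: Hd; rewrite /= in_itv.
  have e2 : 0 < e / 2 by rewrite divr_gt0.
  have := cf x; rewrite /continuous_at => /cvgrPdist_lt /(_ _ e2).
  rewrite -[X in X -> _]/(nbhs (x : subspace `[a, b]) _).
  case: (nbhs_subspaceP `[a, b]%classic x) => // _ [r /= r0 Hr].
  have r2 : 0 < r / 2 by rewrite divr_gt0.
  (* Half radii: a point [x'] within r / 2 of [x] and a point within r / 2 of [x'] both lie in the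
     ball of radius r about [x]. *)
  exists (ball x (r / 2), [set d : R | 0 < d < r / 2]) => /=.
    split; first exact: nbhsx_ballx.
    by exists (r / 2) => //= z /=; rewrite sub0r normrN => + z0; rewrite gtr0_norm// z0.
  move=> [x' d] /= [xx' /andP[d0 dr]] x'ab y yab x'y.
  have h1 : `|f x - f x'| < e / 2.
    by apply: Hr => //; rewrite /= (lt_trans xx')// ltr_pdivrMr// ltr_pMr// ltr1n.
  have h2 : `|f x - f y| < e / 2.
    apply: Hr => /=; last by rewrite in_itv.
    by move: xx'; rewrite /ball/= => xx'; have := ler_distD x' x y; lra.
  by rewrite distrC in h1; have := ler_distD (f x) (f x') (f y); lra.
exists (d / 2); first by rewrite divr_gt0.
move=> x y xab yab xy; apply: (Hd (d / 2)) => //=; last by rewrite divr_gt0.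
by rewrite sub0r normrN gtr0_norm ?divr_gt0// ltr_pdivrMr// ltr_pMr// ltr1n.
Qed.

(* With [ac_local] below, this replaces almost everywhere differentiability in the
   calculus of absolutely continuous functions. *)
Lemma const_principle a b (G : R -> R) p : L1 a b p -> (forall t, a <= t <= b -> 0 <= p t) ->
  (forall e, 0 < e -> exists2 d : R, 0 < d & forall x y, a <= x -> x <= y -> y <= b ->
     y - x < d -> `|G y - G x| <= e * Rint x y p) ->
  forall x, a <= x <= b -> G x = G a.
Proof.
move=> hp p0 H x0 /andP[ax0 x0b].
have key e : 0 < e -> `|G x0 - G a| <= e * Rint a b p.
  move=> e0; have [d d0 Hd] := H e e0.
  (* The interval from [a] to [x] is covered by steps of length d / 2 < d, [n] bounding their
     number; the local bounds add up because [Rint] is additive. *)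
  suff K n : forall x, a <= x -> x <= b -> x - a < n%:R * (d / 2) ->
      `|G x - G a| <= e * Rint a x p.
    have [n Hn] : exists n : nat, x0 - a < n%:R * (d / 2).
      exists (Num.Def.truncn ((x0 - a) / (d / 2))).+1.
      rewrite -ltr_pdivrMr ?divr_gt0//; exact: Num.Theory.truncnS_gt.
    rewrite (le_trans (K n _ ax0 x0b Hn))// ler_wpM2l// ?(ltW e0)//.
    by apply: Rint_sub_le.
  elim: n => [|n IH] x ax xb.
    by rewrite mul0r subr_lt0 ltNge ax.
  move=> hx; have [hs|hl] := ltP (x - a) d; first exact: Hd.
  pose z := x - d / 2.
  have d2 : 0 < d / 2 by rewrite divr_gt0.
  have zx : z <= x by rewrite /z gerBl ltW.
  have az : a <= z by rewrite /z; lra.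
  have zb : z <= b by rewrite (le_trans zx).
  have h1 : z - a < n%:R * (d / 2).
    by rewrite /z; move: hx; rewrite -natr1; lra.
  have h2 := IH z az zb h1.
  have h3 : `|G x - G z| <= e * Rint z x p.
    by apply: Hd => //; rewrite /z; lra.
  rewrite (@Rint_chasles a z x)//; last by apply: L1_sub hp.
  rewrite mulrDr [leRHS]addrC; apply: le_trans (lerD h3 h2).
  by rewrite (le_trans _ (ler_normD _ _))// addrA subrK.
apply/eqP; rewrite -subr_eq0 -normr_le0; apply/ler_addgt0Pr => e e0.
rewrite add0r; have M0 : 0 <= Rint a b p by apply: Rint_ge0.
have h := key (e / (Rint a b p + 1)) (divr_gt0 e0 (ltr_wpDl M0 ltr01)).
rewrite (le_trans h)// -mulrA ger_pMr// mulrC ler_pdivrMr ?ltr_wpDl//; lra.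
Qed.

End real_integrals.

(** * Calculus of absolutely continuous functions *)

Section absolutely_continuous.
Context {R : realType}.
Implicit Types (f g p : R -> R) (a b c x y e : R).

(** The density [f'] is carried along as data, determined only up to a null set; derivatives at
    points never occur. *)
Definition ac a b f f' :=
  L1 a b f' /\ forall x, a <= x <= b -> f x = f a + Rint a x f'.

Lemma ac_diff a b x y f f' : ac a b f f' -> a <= x -> x <= y -> y <= b ->
  f y - f x = Rint x y f'.
Proof.
move=> [hf' hf] ax xy yb.
rewrite hf ?yb ?(le_trans ax)// [f x]hf ?ax ?(le_trans xy)//.
rewrite (@Rint_chasles _ a x y)//; first by ring.
by apply: L1_sub hf'.
Qed.

Lemma ac_sub a b c d f f' : a <= c -> d <= b -> ac a b f f' -> ac c d f f'.
Proof.
move=> ac db H; split; first by apply: L1_sub H.1.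
move=> x /andP[cx xd]; rewrite -(@ac_diff a b c x f f')//; first by ring.
exact: le_trans db.
Qed.

Lemma ac_cont a b f f' : a <= b -> ac a b f f' -> cont a b f.
Proof.
move=> ab [hf' hf].
have H : cont a b (fun x => f a + Rint a x f').
  apply: contD; first exact: cont_cst.
  by have := parameterized_integral_continuous ab hf'.
apply: subspace_eq_continuous H => x; rewrite inE/= in_itv/= => xab.
by symmetry; exact: hf.
Qed.

Lemma ac_eq a b f g f' : (forall x, a <= x <= b -> f x = g x) ->
  ac a b f f' -> ac a b g f'.
Proof.
move=> fg [hf' hf]; split=> // x xab; rewrite -(fg x)// -(fg a); first exact: hf.
by case/andP: xab => ax xb; rewrite lexx (le_trans ax).
Qed.

Lemma ac_eq_der a b f f' g' : (forall x, a <= x <= b -> f' x = g' x) ->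
  ac a b f f' -> ac a b f g'.
Proof.
move=> fg [hf' hf]; split=> [|x xab]; first exact: eq_L1 hf'.
rewrite hf//; congr (_ + _); apply: eq_Rint => t /andP[at_ tx]; apply: fg.
by rewrite at_ (le_trans tx)//; case/andP: xab.
Qed.

(** Errors bounded by [e * Rint x y p] stay small after summation over a subdivision, since they add
    up to e times the mass of [p]. The product and chain rules thereby reduce to uniform
    continuity. *)
Lemma ac_local a b f f' p : L1 a b f' -> L1 a b p ->
  (forall t, a <= t <= b -> 0 <= p t) ->
  (forall e, 0 < e -> exists2 d : R, 0 < d & forall x y, a <= x -> x <= y -> y <= b ->
     y - x < d -> `|f y - f x - Rint x y f'| <= e * Rint x y p) ->
  ac a b f f'.
Proof.
move=> hf' hp p0 H; split=> // x xab.
have := @const_principle _ a b (fun x => f x - Rint a x f') p hp p0.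
move=> /(_ _ x xab); rewrite Rint_pt subr0 => <-; first by rewrite subrK.
move=> e e0; have [d d0 Hd] := H e e0; exists d => // u v au uv vb uvd.
rewrite (@Rint_chasles _ a u v)//; last by apply: L1_sub hf'.
have -> : f v - (Rint a u f' + Rint u v f') - (f u - Rint a u f') =
  f v - f u - Rint u v f' by ring.
exact: Hd.
Qed.

Lemma acD a b f g f' g' : ac a b f f' -> ac a b g g' ->
  ac a b (fun t => f t + g t) (fun t => f' t + g' t).
Proof.
move=> [hf' hf] [hg' hg]; split=> [|x xab]; first exact: L1D.
rewrite hf// hg// RintD; first by ring.
  by apply: L1_sub hf' => //; case/andP: xab.
by apply: L1_sub hg' => //; case/andP: xab.
Qed.

Lemma acZ a b c f f' : ac a b f f' -> ac a b (fun t => c * f t) (fun t => c * f' t).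
Proof.
move=> [hf' hf]; split=> [|x xab]; first exact: L1Z.
rewrite hf// RintZ; first by ring.
by apply: L1_sub hf' => //; case/andP: xab.
Qed.

Lemma acN a b f f' : ac a b f f' -> ac a b (fun t => - f t) (fun t => - f' t).
Proof.
move=> /(acZ (-1)) H; apply: ac_eq (ac_eq_der _ H) => x _; by rewrite mulN1r.
Qed.

Lemma acB a b f g f' g' : ac a b f f' -> ac a b g g' ->
  ac a b (fun t => f t - g t) (fun t => f' t - g' t).
Proof. by move=> hf /acN; exact: acD. Qed.

Lemma ac_cst a b c : a <= b -> ac a b (fun=> c) (fun=> 0).
Proof.
move=> ab; split=> [|x /andP[ax xb]]; first exact: L1_cst.
by rewrite Rint_cst// mul0r addr0.
Qed.

Lemma acM a b f g f' g' : a <= b -> ac a b f f' -> ac a b g g' ->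
  ac a b (fun t => f t * g t) (fun t => f' t * g t + f t * g' t).
Proof.
move=> ab Hf Hg; have cf := ac_cont ab Hf; have cg := ac_cont ab Hg.
have [[hf' _] [hg' _]] := (Hf, Hg).
have L1fg : L1 a b (fun t => f' t * g t).
  by apply: eq_L1 (L1Mcont cg hf') => t _; rewrite mulrC.
have L2fg : L1 a b (fun t => f t * g' t) by exact: L1Mcont.
apply: (@ac_local _ _ _ _ (fun t => `|f' t| + `|g' t|)).
- exact: L1D.
- by apply: L1D; exact: L1_norm.
- by move=> t _; rewrite addr_ge0.
move=> e e0; have [d1 d10 H1] := cont_uniform cf e0.
have [d2 d20 H2] := cont_uniform cg e0.
exists (Num.min d1 d2); first by rewrite lt_min d10.
move=> x y ax xy yb; rewrite lt_min => /andP[xyd1 xyd2].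
have sL h : L1 a b h -> L1 x y h by exact: L1_sub.
(* With the end values [g y] and [f x] frozen the increment of the product is an exact integral;
   what remains contains only oscillations of [f] and [g] over a short interval. *)
have -> : f y * g y - f x * g x - Rint x y (fun t => f' t * g t + f t * g' t) =
  Rint x y (fun t => f' t * (g y - g t) + g' t * (f x - f t)).
  have -> : f y * g y - f x * g x = (f y - f x) * g y + (g y - g x) * f x by ring.
  rewrite (ac_diff Hf)// (ac_diff Hg)//.
  rewrite [_ * g y]mulrC [_ * f x]mulrC -!RintZ ?sL// -RintD ?sL//; last 2 first.
  - exact: L1Z.
  - exact: L1Z.
  rewrite -RintB ?sL//; last 2 first.
  - by apply: L1D; exact: L1Z.
  - exact: L1D.
  by apply: eq_Rint => t _; ring.
have L1a : L1 x y (fun t => f' t * (g y - g t) + g' t * (f x - f t)).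
  apply: L1D.
    apply: (@eq_L1 _ _ _ (fun t => (g y - g t) * f' t)).
      by move=> t _; rewrite mulrC.
    apply: L1Mcont (sL _ hf'); apply: contD; first exact: cont_cst.
    by apply: contN; exact: cont_sub cg.
  apply: (@eq_L1 _ _ _ (fun t => (f x - f t) * g' t)).
    by move=> t _; rewrite mulrC.
  apply: L1Mcont (sL _ hg'); apply: contD; first exact: cont_cst.
  by apply: contN; exact: cont_sub cf.
rewrite (le_trans (Rint_norm L1a))// -RintZ; last first.
  by apply: sL; apply: L1D; exact: L1_norm.
apply: le_Rint.
- exact: L1_norm.
- by apply: L1Z; apply: sL; apply: L1D; exact: L1_norm.
move=> t /andP[xt ty].
have tab : a <= t <= b by rewrite (le_trans ax)// (le_trans ty).
apply: (le_trans (ler_normD _ _)); rewrite [leRHS]mulrDr !normrM; apply: lerD.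
  rewrite mulrC ler_wpM2r// ltW//; apply: H2 => //.
    by rewrite yb (le_trans ax).
  by rewrite ger0_norm ?subr_ge0//; lra.
rewrite mulrC ler_wpM2r// ltW//; apply: H1 => //.
  by rewrite ax (le_trans xy).
by rewrite ler0_norm ?subr_le0//; lra.
Qed.

(** Since [f] need not be differentiable, the mean value theorem is applied to [g] between the
    values of [f], and the intermediate value theorem pulls the mean point back to [x, y]. *)
Lemma mean_value_comp a b x y f (g g' : R -> R) : cont a b f ->
  (forall u : R, is_derive u (1 : R) g (g' u)) -> a <= x -> x <= y -> y <= b ->
  exists2 c, x <= c <= y & g (f y) - g (f x) = g' (f c) * (f y - f x).
Proof.
move=> cf dg ax xy yb.
have cg u v : {within `[u, v], continuous g}.
  apply: continuous_subspaceT => z.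
  exact/differentiable_continuous/derivable1_diffP/(@ex_derive _ _ _ _ _ _ _ (dg z)).
have [c cI E] : exists2 c, Num.min (f x) (f y) <= c <= Num.max (f x) (f y) &
    g (f y) - g (f x) = g' c * (f y - f x).
  have [fxy|/ltW fxy] := leP (f x) (f y).
    have [c cI E] := MVT_segment fxy (fun z _ => dg z) (cg _ _).
    by exists c => //; move: cI; rewrite in_itv.
  have [c cI E] := MVT_segment fxy (fun z _ => dg z) (cg _ _).
  exists c; first by move: cI; rewrite in_itv.
  by rewrite -opprB E; ring.
have cf' : {within `[x, y], continuous f} by apply: cont_sub cf.
have [z zI fz] := IVT xy cf' cI.
by exists z; [move: zI; rewrite in_itv | rewrite fz].
Qed.

Lemma ac_comp a b f f' (g g' : R -> R) : a <= b -> ac a b f f' ->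
  (forall u : R, is_derive u (1 : R) g (g' u)) -> continuous g' ->
  ac a b (fun t => g (f t)) (fun t => g' (f t) * f' t).
Proof.
move=> ab Hf dg cg'; have cf := ac_cont ab Hf; have [hf' _] := Hf.
have cgf : cont a b (fun t => g' (f t)) by exact: (cont_comp cg' cf).
apply: (@ac_local _ _ _ _ (fun t => `|f' t|)).
- exact: L1Mcont.
- exact: L1_norm.
- by move=> t _.
move=> e e0; have [d d0 Hd] := cont_uniform cgf e0; exists d => //.
move=> x y ax xy yb xyd.
have sL h : L1 a b h -> L1 x y h by exact: L1_sub.
have [c /andP[xc cy] ->] := mean_value_comp cf dg ax xy yb.
rewrite (ac_diff Hf)// -RintZ ?sL// -RintB ?sL//; last 2 first.
- exact: L1Z.
- exact: L1Mcont.
have L1a : L1 x y (fun t => (g' (f c) - g' (f t)) * f' t).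
  apply: L1Mcont (sL _ hf'); apply: contD; first exact: cont_cst.
  by apply: contN; exact: cont_sub cgf.
have L1b : L1 x y (fun t => g' (f c) * f' t - g' (f t) * f' t).
  by apply: eq_L1 L1a => t _; ring.
rewrite (le_trans (Rint_norm L1b))// -RintZ; last by apply: sL; exact: L1_norm.
apply: le_Rint.
- exact: L1_norm.
- by apply: L1Z; apply: sL; exact: L1_norm.
move=> t /andP[xt ty].
rewrite -mulrBl normrM ler_wpM2r// ltW//; apply: Hd.
- by rewrite (le_trans ax)// (le_trans cy).
- by rewrite (le_trans ax)// (le_trans ty).
- by rewrite ltr_norml; lra.
Qed.

End absolutely_continuous.

(** * Integrals under the reflection t -> c - t *)

Section reflection.
Context {R : realType}.
Local Notation mu := (@lebesgue_measure R).
Implicit Types (f g p : R -> R) (a b c x y e : R).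

Let refl c : R -> measurableTypeR R := fun t => c - t.

Lemma refl_preimage c a b : refl c @^-1` `[c - b, c - a] = `[a, b]%classic.
Proof. by apply/seteqP; split=> t /=; rewrite /refl !in_itv/=; lra. Qed.

Lemma measurable_refl c : measurable_fun setT (refl c).
Proof. by apply: measurable_funB => //; exact: measurable_cst. Qed.

(** By uniqueness of Lebesgue measure it suffices to test half-open intervals; reflection moves the
    open end to the other side, which leaves the length unchanged. *)
Lemma pushforward_refl c (A : set R) : measurable A ->
  pushforward mu (refl c) A = mu A.
Proof.
move=> mA; apply/esym/lebesgue_measure_unique => //=.
  exact: measurable_refl.
move=> mr _ [[u v]] _ <-.
rewrite /pushforward/=.
have -> : refl c @^-1` `]u, v] = `[c - v, c - u[%classic.
  by apply/seteqP; split=> t /=; rewrite /refl !in_itv/=; lra.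
rewrite !lebesgue_measure_itv/= !lte_fin ltrD2l ltrN2.
by case: ifP => // _; rewrite -!EFinD; congr (_%:E); ring.
Qed.

Lemma ge0_Rint_refl c (D : set R) (f : R -> \bar R) : measurable D ->
  measurable_fun D f -> (forall t, D t -> 0 <= f t)%E ->
  (\int[mu]_(t in refl c @^-1` D) f (refl c t) = \int[mu]_(t in D) f t)%E.
Proof.
move=> mD mf f0.
transitivity (\int[pushforward mu (refl c)]_(t in D) f t)%E.
  rewrite ge0_integral_pushforward//; first exact: measurable_refl.
  by move=> t; rewrite inE => /f0.
by apply: eq_measure_integral => [|? A mA _]; [exact: measurable_refl|exact: pushforward_refl].
Qed.

Lemma L1_refl c a b f : L1 a b f -> L1 (c - b) (c - a) (fun t => f (c - t)).
Proof.
move=> /integrableP[mf fi]; apply/integrableP.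
have E : refl c @^-1` `[a, b] = `[c - b, c - a]%classic.
  by have := refl_preimage c (c - b) (c - a); rewrite !subKr.
split.
  rewrite -E; apply: (measurable_comp _ _ mf) => //.
    by move=> _ [t /= tI <-].
  by apply: (@measurable_funS _ _ _ _ setT) => //; exact: measurable_refl.
have := ge0_Rint_refl c (D := `[a, b]) (f := fun t => `|(f t)%:E|%E).
rewrite E => H; apply: (le_lt_trans _ fi); rewrite H//.
exact: measurableT_comp.
Qed.

Lemma Rint_refl c a b f : L1 a b f ->
  Rint (c - b) (c - a) (fun t => f (c - t)) = Rint a b f.
Proof.
(* The change of variables asks for measurability on the whole line, which the extension by zero
   provides. *)
move=> hf; pose g := f \_ `[a, b].
have hg : mu.-integrable setT (EFin \o g).
  by rewrite -restrict_EFin; apply/integrable_restrict => //=; rewrite setTI.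
have fg t : a <= t <= b -> f t = g t.
  by move=> tab; rewrite /g patchE mem_set//= in_itv.
rewrite [RHS](eq_Rint fg).
rewrite (@eq_Rint _ _ _ _ (fun t => g (refl c t))); last first.
  by move=> t tab; rewrite -fg// /refl; lra.
rewrite /Rint; congr fine.
rewrite -(refl_preimage c) !subKr.
transitivity (\int[pushforward mu (refl c)]_(t in `[a, b]) (g t)%:E)%E; last first.
  by apply: eq_measure_integral => [|? A mA _]; [exact: measurable_refl|exact: pushforward_refl].
apply/esym/integral_pushforward => //.
- exact: measurable_refl.
- exact: (measurable_int _ hg).
- have := refl_preimage c (c - b) (c - a); rewrite !subKr => ->.
  have : L1 (c - b) (c - a) (fun t => f (c - t)) by exact: L1_refl.
  apply: eq_L1 => t tab; rewrite fg//; lra.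
Qed.

Lemma ac_refl c a b f f' : a <= b -> ac a b f f' ->
  ac (c - b) (c - a) (fun t => f (c - t)) (fun t => - f' (c - t)).
Proof.
move=> ab Hf; have [hf' _] := Hf.
split=> [|x /andP[bx xa]]; first exact/L1N/L1_refl.
have L1x : L1 (c - x) b f' by apply: L1_sub hf' => //; lra.
rewrite subKr RintN; last by apply: L1_sub (L1_refl c hf') => //; lra.
have -> : Rint (c - b) x (fun t => f' (c - t)) = Rint (c - x) b f'.
  by rewrite -(Rint_refl c L1x) subKr.
rewrite -(ac_diff Hf) ?lexx//; [ring|lra|lra].
Qed.

End reflection.

(** * Gronwall's inequality, forward and backward *)

Section gronwall.
Context {R : realType}.
Implicit Types (f u p : R -> R) (a b c x : R).

Lemma ac_int a b f : a <= b -> L1 a b f -> ac a b (fun x => Rint a x f) f.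
Proof. by move=> ab hf; split=> // x _; rewrite Rint_pt add0r. Qed.

Lemma ac_exp a b f f' : a <= b -> ac a b f f' ->
  ac a b (fun t => expR (f t)) (fun t => expR (f t) * f' t).
Proof.
move=> ab Hf; exact: ac_comp ab Hf _ (@continuous_expR R).
Qed.

Lemma ac_nincr a b f f' : ac a b f f' -> a <= b ->
  (forall t, a <= t <= b -> f' t <= 0) -> f b <= f a.
Proof.
move=> Hf ab f'0; have [hf' _] := Hf.
rewrite -subr_le0 (ac_diff Hf)// -oppr_ge0 -RintN// Rint_ge0// => t /f'0.
by rewrite oppr_ge0.
Qed.

(** The majorant c + int_a^x p u, multiplied by exp(- int_a^x p), has density exp(- int_a^x p) p (u
    - majorant) <= 0, hence stays below its initial value c. *)
Lemma gronwall a b u p c : a <= b -> cont a b u -> L1 a b p ->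
  (forall t, a <= t <= b -> 0 <= p t) ->
  (forall x, a <= x <= b -> u x <= c + Rint a x (fun t => p t * u t)) ->
  forall x, a <= x <= b -> u x <= c * expR (Rint a x p).
Proof.
move=> ab cu hp p0 H.
have Hpu : L1 a b (fun t => p t * u t).
  by apply: eq_L1 (L1Mcont cu hp) => t _; rewrite mulrC.
have HF := ac_int ab Hpu; have HE := ac_exp ab (acN (ac_int ab hp)).
have HG := acM ab HE (acD (ac_cst c ab) HF).
move=> x /andP[ax xb]; apply: (le_trans (H x _)); first by rewrite ax.
have := ac_nincr (ac_sub (lexx a) xb HG) ax; rewrite /= !Rint_pt oppr0 expR0 mul1r addr0.
rewrite expRN ler_pdivrMl ?expR_gt0// [expR _ * _]mulrC; apply=> t /andP[at_ tx].
have tab : a <= t <= b by rewrite at_ (le_trans tx).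
have := H t tab; have := p0 t tab; have := expR_gt0 (- Rint a t p).
set E := expR _; set F := Rint _ _ _ => E0 pt0 ut.
have -> : E * - p t * (c + F) + E * (0 + p t * u t) = (E * p t) * (u t - (c + F)).
  by ring.
by rewrite mulr_ge0_le0 ?subr_le0// mulr_ge0// ltW.
Qed.

(** Here exp(int_a^x p) times the majorant c + int_x^b p u is nondecreasing, and it is compared at
    the two ends. The bound at an inner point follows by taking that point for [a]. *)
Lemma gronwall_rev a b u p c : a <= b -> cont a b u -> L1 a b p ->
  (forall t, a <= t <= b -> 0 <= p t) ->
  (forall x, a <= x <= b -> u x <= c + Rint x b (fun t => p t * u t)) ->
  u a <= c * expR (Rint a b p).
Proof.
move=> ab cu hp p0 H.
have Hpu : L1 a b (fun t => p t * u t).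
  by apply: eq_L1 (L1Mcont cu hp) => t _; rewrite mulrC.
pose I := Rint a b (fun t => p t * u t).
have HF := acB (ac_cst (c + I) ab) (ac_int ab Hpu).
have HG := acN (acM ab (ac_exp ab (ac_int ab hp)) HF).
apply: (le_trans (H a _)); first by rewrite lexx.
rewrite (mulrC c); have := ac_nincr HG ab.
rewrite lerN2 !Rint_pt expR0 mul1r subr0 (addrK I).
apply=> t tab; have /andP[at_ tb] := tab.
have := H t tab; have := p0 t tab; have := expR_gt0 (Rint a t p).
rewrite /I (@Rint_chasles _ a t b)//.
set E := expR _; set F := Rint a t _; set G := Rint t b _ => E0 pt0 ut.
have -> : - (E * p t * (c + (F + G) - F) + E * (0 - p t * u t)) =
   (E * p t) * (u t - (c + G)) by ring.
by rewrite mulr_ge0_le0 ?subr_le0// mulr_ge0// ltW.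
Qed.

End gronwall.

(** * Complex-valued functions *)

Section complex_modulus.
Context {R : realType}.
Local Notation C := R[i].
Local Notation Re := complex.Re.
Local Notation Im := complex.Im.
Implicit Types (z w : C) (r : R).

(* The modulus of the numFieldType [R[i]] is valued in [R[i]]; [cabs] is its
   real-valued version. *)
Definition cabs (z : C) : R := Normc.normc z.

Lemma cabsE z : `|z| = (cabs z)%:C. Proof. by []. Qed.

Lemma ReD z w : Re (z + w) = Re z + Re w. Proof. by case: z; case: w. Qed.
Lemma ImD z w : Im (z + w) = Im z + Im w. Proof. by case: z; case: w. Qed.
Lemma ReN z : Re (- z) = - Re z. Proof. by case: z. Qed.
Lemma ImN z : Im (- z) = - Im z. Proof. by case: z. Qed.
Lemma ReM z w : Re (z * w) = Re z * Re w - Im z * Im w.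
Proof. by case: z; case: w. Qed.
Lemma ImM z w : Im (z * w) = Re z * Im w + Im z * Re w.
Proof. by case: z; case: w. Qed.

Lemma complex_ext z w : Re z = Re w -> Im z = Im w -> z = w.
Proof. by case: z => ? ?; case: w => ? ? /= -> ->. Qed.

Lemma cabs_ge0 z : 0 <= cabs z.
Proof. by case: z => u v; exact: sqrtr_ge0. Qed.

Lemma cabs0 : cabs 0 = 0. Proof. exact: Normc.normc0. Qed.
Lemma cabs1 : cabs 1 = 1. Proof. exact: Normc.normc1. Qed.
Lemma cabs0_eq0 z : cabs z = 0 -> z = 0. Proof. exact: Normc.eq0_normc. Qed.
Lemma cabsM z w : cabs (z * w) = cabs z * cabs w. Proof. exact: Normc.normcM. Qed.
Lemma cabsV z : cabs z^-1 = (cabs z)^-1. Proof. exact: Normc.normcV. Qed.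
Lemma cabsN z : cabs (- z) = cabs z.
Proof. by apply/complexI; rewrite -!cabsE normrN. Qed.

Lemma cabsD z w : cabs (z + w) <= cabs z + cabs w.
Proof. by rewrite -lecR rmorphD/= -!cabsE ler_normD. Qed.

Lemma cabsB z w : cabs (z - w) <= cabs z + cabs w.
Proof. by rewrite -(cabsN w) cabsD. Qed.

Lemma cabs_sum (I : finType) (P : pred I) (F : I -> C) :
  cabs (\sum_(i | P i) F i) <= \sum_(i | P i) cabs (F i).
Proof.
elim/big_ind2 : _ => [|x1 x2 y1 y2 h1 h2|//]; first by rewrite cabs0.
by rewrite (le_trans (cabsD _ _))// lerD.
Qed.

Lemma cabsR r : cabs r%:C = `|r|.
Proof. by rewrite /cabs/= expr0n/= addr0 sqrtr_sqr. Qed.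

Lemma Re_le_cabs z : `|Re z| <= cabs z.
Proof. by rewrite -lecR -cabsE normc_ge_Re. Qed.

Lemma Im_le_cabs z : `|Im z| <= cabs z.
Proof.
case: z => a b; rewrite /cabs/= -sqrtr_sqr ler_wsqrtr// lerDr sqr_ge0//.
Qed.

Lemma cabs_le z : cabs z <= `|Re z| + `|Im z|.
Proof.
case: z => a b; rewrite /cabs/= -[leRHS]ger0_norm ?addr_ge0// -sqrtr_sqr.
rewrite ler_wsqrtr// sqrrD !real_normK ?num_real//.
by rewrite addrAC lerDl mulrn_wge0// mulr_ge0.
Qed.

Lemma cabs_cexp z : cabs (cexp z) = expR (Re z).
Proof.
rewrite /cexp cabsM cabsR ger0_norm ?expR_ge0// /cabs/= cos2Dsin2 sqrtr1.
by rewrite mulr1.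
Qed.

Lemma cexpD z w : cexp (z + w) = cexp z * cexp w.
Proof.
rewrite /cexp ReD ImD expRD cosD sinD; apply: complex_ext.
  by rewrite !(ReM, ImM)/=; ring.
by rewrite !(ReM, ImM)/=; ring.
Qed.

Lemma cexp0 : cexp 0 = 1 :> C.
Proof. by rewrite /cexp/= expR0 cos0 sin0 mul1r. Qed.

End complex_modulus.

Section complex_ac.
Context {R : realType}.
Local Notation C := R[i].
Local Notation Re := complex.Re.
Local Notation Im := complex.Im.
Implicit Types (f g : R -> C) (a b x y : R).

Definition cac a b f f' :=
  ac a b (fun t => Re (f t)) (fun t => Re (f' t)) /\
  ac a b (fun t => Im (f t)) (fun t => Im (f' t)).

Lemma cac_sub a b c d f f' : a <= c -> d <= b -> cac a b f f' -> cac c d f f'.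
Proof. by move=> ac db [H1 H2]; split; [exact: ac_sub H1|exact: ac_sub H2]. Qed.

Lemma cac_eq a b f g f' : (forall x, a <= x <= b -> f x = g x) ->
  cac a b f f' -> cac a b g f'.
Proof.
move=> fg [H1 H2]; split; [apply: ac_eq H1 => x /fg -> //|].
by apply: ac_eq H2 => x /fg ->.
Qed.

Lemma cac_eq_der a b f f' g' : (forall x, a <= x <= b -> f' x = g' x) ->
  cac a b f f' -> cac a b f g'.
Proof.
move=> fg [H1 H2]; split; [apply: ac_eq_der H1 => x /fg -> //|].
by apply: ac_eq_der H2 => x /fg ->.
Qed.

Lemma cacD a b f g f' g' : cac a b f f' -> cac a b g g' ->
  cac a b (fun t => f t + g t) (fun t => f' t + g' t).
Proof.
move=> [H1 H2] [K1 K2]; split.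
  apply: (ac_eq _ (ac_eq_der _ (acD H1 K1))) => t _; exact/esym/ReD.
by apply: (ac_eq _ (ac_eq_der _ (acD H2 K2))) => t _; exact/esym/ImD.
Qed.

Lemma cacN a b f f' : cac a b f f' -> cac a b (fun t => - f t) (fun t => - f' t).
Proof.
move=> [H1 H2]; split.
  by apply: (ac_eq _ (ac_eq_der _ (acN H1))) => t _; exact/esym/ReN.
by apply: (ac_eq _ (ac_eq_der _ (acN H2))) => t _; exact/esym/ImN.
Qed.

Lemma cac_cst a b (c : C) : a <= b -> cac a b (fun=> c) (fun=> 0).
Proof. by move=> ab; split; exact: ac_cst. Qed.

Lemma cacM a b f g f' g' : a <= b -> cac a b f f' -> cac a b g g' ->
  cac a b (fun t => f t * g t) (fun t => f' t * g t + f t * g' t).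
Proof.
move=> ab [H1 H2] [K1 K2]; split.
  apply: (ac_eq _ (ac_eq_der _ (acB (acM ab H1 K1) (acM ab H2 K2)))) => t _.
    by rewrite ReM.
  by rewrite ReD !ReM; ring.
apply: (ac_eq _ (ac_eq_der _ (acD (acM ab H1 K2) (acM ab H2 K1)))) => t _.
  by rewrite ImM.
by rewrite ImD !ImM; ring.
Qed.

Lemma cacZ a b c f f' : a <= b -> cac a b f f' ->
  cac a b (fun t => c * f t) (fun t => c * f' t).
Proof.
move=> ab H; apply: (cac_eq_der _ (cacM ab (cac_cst c ab) H)) => t _.
by rewrite mul0r add0r.
Qed.

Lemma cac_sum a b (I : finType) (P : pred I) (f f' : I -> R -> C) : a <= b ->
  (forall i, cac a b (f i) (f' i)) ->
  cac a b (fun t => \sum_(i | P i) f i t) (fun t => \sum_(i | P i) f' i t).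
Proof.
move=> ab H; elim: (index_enum I) => [|i s IH].
  apply: (cac_eq _ (cac_eq_der _ (cac_cst 0 ab))) => t _.
    by rewrite big_nil.
  by rewrite big_nil.
have [Pi|Pi] := boolP (P i).
  apply: (cac_eq _ (cac_eq_der _ (cacD (H i) IH))) => t _.
    by rewrite big_cons Pi.
  by rewrite big_cons Pi.
apply: (cac_eq _ (cac_eq_der _ IH)) => t _.
  by rewrite big_cons (negbTE Pi).
by rewrite big_cons (negbTE Pi).
Qed.

Lemma cac_prod a b (I : finType) (f f' : I -> R -> C) : a <= b ->
  (forall i, cac a b (f i) (f' i)) ->
  cac a b (fun t => \prod_i f i t)
    (fun t => \sum_k f' k t * \prod_(i | i != k) f i t).
Proof.
move=> ab H.
(* On a duplicate-free list the condition [i != k] removes exactly one factor, so the induction is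
   the binary product rule. *)
suff K (s : seq I) : uniq s -> cac a b (fun t => \prod_(i <- s) f i t)
    (fun t => \sum_(k <- s) f' k t * \prod_(i <- s | i != k) f i t).
  exact: (K _ (index_enum_uniq I)).
elim: s => [_|i s IH /= /andP[si us]].
  apply: (cac_eq _ (cac_eq_der _ (cac_cst 1 ab))) => t _; by rewrite big_nil.
apply: (cac_eq _ (cac_eq_der _ (cacM ab (H i) (IH us)))) => t _.
  by rewrite big_cons.
rewrite big_cons big_cons eqxx/=; congr (_ * _ + _).
  rewrite [LHS]big_seq [RHS]big_seq_cond; apply: eq_bigl => j.
  by case: (boolP (j \in s)) => //= js; apply/esym/negP => /eqP ji; rewrite -ji js in si.
rewrite big_distrr/= !big_seq; apply: eq_bigr => k ks.
rewrite big_cons; case: eqP => [ik|_]; first by rewrite ik ks in si.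
by rewrite mulrCA.
Qed.

Lemma cac_cexp a b f f' : a <= b -> cac a b f f' ->
  cac a b (fun t => cexp (f t)) (fun t => cexp (f t) * f' t).
Proof.
move=> ab [H1 H2].
have Hc := ac_comp ab H2 (fun u => is_derive_cos u) _.
have Hs := ac_comp ab H2 (fun u => is_derive_sin u) (@continuous_cos R).
have {}Hc : ac a b (fun t => cos (Im (f t))) (fun t => - sin (Im (f t)) * Im (f' t)).
  by apply: Hc => x; apply: cvgN; exact: continuous_sin.
have He := ac_exp ab H1.
split.
  apply: (ac_eq _ (ac_eq_der _ (acM ab He Hc))) => t _.
    by rewrite /cexp ReM/=; ring.
  by rewrite /cexp !(ReM, ImM)/=; ring.
apply: (ac_eq _ (ac_eq_der _ (acM ab He Hs))) => t _.
  by rewrite /cexp ImM/=; ring.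
by rewrite /cexp !(ReM, ImM)/=; ring.
Qed.

Lemma cac_cont a b f f' : a <= b -> cac a b f f' -> cont a b (fun t => cabs (f t)).
Proof.
move=> ab [/(ac_cont ab) H1 /(ac_cont ab) H2].
have H : cont a b (fun t => Re (f t) * Re (f t) + Im (f t) * Im (f t)).
  by apply: contD; exact: contM.
have -> : (fun t => cabs (f t)) =
    Num.sqrt \o (fun t => Re (f t) * Re (f t) + Im (f t) * Im (f t)).
  by apply/funext => t /=; case: (f t) => u v; rewrite /cabs/= !expr2.
by apply: cont_comp H; exact: sqrt_continuous.
Qed.

(* The constant 2 comes from estimating real and imaginary parts separately. *)
Lemma cac_incr a b x y f f' (g : R -> R) : cac a b f f' -> a <= x -> x <= y -> y <= b ->
  L1 x y g -> (forall t, x <= t <= y -> cabs (f' t) <= g t) ->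
  cabs (f y - f x) <= 2 * Rint x y g.
Proof.
move=> [H1 H2] ax xy yb hg fg.
have aux h h' : ac a b h h' -> (forall t, x <= t <= y -> `|h' t| <= g t) ->
    `|h y - h x| <= Rint x y g.
  move=> Hh hh; rewrite (ac_diff Hh)//.
  have L1h : L1 x y h' by apply: L1_sub Hh.1.
  by apply: (le_trans (Rint_norm L1h)); apply: le_Rint => //; exact: L1_norm.
rewrite (le_trans (cabs_le _))// mulr_natl mulr2n ReD ReN ImD ImN; apply: lerD.
  by apply: (aux _ _ H1) => t /fg; apply: le_trans; exact: Re_le_cabs.
by apply: (aux _ _ H2) => t /fg; apply: le_trans; exact: Im_le_cabs.
Qed.

Lemma cac_refl c a b f f' : a <= b -> cac a b f f' ->
  cac (c - b) (c - a) (fun t => f (c - t)) (fun t => - f' (c - t)).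
Proof.
move=> ab [H1 H2]; split.
  by apply: (ac_eq_der _ (ac_refl c ab H1)) => t _; rewrite ReN.
by apply: (ac_eq_der _ (ac_refl c ab H2)) => t _; rewrite ImN.
Qed.

End complex_ac.

(** * A two-point boundary value problem under an exponential dichotomy *)

Section sums.
Context {R : realType}.

Lemma sumM_le (I : finType) (Q : pred I) (f g : I -> R) :
  (forall i, 0 <= f i) -> (forall i, 0 <= g i) ->
  \sum_(i | Q i) f i * g i <= (\sum_(i | Q i) f i) * \sum_(i | Q i) g i.
Proof.
move=> f0 g0; rewrite mulr_suml; apply: ler_sum => i Qi.
rewrite ler_wpM2l// (bigD1 i)//= lerDl sumr_ge0//.
Qed.

Lemma ler_sum1 (I : finType) (Q : pred I) (f : I -> R) i :
  (forall i, 0 <= f i) -> Q i -> f i <= \sum_(i | Q i) f i.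
Proof. by move=> f0 Qi; rewrite (bigD1 i)//= lerDl sumr_ge0. Qed.

Lemma ler_sum_all (I : finType) (Q : pred I) (f : I -> R) :
  (forall i, 0 <= f i) -> \sum_(i | Q i) f i <= \sum_i f i.
Proof.
by move=> f0; rewrite [leRHS](bigID Q)//= lerDl sumr_ge0.
Qed.

Lemma ler_sum_cst n (Q : pred 'I_n) (f : 'I_n -> R) (c : R) : 0 <= c ->
  (forall i, Q i -> f i <= c) -> \sum_(i | Q i) f i <= n%:R * c.
Proof.
move=> c0 H; apply: (le_trans (ler_sum _ H)).
apply: (le_trans (ler_sum_all _ (fun=> c0))).
by rewrite sumr_const card_ord mulr_natl.
Qed.

Lemma L1_sum a b (I : finType) (Q : pred I) (f : I -> R -> R) :
  (forall i, L1 a b (f i)) -> L1 a b (fun t => \sum_(i | Q i) f i t).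
Proof.
move=> H; elim: (index_enum I) => [|i s IH].
  by apply: eq_L1 (L1_cst a b 0) => t _; rewrite big_nil.
have [Qi|Qi] := boolP (Q i).
  by apply: eq_L1 (L1D (H i) IH) => t _; rewrite big_cons Qi.
by apply: eq_L1 IH => t _; rewrite big_cons (negbTE Qi).
Qed.

Lemma cont_sum a b (I : finType) (Q : pred I) (f : I -> R -> R) :
  (forall i, cont a b (f i)) -> cont a b (fun t => \sum_(i | Q i) f i t).
Proof.
move=> H; elim: (index_enum I) => [|i s IH].
  rewrite (_ : (fun _ => _) = fun=> 0); first exact: cont_cst.
  by apply/funext => t; rewrite big_nil.
have [Qi|Qi] := boolP (Q i).
  rewrite (_ : (fun _ => _) = fun t => f i t + \sum_(j <- s | Q j) f j t).
    exact: contD.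
  by apply/funext => t; rewrite big_cons Qi.
rewrite (_ : (fun _ => _) = fun t => \sum_(j <- s | Q j) f j t)//.
by apply/funext => t; rewrite big_cons (negbTE Qi).
Qed.

Lemma cont_expR a b (c d : R) : cont a b (fun s => expR (c * s + d)).
Proof.
apply: (cont_comp (@continuous_expR R)); apply: contD; last exact: cont_cst.
by apply: contM; [exact: cont_cst|apply: cont_cts => x; exact: cvg_id].
Qed.

Lemma L1_expM u v (c d : R) (f : R -> R) :
  L1 u v f -> L1 u v (fun s => expR (c * s + d) * f s).
Proof. by apply: L1Mcont; exact: cont_expR. Qed.

End sums.

Section bvp.
Context {R : realType} (n : nat) (sg : pred 'I_n) (k t : R) (a : 'I_n -> R[i])
  (P : R -> 'I_n -> 'I_n -> R[i]) (y : 'I_n -> R -> R[i]).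
Local Notation Re := complex.Re.

Definition solution := forall j,
  cac 0 t (y j) (fun s => a j * y j s + \sum_l P s j l * y l s).

Definition dichotomy :=
  [/\ 0 <= k, forall j, ~~ sg j -> Re (a j) <= - k & forall j, sg j -> k <= Re (a j)].

(* [um] and [up] measure the decaying and the growing components of [y]. The
   factor [2 * n] in [pnorm] and [mnorm] absorbs the sum over the components and
   the separate estimates of real and imaginary parts; [mnorm] retains only the
   coefficients through which the decaying components drive the growing ones. *)
Definition qnorm s := \sum_j \sum_l cabs (P s j l).
Definition pnorm s := 2 * n%:R * qnorm s.
Definition mnorm s := 2 * n%:R * \sum_(j | sg j) \sum_(l | ~~ sg l) cabs (P s j l).
Definition um s := \sum_(j | ~~ sg j) cabs (y j s).
Definition up s := \sum_(j | sg j) cabs (y j s).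
Definition force j s := \sum_l P s j l * y l s.

Hypotheses (t0 : 0 <= t) (Hd : dichotomy) (Hy : solution)
  (HP : forall j l, L1 0 t (fun s => cabs (P s j l))).

Lemma qnorm_ge0 s : 0 <= qnorm s.
Proof. by apply: sumr_ge0 => j _; apply: sumr_ge0 => l _; exact: cabs_ge0. Qed.

Lemma pnorm_ge0 s : 0 <= pnorm s.
Proof. by rewrite !mulr_ge0// qnorm_ge0. Qed.

Lemma mnorm_ge0 s : 0 <= mnorm s.
Proof.
rewrite !mulr_ge0//.
by apply: sumr_ge0 => j _; apply: sumr_ge0 => l _; exact: cabs_ge0.
Qed.

Lemma um_ge0 s : 0 <= um s.
Proof. by apply: sumr_ge0 => j _; exact: cabs_ge0. Qed.

Lemma up_ge0 s : 0 <= up s.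
Proof. by apply: sumr_ge0 => j _; exact: cabs_ge0. Qed.

Lemma L1_qnorm : L1 0 t qnorm.
Proof. by apply: L1_sum => j; apply: L1_sum => l; exact: HP. Qed.

Lemma L1_pnorm : L1 0 t pnorm.
Proof. by apply: L1Z; exact: L1_qnorm. Qed.

Lemma L1_mnorm : L1 0 t mnorm.
Proof. by apply: L1Z; apply: L1_sum => j; apply: L1_sum => l; exact: HP. Qed.

Lemma cont_um : cont 0 t um.
Proof. by apply: cont_sum => j; exact: (cac_cont t0 (Hy j)). Qed.

Lemma cont_up : cont 0 t up.
Proof. by apply: cont_sum => j; exact: (cac_cont t0 (Hy j)). Qed.

Lemma row_le (Q : pred 'I_n) j s : cabs (\sum_(l | Q l) P s j l * y l s) <=
  (\sum_(l | Q l) cabs (P s j l)) * \sum_(l | Q l) cabs (y l s).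
Proof.
apply: (le_trans (cabs_sum _ _)); under eq_bigr do rewrite cabsM.
by apply: sumM_le => i; exact: cabs_ge0.
Qed.

Lemma qnorm_row j s : \sum_l cabs (P s j l) <= qnorm s.
Proof.
apply: (ler_sum1 (f := fun j => \sum_l cabs (P s j l))) => // i.
by rewrite sumr_ge0// => l _; rewrite cabs_ge0.
Qed.

Lemma force_le j s : cabs (force j s) <= qnorm s * (um s + up s).
Proof.
apply: (le_trans (row_le _ _ _)).
rewrite [X in _ * X](bigID sg)/= [X in _ * X]addrC -/(um s) -/(up s).
by rewrite ler_wpM2r ?qnorm_row// addr_ge0 ?um_ge0 ?up_ge0.
Qed.

Lemma force_le_pos j s : sg j ->
  cabs (force j s) <= (\sum_(j | sg j) \sum_(l | ~~ sg l) cabs (P s j l)) * um s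
    + qnorm s * up s.
Proof.
move=> sj; rewrite /force (bigID sg)/= addrC; apply: (le_trans (cabsD _ _)).
apply: lerD; apply: (le_trans (row_le _ _ _)).
  apply: ler_wpM2r; first exact: um_ge0.
  apply: (ler_sum1 (f := fun j => \sum_(l | ~~ sg l) cabs (P s j l))) => // i.
  by rewrite sumr_ge0// => l _; rewrite cabs_ge0.
apply: ler_wpM2r; first exact: up_ge0.
by apply: le_trans (qnorm_row j s); apply: ler_sum_all => i; exact: cabs_ge0.
Qed.

Lemma cac_id (u v : R) : u <= v -> cac u v (fun s => s%:C) (fun=> 1).
Proof.
move=> uv; split => /=.
  split=> [|x /andP[ux xv]]; first exact: L1_cst.
  by rewrite Rint_cst// mul1r addrC subrK.
by split=> [|x /andP[ux xv]]; [exact: L1_cst|rewrite Rint_cst// mul0r addr0].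
Qed.

(** The integrating factor is normalised to be 1 at [x0]: increments between [x0] and an end point
    compare [y j x0] with the freely transported boundary value, and only the perturbation is left
    in the density. *)
Lemma duhamel x0 j : cac 0 t (fun s => cexp (a j * (x0 - s)%:C) * y j s)
  (fun s => cexp (a j * (x0 - s)%:C) * force j s).
Proof.
have H := cacD (cac_cst (a j * x0%:C) t0) (cacN (cacZ (a j) t0 (cac_id t0))).
apply: (cac_eq _ (cac_eq_der _ (cacM t0 (cac_cexp t0 H) (Hy j)))) => s _.
  by rewrite rmorphB/= mulrBr.
have -> : a j * (x0 - s)%:C = a j * x0%:C - a j * s%:C by rewrite rmorphB mulrBr.
by rewrite /force; ring.
Qed.

Lemma ReMr (z : R[i]) (r : R) : Re (z * r%:C) = Re z * r.
Proof. by rewrite ReM/= mulr0 subr0. Qed.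

(** Decaying components are integrated forward from 0 and growing ones backward from [t], so that
    the free propagator is always at most e^{-k|x-s|}. *)
Lemma minus_est j x : ~~ sg j -> 0 <= x <= t ->
  cabs (y j x - cexp (a j * x%:C) * y j 0) <=
  expR (- k * x) * (2 * Rint 0 x (fun s => qnorm s * (expR (k * s) * (um s + up s)))).
Proof.
move=> sj /andP[x0 xt]; have [k0 am _] := Hd.
have L1g : L1 0 x (fun s => qnorm s * (expR (k * s) * (um s + up s))).
  apply: (@eq_L1 _ _ _ (fun s => (expR (k * s + 0) * (um s + up s)) * qnorm s)).
    by move=> s _; rewrite mulrC addr0.
  apply: L1Mcont; last by apply: L1_sub L1_qnorm.
  apply: contM; first exact: cont_expR.
  by apply: contD; [apply: cont_sub cont_um|apply: cont_sub cont_up].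
have := cac_incr (duhamel x j) (lexx 0) x0 xt
  (g := fun s => expR (- k * x) * (qnorm s * (expR (k * s) * (um s + up s)))).
rewrite subrr mulr0 cexp0 mul1r subr0 RintZ// mulrCA; apply; first exact: L1Z.
move=> s /andP[s0 sx]; rewrite cabsM cabs_cexp ReMr.
have -> : expR (- k * x) * (qnorm s * (expR (k * s) * (um s + up s))) =
    expR (- k * (x - s)) * (qnorm s * (um s + up s)).
  by rewrite (_ : - k * (x - s) = - k * x + k * s) ?expRD; ring.
rewrite ler_pM ?cabs_ge0 ?expR_ge0 ?force_le//.
by rewrite ler_expR; have := am _ sj; nra.
Qed.

(** With zero data at [t] the integral over [x, t] is the whole component. The factor 2 comes from
    [cac_incr] and the factor [n] from summing over the growing indices. *)
Lemma plus_est x : (forall j, sg j -> y j t = 0) -> 0 <= x <= t ->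
  up x <= Rint x t (fun s => expR (- k * (s - x)) * (mnorm s * um s + pnorm s * up s)).
Proof.
move=> yt /andP[x0 xt]; have [k0 _ ap] := Hd.
pose w s := (\sum_(j | sg j) \sum_(l | ~~ sg l) cabs (P s j l)) * um s + qnorm s * up s.
have w0 s : 0 <= w s.
  rewrite addr_ge0// mulr_ge0 ?um_ge0 ?up_ge0 ?qnorm_ge0//.
  by apply: sumr_ge0 => j _; apply: sumr_ge0 => l _; exact: cabs_ge0.
have L1w : L1 x t w.
  apply: L1_sub x0 (lexx t) _; apply: L1D.
    apply: (@eq_L1 _ _ _ (fun s => um s * \sum_(j | sg j) \sum_(l | ~~ sg l) cabs (P s j l))).
      by move=> s _; rewrite mulrC.
    apply: L1Mcont; first exact: cont_um.
    by apply: L1_sum => j; apply: L1_sum => l; exact: HP.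
  apply: (@eq_L1 _ _ _ (fun s => up s * qnorm s)); first by move=> s _; rewrite mulrC.
  by apply: L1Mcont; [exact: cont_up|exact: L1_qnorm].
have L1g : L1 x t (fun s => expR (- k * (s - x)) * w s).
  apply: (@eq_L1 _ _ _ (fun s => expR (- k * s + k * x) * w s)).
    by move=> s _; congr (expR _ * _); ring.
  by apply: L1Mcont => //; exact: cont_expR.
have -> : Rint x t (fun s => expR (- k * (s - x)) * (mnorm s * um s + pnorm s * up s))
    = n%:R * (2 * Rint x t (fun s => expR (- k * (s - x)) * w s)).
  rewrite mulrA [n%:R * 2]mulrC -RintZ//; apply: eq_Rint => s _.
  by rewrite /w /mnorm /pnorm; ring.
apply: ler_sum_cst => [|j sj].
  by rewrite mulr_ge0// Rint_ge0// => s _; rewrite mulr_ge0 ?expR_ge0.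
have := cac_incr (duhamel x j) x0 xt (lexx t) L1g.
rewrite yt// mulr0 subrr mulr0 cexp0 mul1r sub0r cabsN; apply.
move=> s /andP[xs st]; rewrite cabsM cabs_cexp ReMr.
rewrite ler_pM ?cabs_ge0 ?expR_ge0 ?force_le_pos//.
by rewrite ler_expR; have := ap _ sj; nra.
Qed.

(** * Solutions whose growing components vanish at the right end *)

Section zero_right_data.
Variable e : R.
Let L := Rint 0 t pnorm.
Let K := expR L.
Hypotheses (yt : forall j, sg j -> y j t = 0)
  (He : forall x : R, 0 <= x <= t -> Rint x t (fun s => expR (- (2 * k) * (s - x)) * mnorm s) <= e)
  (Hsmall : L * K ^+ 2 * e <= 1 / 2).

Lemma L_ge0 : 0 <= L.
Proof. by apply: Rint_ge0 => s _; exact: pnorm_ge0. Qed.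

Lemma K_ge1 : 1 <= K.
Proof. by rewrite -expR0 ler_expR L_ge0. Qed.

Lemma e_ge0 : 0 <= e.
Proof.
apply: le_trans (He (x := t) _); last by rewrite t0 lexx.
by rewrite Rint_pt.
Qed.

Lemma Rint_pnorm_le x x' : 0 <= x -> x <= x' -> x' <= t -> Rint x x' pnorm <= L.
Proof.
by move=> x0 xx' x't; apply: Rint_sub_le L1_pnorm _ => // s _; exact: pnorm_ge0.
Qed.

(** The rate 2k has two sources: the propagator e^{-k(s-x)} of the growing components and the decay
    e^{-ks} of the components driving them. For v = e^{-ks} [up] the estimate takes the form
    required by backward Gronwall, the forcing by [um] being its constant term. *)
Lemma up_le_um x0 M : 0 <= x0 <= t ->
  (forall s, x0 <= s <= t -> expR (k * s) * um s <= M) ->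
  expR (k * x0) * up x0 <=
    M * K * Rint x0 t (fun s => expR (- (2 * k) * (s - x0)) * mnorm s).
Proof.
move=> /andP[x00 x0t] HM.
have M0 : 0 <= M.
  by apply: le_trans (HM x0 _); rewrite ?lexx// mulr_ge0 ?expR_ge0 ?um_ge0.
pose v s := expR (- k * s + 0) * up s.
have cv : cont 0 t v by apply: contM; [exact: cont_expR|exact: cont_up].
pose G := Rint x0 t (fun s => expR (- (2 * k) * s + 0) * mnorm s).
have L1G x : 0 <= x -> L1 x t (fun s => expR (- (2 * k) * s + 0) * mnorm s).
  by move=> x_0; apply: L1_expM; apply: L1_sub x_0 (lexx _) L1_mnorm.
have L1pv x : 0 <= x -> L1 x t (fun s => pnorm s * v s).
  move=> x_0; apply: L1_sub x_0 (lexx _) _.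
  by apply: eq_L1 (L1Mcont cv L1_pnorm) => s _; rewrite mulrC.
have step x : x0 <= x <= t -> v x <= M * G + Rint x t (fun s => pnorm s * v s).
  move=> /andP[x0x xt]; have x_0 := le_trans x00 x0x.
  have xI : 0 <= x <= t by rewrite x_0.
  have H := plus_est yt xI.
  have L1mp : L1 x t (fun s => mnorm s * um s + pnorm s * up s).
    apply: L1_sub x_0 (lexx t) _; apply: L1D.
      by apply: eq_L1 (L1Mcont cont_um L1_mnorm) => s _; rewrite mulrC.
    by apply: eq_L1 (L1Mcont cont_up L1_pnorm) => s _; rewrite mulrC.
  have {H} H : v x <= Rint x t (fun s => expR (- k * s + 0) * (mnorm s * um s + pnorm s * up s)).
    rewrite /v addr0.
    have -> : Rint x t (fun s => expR (- k * s + 0) * (mnorm s * um s + pnorm s * up s)) =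
      expR (- k * x) * Rint x t (fun s => expR (- k * (s - x)) * (mnorm s * um s + pnorm s * up s)).
      rewrite -RintZ; last first.
        by apply: eq_L1 (L1_expM (- k) (k * x) L1mp) => s _; congr (expR _ * _); ring.
      apply: eq_Rint => s _; rewrite mulrA -expRD; congr (expR _ * _); ring.
    by rewrite ler_pM2l ?expR_gt0.
  apply: (le_trans H).
  apply: (@le_trans _ _ (Rint x t (fun s => M * (expR (- (2 * k) * s + 0) * mnorm s) + pnorm s * v s))).
    apply: le_Rint.
    - exact: L1_expM.
    - by apply: L1D; [apply: L1Z; exact: L1G|exact: L1pv].
    move=> s /andP[xs st].
    have -> : expR (- k * s + 0) * (mnorm s * um s + pnorm s * up s) =
       (expR (- (2 * k) * s + 0) * mnorm s) * (expR (k * s) * um s) + pnorm s * v s.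
      rewrite /v mulrDr; congr (_ + _); last by rewrite mulrCA.
      by rewrite (_ : - k * s + 0 = - (2 * k) * s + 0 + k * s) ?expRD; ring.
    rewrite lerD2r [leRHS]mulrC ler_wpM2l ?HM ?(le_trans x0x)//.
    by rewrite mulr_ge0 ?expR_ge0 ?mnorm_ge0.
  rewrite RintD; [|by apply: L1Z; exact: L1G|exact: L1pv].
  rewrite lerD2r RintZ ?L1G//; apply: ler_wpM2l => //.
  by apply: Rint_sub_le (L1G _ x00) _ => // s _; rewrite mulr_ge0 ?expR_ge0 ?mnorm_ge0.
have cv0 : cont x0 t v by apply: cont_sub cv.
have hp0 : L1 x0 t pnorm by apply: L1_sub L1_pnorm.
have G0 : 0 <= G.
  by apply: Rint_ge0 => s _; rewrite mulr_ge0 ?expR_ge0 ?mnorm_ge0.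
have := gronwall_rev x0t cv0 hp0 (fun s _ => pnorm_ge0 s) step.
have EG : Rint x0 t (fun s => expR (- (2 * k) * (s - x0)) * mnorm s) = expR (2 * k * x0) * G.
  rewrite -RintZ ?L1G//; apply: eq_Rint => s _; rewrite mulrA -expRD.
  by congr (expR _ * _); ring.
move=> H; rewrite EG.
have -> : expR (k * x0) * up x0 = expR (2 * k * x0) * v x0.
  rewrite /v mulrA -expRD; congr (expR _ * _); ring.
have -> : M * K * (expR (2 * k * x0) * G) = expR (2 * k * x0) * (M * G * K) by ring.
apply: ler_wpM2l; first exact: expR_ge0.
have H2 : M * G * expR (Rint x0 t pnorm) <= M * G * K.
  apply: ler_wpM2l; first exact: mulr_ge0.
  by rewrite ler_expR; apply: Rint_pnorm_le.
exact: le_trans H H2.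
Qed.

(** Forward Gronwall for e^{ks} [um]; the growing components enter only as a source of total mass at
    most L Mp. *)
Lemma um_le x Mp : 0 <= Mp -> (forall s, 0 <= s <= t -> expR (k * s) * up s <= Mp) ->
  0 <= x <= t -> expR (k * x) * um x <= (um 0 + L * Mp) * K.
Proof.
move=> Mp0 HMp /andP[x0 xt].
pose U s := expR (k * s + 0) * um s.
have cU : cont 0 t U by apply: contM; [exact: cont_expR|exact: cont_um].
have L1pU : L1 0 t (fun s => pnorm s * U s).
  by apply: eq_L1 (L1Mcont cU L1_pnorm) => s _; rewrite mulrC.
have step s : 0 <= s <= t -> U s <= (um 0 + L * Mp) + Rint 0 s (fun r => pnorm r * U r).
  move=> sI; have /andP[s0 st] := sI.
  pose I0 := Rint 0 s (fun r => qnorm r * (expR (k * r) * (um r + up r))).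
  have I00 : 0 <= I0.
    apply: Rint_ge0 => r _; rewrite mulr_ge0 ?qnorm_ge0// mulr_ge0 ?expR_ge0//.
    by rewrite addr_ge0 ?um_ge0 ?up_ge0.
  have H1 j : ~~ sg j -> expR (k * s) * cabs (y j s) <= cabs (y j 0) + 2 * I0.
    move=> sj; have := minus_est sj sI; rewrite -/I0 => H.
    have H2 : cabs (y j s) <= expR (- k * s) * (cabs (y j 0) + 2 * I0).
      rewrite -[y j s](subrK (cexp (a j * s%:C) * y j 0)) (le_trans (cabsD _ _))//.
      rewrite mulrDr addrC lerD// cabsM cabs_cexp ReMr ler_wpM2r ?cabs_ge0//.
      by rewrite ler_expR ler_wpM2r//; case: Hd => _ + _; exact.
    by rewrite -ler_pdivlMl ?expR_gt0// -expRN -mulNr.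
  have H2 : U s <= um 0 + n%:R * (2 * I0).
    rewrite /U addr0 mulr_sumr.
    apply: (@le_trans _ _ (\sum_(j | ~~ sg j) (cabs (y j 0) + 2 * I0))).
      by apply: ler_sum => j; exact: H1.
    by rewrite big_split/= lerD2l; apply: ler_sum_cst => //; rewrite mulr_ge0.
  apply: (le_trans H2); rewrite -addrA lerD2l.
  have L1pUs : L1 0 s (fun r => pnorm r * U r) by apply: L1_sub L1pU.
  have L1ps : L1 0 s pnorm by apply: L1_sub L1_pnorm.
  have -> : n%:R * (2 * I0) = Rint 0 s (fun r => pnorm r * (expR (k * r) * (um r + up r))).
    rewrite /I0 mulrA [n%:R * 2]mulrC -RintZ.
      by apply: eq_Rint => r _; rewrite /pnorm; ring.
    apply: (@eq_L1 _ _ _ (fun r => (expR (k * r + 0) * (um r + up r)) * qnorm r)).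
      by move=> r _; rewrite addr0 mulrC.
    apply: L1Mcont; last by apply: L1_sub L1_qnorm.
    apply: contM; first exact: cont_expR.
    by apply: contD; [apply: cont_sub cont_um|apply: cont_sub cont_up].
  apply: (@le_trans _ _ (Rint 0 s (fun r => Mp * pnorm r + pnorm r * U r))).
    apply: le_Rint.
    - apply: (@eq_L1 _ _ _ (fun r => (expR (k * r + 0) * (um r + up r)) * pnorm r)).
        by move=> r _; rewrite addr0 mulrC.
      apply: L1Mcont => //.
      apply: contM; first exact: cont_expR.
      by apply: contD; [apply: cont_sub cont_um|apply: cont_sub cont_up].
    - by apply: L1D => //; exact: L1Z.
    move=> r /andP[r0 rs]; rewrite /U addr0 [Mp * _]mulrC -mulrDr ler_wpM2l ?pnorm_ge0//.
    by rewrite mulrDr addrC lerD2r HMp// r0 (le_trans rs).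
  rewrite RintD//; last exact: L1Z.
  by rewrite RintZ// lerD2r mulrC ler_wpM2r// Rint_pnorm_le.
have := gronwall t0 cU L1_pnorm (fun s _ => pnorm_ge0 s) step.
move=> /(_ x); rewrite x0 xt /U addr0 => /(_ isT) H; apply: (le_trans H).
apply: ler_wpM2l; last by rewrite ler_expR Rint_pnorm_le.
by apply: addr_ge0 (um_ge0 0) (mulr_ge0 L_ge0 Mp0).
Qed.

(** A bootstrap: with M the maximum of e^{ks} [um], [up_le_um] followed by [um_le] gives M <= K
    [um 0] + (L K^2 e) M, and [Hsmall] allows the last term, at most M / 2, to be absorbed. The
    maximum is attained, so M is finite beforehand. *)
Lemma um_bound x : 0 <= x <= t -> expR (k * x) * um x <= 2 * K * um 0.
Proof.
have cU : cont 0 t (fun s => expR (k * s + 0) * um s).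
  by apply: contM; [exact: cont_expR|exact: cont_um].
have [c cI Hc] := EVT_max t0 cU.
pose M := expR (k * c + 0) * um c.
have HM s : 0 <= s <= t -> expR (k * s) * um s <= M.
  by move=> sI; have := Hc s; rewrite in_itv/= addr0; exact.
have M0 : 0 <= M by rewrite mulr_ge0 ?expR_ge0 ?um_ge0.
have K1 := K_ge1; have K0 : 0 <= K by apply: le_trans K1.
have Hp s : 0 <= s <= t -> expR (k * s) * up s <= M * K * e.
  move=> sI; apply: (le_trans (up_le_um sI _)).
    move=> r /andP[sr rt]; apply: HM; rewrite rt andbT (le_trans _ sr)//.
    by case/andP: sI.
  by apply: ler_wpM2l (He sI); rewrite mulr_ge0.
have cI' : 0 <= c <= t by move: cI; rewrite in_itv.
have H : M <= (um 0 + L * (M * K * e)) * K.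
  have MKe0 : 0 <= M * K * e by rewrite mulr_ge0 ?e_ge0// mulr_ge0.
  by rewrite {1}/M addr0; exact: um_le MKe0 Hp cI'.
have M2 : M <= 2 * K * um 0.
  have : L * (M * K * e) * K <= M / 2.
    have -> : L * (M * K * e) * K = M * (L * K ^+ 2 * e) by ring.
    by have := ler_wpM2l M0 Hsmall; lra.
  by move: H; rewrite mulrDl; lra.
by move=> xI; apply: le_trans M2; exact: HM.
Qed.

Lemma up_bound x : 0 <= x <= t -> expR (k * x) * up x <=
  2 * K ^+ 2 * um 0 * Rint x t (fun s => expR (- (2 * k) * (s - x)) * mnorm s).
Proof.
move=> xI; have := up_le_um xI (M := 2 * K * um 0).
have -> : 2 * K * um 0 * K = 2 * K ^+ 2 * um 0 by ring.
apply=> s /andP[xs st]; apply: um_bound; rewrite st (le_trans _ xs)//.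
by case/andP: xI.
Qed.

Lemma up_bound_cst x : 0 <= x <= t -> expR (k * x) * up x <= 2 * K ^+ 2 * um 0 * e.
Proof.
move=> xI; apply: (le_trans (up_bound xI)).
by rewrite ler_wpM2l ?He// !mulr_ge0 ?um_ge0 ?exprn_ge0 ?expR_ge0.
Qed.

(** The factor [Rint 0 x pnorm] is what matters: it is small near 0, so there the decaying
    components are free exponentials to leading order. *)
Lemma minus_bound j x : ~~ sg j -> 0 <= x <= t ->
  cabs (y j x - cexp (a j * x%:C) * y j 0) <=
  expR (- k * x) * (2 * K * (1 + K * e) * um 0 * Rint 0 x pnorm).
Proof.
move=> sj xI; apply: (le_trans (minus_est sj xI)).
have /andP[x0 xt] := xI.
rewrite ler_pM2l ?expR_gt0//.
have n1 : 1 <= n%:R :> R by rewrite ler1n; case: (n) j {sj} => // -[].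
have L1q : L1 0 x qnorm by apply: L1_sub L1_qnorm.
have L1p : L1 0 x pnorm by apply: L1_sub L1_pnorm.
rewrite -!RintZ//.
  apply: le_Rint; [|exact: L1Z|].
    apply: L1Z; apply: (@eq_L1 _ _ _ (fun s => (expR (k * s + 0) * (um s + up s)) * qnorm s)).
      by move=> s _; rewrite mulrC addr0.
    apply: L1Mcont => //; apply: contM; first exact: cont_expR.
    by apply: contD; [apply: cont_sub cont_um|apply: cont_sub cont_up].
  move=> s /andP[s0 sx]; have sI : 0 <= s <= t by rewrite s0 (le_trans sx).
  rewrite mulrA [leRHS]mulrC; apply: ler_pM.
  - by rewrite mulr_ge0 ?qnorm_ge0.
  - by rewrite mulr_ge0 ?expR_ge0 ?addr_ge0 ?um_ge0 ?up_ge0.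
  - rewrite /pnorm ler_wpM2r ?qnorm_ge0//; lra.
  rewrite mulrDr (_ : 2 * K * (1 + K * e) * um 0 = 2 * K * um 0 + 2 * K ^+ 2 * um 0 * e).
    by rewrite lerD ?um_bound ?up_bound_cst.
  by ring.
apply: (@eq_L1 _ _ _ (fun s => (expR (k * s + 0) * (um s + up s)) * qnorm s)).
  by move=> s _; rewrite mulrC addr0.
apply: L1Mcont => //; apply: contM; first exact: cont_expR.
by apply: contD; [apply: cont_sub cont_um|apply: cont_sub cont_up].
Qed.

Lemma Rint_expR_le (u v c : R) : 0 < c -> u <= v ->
  Rint u v (fun s => expR (- c * (s - u))) <= c^-1.
Proof.
move=> c0 uv.
have [Hid _] := cac_id uv.
have Hlin := acZ (- c) (acB Hid (ac_cst u uv)).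
have H := ac_exp uv Hlin.
have := ac_diff H (lexx u) uv (lexx v).
rewrite /= subrr mulr0 expR0.
have -> : Rint u v (fun s => expR (- c * (s - u)) * (- c * (1 - 0))) =
    - c * Rint u v (fun s => expR (- c * (s - u))).
  rewrite -RintZ; first by apply: eq_Rint => s _; ring.
  apply: L1_cont; have := @cont_expR _ u v (- c) (c * u).
  congr (cont _ _ _); apply/funext => s; congr expR; ring.
move=> E; rewrite -[c^-1]mulr1 mulrC ler_pdivlMr// mulrC.
by have := expR_gt0 (- c * (v - u)); lra.
Qed.

(** * The first-order term of a growing component at the left end *)

Section refined.
Variables (l0 j0 : 'I_n) (c0 : R[i]) (h M0 eta : R).
Hypotheses (sl0 : ~~ sg l0) (sj0 : sg j0) (k_gt0 : 0 < k) (e1 : e <= 1)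
  (y0 : forall l, ~~ sg l -> y l 0 = (l == l0)%:R)
  (h0 : 0 < h) (ht : 2 * h <= t) (eta0 : 0 <= eta)
  (Hc : forall s : R, 0 <= s <= 2 * h -> cabs (P s j0 l0 - c0) <= eta)
  (Hm : forall s : R, 0 <= s <= 2 * h -> mnorm s <= M0)
  (HL : Rint 0 (2 * h) pnorm <= eta).
Let C3 := 2 * K * (1 + K).

Lemma um0E : um 0 = 1.
Proof.
rewrite /um (bigD1 l0)//= y0// eqxx/= big1 ?addr0; first exact: cabs1.
by move=> l /andP[sl ll0]; rewrite y0// (negbTE ll0) cabs0.
Qed.

Lemma a_gap : Re (a l0 - a j0) <= - (2 * k).
Proof.
case: Hd => _ /(_ _ sl0) am /(_ _ sj0) ap.
by rewrite ReD ReN; lra.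
Qed.

(** The force on [j0] is compared with its leading part c0 e^{a_l0 s}. The three errors are the
    variation of the coefficient, the deviation of the decaying components from free exponentials,
    and the feedback of the growing ones. Each carries e^{-2ks}: one e^{-ks} from the twist by
    e^{-a_j0 s}, the other from the decay of the solution. *)
Lemma pert_le s : 0 <= s <= t ->
  cabs (cexp (a j0 * (0 - s)%:C) * (force j0 s - c0 * cexp (a l0 * s%:C))) <=
  expR (- (2 * k) * s) * (cabs (P s j0 l0 - c0) + mnorm s * (C3 * Rint 0 s pnorm)
     + qnorm s * (expR (k * s) * up s)).
Proof.
move=> sI; have /andP[s0 st] := sI; have [_ am ap] := Hd.
have K1 := K_ge1; have K0 : 0 <= K by exact: le_trans K1.
have e0 := e_ge0.
have n1 : 1 <= n%:R :> R by rewrite ler1n; case: (n) j0 => // -[].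
have I0 : 0 <= Rint 0 s pnorm by apply: Rint_ge0 => r _; exact: pnorm_ge0.
pose d l := y l s - cexp (a l * s%:C) * y l 0.
have -> : force j0 s - c0 * cexp (a l0 * s%:C) =
    (P s j0 l0 - c0) * cexp (a l0 * s%:C) + \sum_(l | ~~ sg l) P s j0 l * d l
    + \sum_(l | sg l) P s j0 l * y l s.
  rewrite /force (bigID sg)/=.
  have -> : \sum_(l | ~~ sg l) P s j0 l * y l s = \sum_(l | ~~ sg l) P s j0 l * d l
      + P s j0 l0 * cexp (a l0 * s%:C).
    rewrite [X in _ + X](_ : _ = \sum_(l | ~~ sg l) P s j0 l * (cexp (a l * s%:C) * y l 0)).
      by rewrite -big_split/=; apply: eq_bigr => l _; rewrite -mulrDr /d subrK.
    rewrite (bigD1 l0)//= y0// eqxx mulr1 big1 ?addr0// => l /andP[sl ll0].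
    by rewrite y0// (negbTE ll0) !mulr0.
  by ring.
have A1 : cabs ((P s j0 l0 - c0) * cexp (a l0 * s%:C)) <=
    expR (- k * s) * cabs (P s j0 l0 - c0).
  rewrite cabsM cabs_cexp ReMr mulrC ler_wpM2r ?cabs_ge0// ler_expR ler_wpM2r//.
  exact: am.
have A2 : cabs (\sum_(l | ~~ sg l) P s j0 l * d l) <=
    expR (- k * s) * (mnorm s * (C3 * Rint 0 s pnorm)).
  apply: (le_trans (cabs_sum _ _)).
  apply: (@le_trans _ _ (\sum_(l | ~~ sg l)
      cabs (P s j0 l) * (expR (- k * s) * (C3 * Rint 0 s pnorm)))).
    apply: ler_sum => l sl; rewrite cabsM; apply: ler_wpM2l; first exact: cabs_ge0.
    apply: (le_trans (minus_bound sl sI)); rewrite um0E mulr1.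
    apply: ler_wpM2l; first exact: expR_ge0.
    apply: ler_wpM2r => //; rewrite /C3 ler_wpM2l ?mulr_ge0// lerD2l.
    by rewrite -[leRHS]mulr1; exact: ler_wpM2l.
  rewrite -mulr_suml mulrCA; apply: ler_wpM2l; first exact: expR_ge0.
  apply: ler_wpM2r; first by rewrite /C3 !mulr_ge0// addr_ge0.
  apply: (@le_trans _ _ (\sum_(j | sg j) \sum_(l | ~~ sg l) cabs (P s j l))).
    apply: (ler_sum1 (f := fun j => \sum_(l | ~~ sg l) cabs (P s j l))) => // i.
    by rewrite sumr_ge0// => l _; rewrite cabs_ge0.
  rewrite /mnorm ler_peMl//; last by lra.
  by apply: sumr_ge0 => j _; apply: sumr_ge0 => l _; exact: cabs_ge0.
have A3 : cabs (\sum_(l | sg l) P s j0 l * y l s) <=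
    expR (- k * s) * (qnorm s * (expR (k * s) * up s)).
  have -> : expR (- k * s) * (qnorm s * (expR (k * s) * up s)) = qnorm s * up s.
    rewrite -[RHS]mul1r -expR0 -(addNr (k * s)) -mulNr expRD; ring.
  apply: (le_trans (row_le _ _ _)); apply: ler_wpM2r; first exact: up_ge0.
  by apply: le_trans (qnorm_row j0 s); apply: ler_sum_all => i; exact: cabs_ge0.
rewrite cabsM cabs_cexp ReMr sub0r.
have -> : - (2 * k) * s = - k * s + - k * s by ring.
rewrite expRD -[leRHS]mulrA; apply: ler_pM; rewrite ?cabs_ge0 ?expR_ge0//.
  by rewrite ler_expR mulrN mulNr lerN2 ler_wpM2r// ap.
apply: (le_trans (cabsD _ _)); rewrite !mulrDr; apply: lerD => //.
by apply: (le_trans (cabsD _ _)); exact: lerD.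
Qed.

Let E := expR (- (2 * k) * h).

(** The kernel integral over [s, t] is cut at s + h. The left piece stays inside [0, 2h], where
    [mnorm] is at most [M0], which is why the assumptions are made up to 2h; on the right piece the
    kernel is at most E. *)
Lemma up_near s : 0 <= s <= h ->
  expR (k * s) * up s <= 2 * K ^+ 2 * (M0 / (2 * k) + E * L).
Proof.
have [h_gt0 h_le kp] := And3 h0 ht k_gt0.
move=> /andP[s0 sh]; have sI : 0 <= s <= t by rewrite s0/=; lra.
have M00 : 0 <= M0.
  by apply: le_trans (mnorm_ge0 0) (Hm _); rewrite lexx/=; lra.
apply: (le_trans (up_bound sI)); rewrite um0E mulr1.
apply: ler_wpM2l; first by rewrite mulr_ge0 ?exprn_ge0 ?expR_ge0.
have L1g u v : 0 <= u -> v <= t -> L1 u v (fun r => expR (- (2 * k) * (r - s)) * mnorm r).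
  move=> u0 vt.
  apply: (@eq_L1 _ _ _ (fun r => expR (- (2 * k) * r + 2 * k * s) * mnorm r)).
    by move=> r _; congr (expR _ * _); ring.
  by apply: L1_expM; apply: L1_sub L1_mnorm.
rewrite (@Rint_chasles _ s (s + h) t); [|lra|lra|exact: L1g].
apply: lerD.
  apply: (@le_trans _ _ (Rint s (s + h) (fun r => M0 * expR (- (2 * k) * (r - s))))).
    apply: le_Rint; [by apply: L1g; lra| |].
      apply: L1Z; apply: L1_cont; have := @cont_expR _ s (s + h) (- (2 * k)) (2 * k * s).
      congr (cont _ _ _); apply/funext => r; congr expR; ring.
    move=> r /andP[sr rh]; rewrite mulrC ler_wpM2r ?expR_ge0// Hm//.
    by rewrite (le_trans s0)//=; lra.
  rewrite RintZ; last first.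
    apply: L1_cont; have := @cont_expR _ s (s + h) (- (2 * k)) (2 * k * s).
    congr (cont _ _ _); apply/funext => r; congr expR; ring.
  by apply: ler_wpM2l => //; apply: Rint_expR_le; lra.
apply: (@le_trans _ _ (Rint (s + h) t (fun r => E * pnorm r))).
  apply: le_Rint; [by apply: L1g; lra| |].
    by apply: L1Z; apply: L1_sub L1_pnorm; lra.
  move=> r /andP[sr rt]; apply: ler_pM; rewrite ?expR_ge0 ?mnorm_ge0//.
    rewrite ler_expR !mulNr lerN2 ler_wpM2l//; lra.
  rewrite /mnorm /pnorm ler_wpM2l ?mulr_ge0//.
  apply: (@le_trans _ _ (\sum_(j | sg j) \sum_l cabs (P r j l))).
    by apply: ler_sum => j _; apply: ler_sum_all => l; exact: cabs_ge0.
  by apply: ler_sum_all => j; apply: sumr_ge0 => l _; exact: cabs_ge0.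
rewrite RintZ; last by apply: L1_sub L1_pnorm; lra.
by rewrite ler_wpM2l ?expR_ge0//; apply: Rint_pnorm_le; lra.
Qed.

(** As [y j0] vanishes at [t], its value at 0 is minus the integral of the twisted force, whose
    leading part integrates to c0 / (a_j0 - a_l0) up to an exponentially small end term. Of the
    errors, those produced on [0, h] have a factor [eta] together with 1 / (2k) or E, and those
    beyond h have the factor E. *)
Lemma refined_asymptotics :
  cabs (y j0 0 + c0 / (a j0 - a l0)) <=
  2 * ((eta + M0 * (C3 * eta)) / (2 * k) + 2 * K ^+ 2 * (M0 / (2 * k) + E * L) * eta
       + E * ((1 + C3 * L + 2 * K ^+ 2) * L + cabs c0 * t)) + cabs c0 / (2 * k) * E.
Proof.
have K1 := K_ge1; have K0 : 0 <= K by exact: le_trans K1.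
have e0 := e_ge0; have L0 := L_ge0.
have [h_gt0 h_le kp] := And3 h0 ht k_gt0.
have C30 : 0 <= C3 by rewrite /C3 !mulr_ge0// addr_ge0.
have CL0 : 0 <= C3 * L by exact: mulr_ge0.
have K20 : 0 <= 2 * K ^+ 2 by rewrite mulr_ge0// exprn_ge0.
have M00 : 0 <= M0.
  by apply: le_trans (mnorm_ge0 0) (Hm _); rewrite lexx/=; lra.
have k20 : 0 <= (2 * k)^-1 by rewrite invr_ge0; lra.
have n1 : 1 <= n%:R :> R by rewrite ler1n; case: (n) j0 => // -[].
have qp s : qnorm s <= pnorm s by rewrite /pnorm ler_peMl ?qnorm_ge0//; lra.
have gap := a_gap.
have gap_neq0 : a l0 - a j0 != 0.
  by apply/eqP => g0; move: gap; rewrite g0/=; lra.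
pose w s := c0 / (a l0 - a j0) * cexp ((a l0 - a j0) * s%:C).
have Hw : cac 0 t w (fun s => c0 * cexp ((a l0 - a j0) * s%:C)).
  have H := cacZ (c0 / (a l0 - a j0)) t0 (cac_cexp t0 (cacZ (a l0 - a j0) t0 (cac_id t0))).
  by apply: cac_eq_der H => s _; rewrite mulr1 [cexp _ * _]mulrC mulrA divfK.
pose D s := cexp (a j0 * (0 - s)%:C) * y j0 s - w s.
have HD : cac 0 t D
    (fun s => cexp (a j0 * (0 - s)%:C) * (force j0 s - c0 * cexp (a l0 * s%:C))).
  apply: cac_eq_der (cacD (duhamel 0 j0) (cacN Hw)) => s _.
  have -> : cexp ((a l0 - a j0) * s%:C) = cexp (a j0 * (0 - s)%:C) * cexp (a l0 * s%:C).
    by rewrite -cexpD sub0r rmorphN/=; congr cexp; ring.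
  by ring.
(* The left-hand side is [D 0], while [D t] equals - [w t] because [y j0 t] vanishes. *)
have E1 : y j0 0 + c0 / (a j0 - a l0) = - (D t - D h) - (D h - D 0) - w t.
  rewrite /D yt// mulr0 subrr mulr0 cexp0 mul1r /w mulr0 cexp0 mulr1.
  by rewrite -[a j0 - a l0]opprB invrN mulrN; ring.
have B1 : cabs (w t) <= cabs c0 / (2 * k) * E.
  rewrite /w cabsM cabs_cexp ReMr cabsM cabsV; apply: ler_pM.
  - by rewrite mulr_ge0 ?invr_ge0 ?cabs_ge0.
  - exact: expR_ge0.
  - apply: ler_wpM2l; first exact: cabs_ge0.
    rewrite lef_pV2 ?posrE; last 2 first.
    + rewrite lt_neqAle cabs_ge0 andbT eq_sym; apply/eqP => /cabs0_eq0 /eqP.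
      exact/negP.
    + lra.
    by apply: le_trans (Re_le_cabs _); rewrite ler0_norm; lra.
  - rewrite ler_expR; nra.
(* Far from 0 the coefficients are merely summable, and crude bounds suffice since the kernel
   contributes E. *)
have B2 : cabs (D t - D h) <=
    2 * (E * ((1 + C3 * L + 2 * K ^+ 2) * L + cabs c0 * t)).
  have L1ph : L1 h t pnorm by apply: L1_sub L1_pnorm; lra.
  have L1g : L1 h t (fun s => (1 + C3 * L + 2 * K ^+ 2) * pnorm s + cabs c0).
    by apply: L1D; [exact: L1Z|exact: L1_cst].
  have := cac_incr HD (ltW h0) _ (lexx t) (L1Z E L1g).
  rewrite RintZ// RintD; [|exact: L1Z|exact: L1_cst].
  rewrite RintZ// Rint_cst; last lra.
  move=> H; apply: (le_trans (H _ _)); first lra.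
    move=> s /andP[hs st]; have sI : 0 <= s <= t by rewrite st (le_trans _ hs)// ltW.
    have I0 : 0 <= Rint 0 s pnorm by apply: Rint_ge0 => r _; exact: pnorm_ge0.
    have CI0 := mulr_ge0 C30 I0.
    have Up0 := mulr_ge0 (expR_ge0 (k * s)) (up_ge0 s).
    apply: (le_trans (pert_le sI)); apply: ler_pM.
    - exact: expR_ge0.
    - apply: addr_ge0 (mulr_ge0 (qnorm_ge0 s) Up0).
      exact: addr_ge0 (cabs_ge0 _) (mulr_ge0 (mnorm_ge0 s) CI0).
    - by rewrite ler_expR !mulNr lerN2 ler_wpM2l//; lra.
    have h1 : cabs (P s j0 l0 - c0) <= pnorm s + cabs c0.
      apply: (le_trans (cabsB _ _)); rewrite lerD2r (le_trans _ (qp s))//.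
      apply: le_trans (qnorm_row j0 s).
      by apply: (ler_sum1 (f := fun l => cabs (P s j0 l))) => // i; exact: cabs_ge0.
    have h2 : mnorm s * (C3 * Rint 0 s pnorm) <= C3 * L * pnorm s.
      rewrite [leRHS]mulrC; apply: ler_pM => //; first exact: mnorm_ge0.
      - rewrite /mnorm /pnorm ler_wpM2l ?mulr_ge0//.
        apply: (@le_trans _ _ (\sum_(j | sg j) \sum_l cabs (P s j l))).
          by apply: ler_sum => j _; apply: ler_sum_all => l; exact: cabs_ge0.
        by apply: ler_sum_all => j; apply: sumr_ge0 => l _; exact: cabs_ge0.
      - by apply: ler_wpM2l => //; apply: Rint_pnorm_le => //; lra.
    have h3 : qnorm s * (expR (k * s) * up s) <= 2 * K ^+ 2 * pnorm s.
      rewrite [leRHS]mulrC; apply: ler_pM => //; first exact: qnorm_ge0.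
      apply: (le_trans (up_bound_cst sI)); rewrite um0E mulr1.
      by rewrite -[leRHS]mulr1 ler_wpM2l// mulr_ge0// exprn_ge0.
    by lra.
  rewrite ler_wpM2l// ler_wpM2l ?expR_ge0//; apply: lerD.
    apply: ler_wpM2l; first by apply: addr_ge0 => //; exact: addr_ge0.
    by apply: Rint_pnorm_le; lra.
  by apply: ler_wpM2l; [exact: cabs_ge0|lra].
(* Near 0 the first two errors are uniformly small and integrate against the kernel to O(eta / k).
   For the feedback term the kernel is bounded by 1: [up_near] already supplies the small factor and
   [HL] the [eta]. *)
have B3 : cabs (D h - D 0) <=
    2 * ((eta + M0 * (C3 * eta)) / (2 * k) + 2 * K ^+ 2 * (M0 / (2 * k) + E * L) * eta).
  pose A := eta + M0 * (C3 * eta); pose B := 2 * K ^+ 2 * (M0 / (2 * k) + E * L).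
  have A0 : 0 <= A by apply: addr_ge0 => //; apply: mulr_ge0 => //; exact: mulr_ge0.
  have B0 : 0 <= B.
    apply: mulr_ge0 => //; apply: addr_ge0; first exact: mulr_ge0.
    by apply: mulr_ge0 => //; exact: expR_ge0.
  have L1ph : L1 0 h pnorm by apply: L1_sub L1_pnorm; lra.
  have L1e : L1 0 h (fun s => expR (- (2 * k) * (s - 0))).
    apply: L1_cont; have := @cont_expR _ 0 h (- (2 * k)) 0.
    congr (cont _ _ _); apply/funext => r; congr expR; ring.
  have L1g : L1 0 h (fun s => A * expR (- (2 * k) * (s - 0)) + B * pnorm s).
    by apply: L1D; exact: L1Z.
  have := cac_incr HD (lexx 0) (ltW h0) _ L1g.
  rewrite (RintD (L1Z A L1e) (L1Z B L1ph)) (RintZ A L1e) (RintZ B L1ph).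
  move=> H; apply: (le_trans (H _ _)); first lra.
    move=> s /andP[s0 sh]; have sI : 0 <= s <= t by rewrite s0/=; lra.
    apply: (le_trans (pert_le sI)); rewrite mulrDr subr0; apply: lerD.
      rewrite mulrC; apply: ler_wpM2r; first exact: expR_ge0.
      have s2h : 0 <= s <= 2 * h by rewrite s0/=; lra.
      apply: lerD; first exact: Hc.
      apply: ler_pM; [exact: mnorm_ge0| |exact: Hm|].
        by apply: mulr_ge0 => //; apply: Rint_ge0 => r _; exact: pnorm_ge0.
      apply: ler_wpM2l => //; apply: le_trans HL; apply: Rint_sub_le => //.
      - by lra.
      - by apply: L1_sub L1_pnorm.
      - by move=> r _; exact: pnorm_ge0.
    apply: (@le_trans _ _ (qnorm s * (expR (k * s) * up s))).
      apply: ler_piMl; last first.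
        by rewrite -[leRHS]expR0 ler_expR mulNr oppr_le0; apply: mulr_ge0 => //; lra.
      by apply: mulr_ge0 (qnorm_ge0 s) (mulr_ge0 (expR_ge0 _) (up_ge0 s)).
    rewrite [leRHS]mulrC; apply: ler_pM => //; first exact: qnorm_ge0.
      exact: mulr_ge0 (expR_ge0 _) (up_ge0 s).
    by apply: up_near; rewrite s0.
  rewrite ler_wpM2l//; apply: lerD.
    by apply: ler_wpM2l => //; apply: Rint_expR_le; lra.
  apply: ler_wpM2l => //; apply: le_trans HL; apply: Rint_sub_le => //.
  - exact: ltW.
  - by lra.
  - by apply: L1_sub L1_pnorm.
  - by move=> r _; exact: pnorm_ge0.
rewrite E1; apply: (le_trans (cabsB _ _)); apply: lerD => //.
apply: (le_trans (cabsB _ _)); rewrite cabsN.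
by move: B2 B3; lra.
Qed.

End refined.

End zero_right_data.

End bvp.

(** * Time reversal, which exchanges growing and decaying components *)

Section reflected_problem.
Context {R : realType} (n : nat).
Implicit Types (sg : pred 'I_n) (k t : R) (a : 'I_n -> R[i])
  (P : R -> 'I_n -> 'I_n -> R[i]) (y : 'I_n -> R -> R[i]).

Definition refl_coef t P := fun s j l => - P (t - s) j l.

Lemma solution_refl t a P y : 0 <= t -> solution t a P y ->
  solution t (fun j => - a j) (refl_coef t P) (fun j s => y j (t - s)).
Proof.
move=> t0 Hy j; have := cac_refl t t0 (Hy j); rewrite subrr subr0.
apply: cac_eq_der => s _; rewrite opprD mulNr; congr (_ + _).
by rewrite -sumrN; apply: eq_bigr => l _; rewrite mulNr.
Qed.

Lemma dichotomy_refl sg k a : dichotomy sg k a ->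
  dichotomy (fun j => ~~ sg j) k (fun j => - a j).
Proof.
move=> [k0 am ap]; split=> // j sj; rewrite ReN.
  by rewrite lerN2 ap//; move: sj; rewrite negbK.
by rewrite lerNr am.
Qed.

Lemma um_refl sg t y s : um (fun j => ~~ sg j) (fun j s => y j (t - s)) s = up sg y (t - s).
Proof. by apply: eq_bigl => j; rewrite negbK. Qed.

Lemma up_refl sg t y s : up (fun j => ~~ sg j) (fun j s => y j (t - s)) s = um sg y (t - s).
Proof. by []. Qed.

Lemma mnorm_refl sg t P s : mnorm sg (refl_coef t P) s = mnorm sg P (t - s).
Proof.
rewrite /mnorm; congr (_ * _); apply: eq_bigr => j _; apply: eq_bigr => l _.
by rewrite cabsN.
Qed.

Lemma pnorm_refl t P s : pnorm (refl_coef t P) s = pnorm P (t - s).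
Proof.
rewrite /pnorm /qnorm; congr (_ * _); apply: eq_bigr => j _; apply: eq_bigr => l _.
by rewrite cabsN.
Qed.

Lemma L1_refl_coef t P : (forall j l, L1 0 t (fun s => cabs (P s j l))) ->
  forall j l, L1 0 t (fun s => cabs (refl_coef t P s j l)).
Proof.
move=> HP j l; have := L1_refl t (HP j l); rewrite subrr subr0.
by apply: eq_L1 => s _; rewrite cabsN.
Qed.

Lemma Rint_pnorm_refl t P : (forall j l, L1 0 t (fun s => cabs (P s j l))) ->
  Rint 0 t (pnorm (refl_coef t P)) = Rint 0 t (pnorm P).
Proof.
move=> HP; rewrite -(Rint_refl t (L1_pnorm HP)) subrr subr0.
by apply: eq_Rint => s _; rewrite pnorm_refl.
Qed.

End reflected_problem.

(** * Smallness of the exponential kernel against a summable function *)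

Section exponential_kernel.
Context {R : realType}.
Implicit Types (f : R -> R).

Lemma expRN_le (x : R) : 0 < x -> expR (- x) <= x^-1.
Proof.
move=> x0; rewrite expRN lef_pV2 ?posrE ?expR_gt0//.
by have := expR_ge1Dx x; lra.
Qed.

Lemma mul_expRN_le (x : R) : 0 < x -> x * expR (- x) <= 4 / x.
Proof.
move=> x0; have x2 : 0 < x / 2 by lra.
(* The constant 4 comes from squaring e^{-x/2} <= 2 / x. *)
have -> : - x = - (x / 2) + - (x / 2) by lra.
rewrite expRD; have := expRN_le x2; have := expR_ge0 (- (x / 2)).
set E := expR _ => E0 EE.
have : E * E <= (x / 2)^-1 * (x / 2)^-1 by apply: ler_pM.
rewrite -invfM => H; rewrite (_ : 4 / x = x * (x / 2 * (x / 2))^-1).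
  by rewrite ler_wpM2l// ltW.
by field; rewrite gt_eqF.
Qed.

Lemma L1_kernel u v (c d : R) f : L1 u v f -> L1 u v (fun s => expR (c * (s - d)) * f s).
Proof.
move=> hf; apply: eq_L1 (L1_expM c (- c * d) hf) => s _.
by congr (expR _ * _); ring.
Qed.

(** Close to [x] the mass of [f] is small by absolute continuity of its integral, uniformly in [x];
    at distance [dl] or more the kernel is at most e^{-2k dl}. *)
Lemma kernel_small f : L1 0 1 f -> (forall s, 0 <= s <= 1 -> 0 <= f s) ->
  forall e : R, 0 < e -> exists2 k0 : R, 0 < k0 & forall k x x' : R,
    k0 <= k -> 0 <= x -> x <= x' -> x' <= 1 ->
    Rint x x' (fun s => expR (- (2 * k) * (s - x)) * f s) <= e.
Proof.
move=> hf f0 e e0; have e2 : 0 < e / 2 by lra.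
have [d d0 Hd] := Rint_small hf e2.
pose L := Rint 0 1 f.
have L0 : 0 <= L by exact: Rint_ge0.
pose dl := d / 2.
have dl0 : 0 < dl by rewrite /dl; lra.
(* From e^{-2k dl} L <= L / (2k dl), which is at most e / 2 as soon as k >= L / (dl e). *)
exists (L / (dl * e) + 1); first by rewrite ltr_wpDl// divr_ge0// mulr_ge0// ltW.
move=> k x x' kk x0 xx' x'1.
have k_gt0 : 0 < k.
  by apply: lt_le_trans kk; rewrite ltr_wpDl// divr_ge0// mulr_ge0// ltW.
have subL u v : 0 <= u -> v <= 1 -> L1 u v f by move=> *; apply: L1_sub hf.
have near_x z : x <= z -> z - x < d -> z <= 1 ->
    Rint x z (fun s => expR (- (2 * k) * (s - x)) * f s) <= e / 2.
  move=> xz zxd z1; apply: le_trans (ltW (Hd x z x0 xz z1 zxd)).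
  apply: le_Rint; [exact/L1_kernel/subL|exact/L1_norm/subL|].
  move=> s /andP[xs sz]; rewrite ger0_norm; last by rewrite f0// (le_trans x0)//= (le_trans sz).
  apply: ler_piMl; first by rewrite f0// (le_trans x0)//= (le_trans sz).
  rewrite -[leRHS]expR0 ler_expR mulNr oppr_le0 mulr_ge0 ?subr_ge0//; lra.
have [h|h] := ltP (x' - x) d; first by apply: (le_trans (near_x _ xx' h x'1)); lra.
have h1 : x <= x + dl by lra.
have h2 : x + dl <= x' by move: h; rewrite /dl; lra.
rewrite (@Rint_chasles _ x (x + dl) x')//; last exact/L1_kernel/subL.
have -> : e = e / 2 + e / 2 by lra.
apply: lerD; first by apply: near_x => //; rewrite /dl; lra.
have xdl0 : 0 <= x + dl by lra.
apply: (@le_trans _ _ (Rint (x + dl) x' (fun s => expR (- (2 * k) * dl) * f s))).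
  apply: le_Rint; [exact/L1_kernel/subL|exact/L1Z/subL|].
  move=> s /andP[xs sx]; apply: ler_wpM2r.
    by rewrite f0// (le_trans xdl0)//= (le_trans sx).
  by rewrite ler_expR !mulNr lerN2 ler_wpM2l//; lra.
rewrite RintZ; last exact: subL.
apply: (@le_trans _ _ (expR (- (2 * k) * dl) * L)).
  by apply: ler_wpM2l; [exact: expR_ge0|apply: Rint_sub_le].
have kd : 0 < 2 * k * dl by rewrite !mulr_gt0.
rewrite mulNr; apply: (@le_trans _ _ ((2 * k * dl)^-1 * L)).
  by apply: ler_wpM2r => //; exact: expRN_le.
rewrite mulrC ler_pdivrMr//.
have : L / (dl * e) <= k by lra.
by rewrite ler_pdivrMr ?mulr_gt0//; lra.
Qed.

(** Applying [kernel_small] to [f (t - s)] would give a threshold depending on [t]. Reflecting about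
    [t] and then about 1 turns every case into an integral for the single function [f (1 - s)],
    based at the shifted point x + (1 - t). *)
Lemma kernel_small_rev f : L1 0 1 f -> (forall s, 0 <= s <= 1 -> 0 <= f s) ->
  forall e : R, 0 < e -> exists2 k0 : R, 0 < k0 & forall k t x : R,
    k0 <= k -> 0 <= x -> x <= t -> t <= 1 ->
    Rint x t (fun s => expR (- (2 * k) * (s - x)) * f (t - s)) <= e.
Proof.
move=> hf f0 e e0.
have hf' : L1 0 1 (fun s => f (1 - s)).
  by have := L1_refl 1 hf; rewrite subrr subr0.
have [|k0 k00 H] := kernel_small hf' _ e0; first by move=> s s01; rewrite f0//; lra.
exists k0 => // k t x kk x0 xt t1.
have h1 : x + (1 - t) <= 1 by lra.
have h2 : 0 <= x + (1 - t) by lra.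
have := H k (x + (1 - t)) 1 kk h2 h1 (lexx 1).
apply: le_trans.
have L1f : L1 x t (fun s => expR (- (2 * k) * (s - x)) * f (t - s)).
  apply: L1_kernel; apply: L1_sub x0 (lexx t) _.
  have hft : L1 0 t f by apply: L1_sub hf.
  by have := L1_refl t hft; rewrite subrr subr0.
have E1 : Rint x t (fun s => expR (- (2 * k) * (s - x)) * f (t - s)) =
    Rint 0 (t - x) (fun s => expR (- (2 * k) * (t - x - s)) * f s).
  rewrite -(Rint_refl t L1f) subrr; apply: eq_Rint => s _.
  by rewrite subKr; congr (expR _ * _); ring.
have L1g : L1 (x + (1 - t)) 1 (fun s => expR (- (2 * k) * (s - (x + (1 - t)))) * f (1 - s)).
  by apply: L1_kernel; apply: L1_sub hf'.
rewrite E1 -(Rint_refl 1 L1g) subrr.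
have -> : 1 - (x + (1 - t)) = t - x by ring.
rewrite le_eqVlt; apply/orP; left; apply/eqP; apply: eq_Rint => s _.
by rewrite subKr; congr (expR _ * _); ring.
Qed.

End exponential_kernel.

(** * Consequences for large k: the cone and the boundary values *)

Section large_k.
Context {R : realType} (n : nat) (sg : pred 'I_n) (P : R -> 'I_n -> 'I_n -> R[i]).
Hypothesis HP : forall j l, L1 0 1 (fun s => cabs (P s j l)).
Let L := Rint 0 1 (pnorm P).
Let K := expR L.

Lemma um_eq0 (sg' : pred 'I_n) (y : 'I_n -> R -> R[i]) s :
  um sg' y s <= 0 -> forall j, ~~ sg' j -> y j s = 0.
Proof.
move=> u0 j sj; apply: cabs0_eq0; apply/eqP; rewrite eq_le cabs_ge0 andbT.
apply: le_trans u0.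
by apply: (ler_sum1 (f := fun j => cabs (y j s))) => // i; exact: cabs_ge0.
Qed.

Let L0 : 0 <= L.
Proof. by apply: Rint_ge0 => s _; exact: pnorm_ge0. Qed.

Let L_mono t : 0 <= t <= 1 -> Rint 0 t (pnorm P) <= L.
Proof.
move=> /andP[t0 t1]; apply: Rint_sub_le => //; first exact: L1_pnorm.
by move=> s _; exact: pnorm_ge0.
Qed.

Let K_mono t : 0 <= t <= 1 -> expR (Rint 0 t (pnorm P)) ^+ 2 <= K ^+ 2.
Proof.
move=> t01; apply: lerXn2r; [exact: expR_ge0|exact: expR_ge0|].
by rewrite ler_expR; exact: L_mono.
Qed.

Let L1t t : 0 <= t <= 1 -> forall j l, L1 0 t (fun s => cabs (P s j l)).
Proof. by move=> /andP[t0 t1] j l; apply: L1_sub (HP j l). Qed.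

Lemma small_constant (e : R) : 0 <= e -> e <= (2 * (L * K ^+ 2 + 1))^-1 ->
  forall t, 0 <= t <= 1 ->
  Rint 0 t (pnorm P) * expR (Rint 0 t (pnorm P)) ^+ 2 * e <= 1 / 2.
Proof.
move=> e0 ee t t01.
have Lt0 : 0 <= Rint 0 t (pnorm P) by apply: Rint_ge0 => s _; exact: pnorm_ge0.
have LK0 : 0 <= L * K ^+ 2 by rewrite mulr_ge0// exprn_ge0// expR_ge0.
apply: (@le_trans _ _ (L * K ^+ 2 * e)).
  apply: ler_wpM2r; first exact: e0.
  by apply: ler_pM Lt0 _ (L_mono t01) (K_mono t01); rewrite exprn_ge0// expR_ge0.
apply: (@le_trans _ _ (L * K ^+ 2 * (2 * (L * K ^+ 2 + 1))^-1)).
  exact: ler_wpM2l.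
have h : 0 < 2 * (L * K ^+ 2 + 1) by lra.
rewrite ler_pdivrMr//; lra.
Qed.

(* Solutions that start in the growing subspace stay in a thin cone around it. *)
Lemma cone (eta : R) : 0 < eta -> exists2 k0 : R, 0 < k0 & forall k t a y,
  k0 <= k -> 0 <= t <= 1 -> dichotomy sg k a -> solution t a P y ->
  (forall j, ~~ sg j -> y j 0 = 0) ->
  um sg y t <= eta * up sg y t /\ (up sg y t = 0 -> forall j, y j 0 = 0).
Proof.
move=> eta0; have K_gt0 : 0 < K by exact: expR_gt0.
have LK0 : 0 <= L * K ^+ 2 by rewrite mulr_ge0// exprn_ge0// expR_ge0.
(* The first bound makes the slope 2 K^2 e of the cone at most [eta], the second is the smallness
   required by the bootstrap. *)
pose e := Num.min (eta / (2 * K ^+ 2)) (2 * (L * K ^+ 2 + 1))^-1.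
have e0 : 0 < e.
  by rewrite lt_min divr_gt0 ?mulr_gt0 ?exprn_gt0//= invr_gt0; lra.
have mL1 : L1 0 1 (mnorm (fun j => ~~ sg j) P) by exact: L1_mnorm.
have [k0 k00 H] := kernel_small_rev mL1 (fun s _ => mnorm_ge0 _ _ s) e0.
exists k0 => // k t a y kk t01 Hd Hy y0; have /andP[t0 t1] := t01.
have e_le : e <= (2 * (L * K ^+ 2 + 1))^-1 by rewrite ge_min lexx orbT.
have Hsmall := small_constant (ltW e0) e_le t01.
have HPt := L1t t01.
rewrite -(Rint_pnorm_refl HPt) in Hsmall.
have yt j : ~~ sg j -> (fun j s => y j (t - s)) j t = 0.
  by move=> sj /=; rewrite subrr; exact: y0.
have He x : 0 <= x <= t -> Rint x t (fun s => expR (- (2 * k) * (s - x)) *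
    mnorm (fun j => ~~ sg j) (refl_coef t P) s) <= e.
  move=> /andP[x0 xt]; apply: le_trans (H k t x kk x0 xt t1).
  rewrite le_eqVlt; apply/orP; left; apply/eqP; apply: eq_Rint => s _.
  by rewrite mnorm_refl.
have tt : 0 <= t <= t by rewrite t0 lexx.
have zt : (0 : R) <= 0 <= t by rewrite lexx t0.
have HPr := L1_refl_coef HPt.
have Dr := dichotomy_refl Hd; have Sr := solution_refl t0 Hy.
split.
  have := up_bound_cst t0 Dr Sr HPr yt He Hsmall zt.
  rewrite mulr0 expR0 mul1r up_refl um_refl subr0 (Rint_pnorm_refl HPt).
  move=> HH; apply: (le_trans HH); rewrite mulrAC; apply: ler_wpM2r; first exact: up_ge0.
  apply: (@le_trans _ _ (2 * K ^+ 2 * e)).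
    apply: ler_wpM2r; first exact: ltW.
    by apply: ler_wpM2l; [exact: ler0n|exact: K_mono].
  by rewrite mulrC -ler_pdivlMr ?mulr_gt0 ?exprn_gt0// ge_min lexx.
move=> up0 j.
(* Backward uniqueness: in reversed time this bounds e^{kt} times the growing part at 0 by its value
   at [t], which is zero. *)
have := um_bound t0 Dr Sr HPr yt He Hsmall tt.
rewrite !um_refl subr0 subrr up0 mulr0 => HH.
have [sj|sj] := boolP (sg j); last exact: y0.
have : um (fun j => ~~ sg j) y 0 <= 0.
  rewrite (_ : um _ _ _ = up sg y 0); last by apply: eq_bigl => i; rewrite negbK.
  by rewrite -(pmulr_rle0 _ (expR_gt0 (k * t))).
by move/um_eq0; apply; rewrite negbK.
Qed.

Hypothesis Hcont : forall eta : R, 0 < eta -> exists2 d : R, 0 < d &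
  forall s j l, 0 <= s <= d -> sg j -> ~~ sg l -> cabs (P s j l - P 0 j l) <= eta.

(** The decaying components cross the whole interval and arrive with size e^{-k}. The growing ones
    come from [refined_asymptotics] with [t] = 1, once [eta'], then h, then k have been chosen in
    this order. *)
Lemma boundary_asymptotics (eta : R) : 0 < eta -> exists2 k0 : R, 0 < k0 & forall k a y l0,
  k0 <= k -> dichotomy sg k a -> solution 1 a P y ->
  ~~ sg l0 -> (forall l, ~~ sg l -> y l 0 = (l == l0)%:R) ->
  (forall j, sg j -> y j 1 = 0) ->
  (forall l, ~~ sg l -> k * cabs (y l 1) <= eta) /\
  (forall j, sg j -> k * cabs (y j 0 + P 0 j l0 / (a j - a l0)) <= eta).
Proof.
move=> eta0; have K_gt0 : 0 < K by exact: expR_gt0.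
have LK0 : 0 <= L * K ^+ 2 by rewrite mulr_ge0// exprn_ge0// expR_ge0.
pose e := Num.min 1 (2 * (L * K ^+ 2 + 1))^-1.
have e0 : 0 < e by rewrite lt_min ltr01/= invr_gt0; lra.
have mL1 : L1 0 1 (mnorm sg P) by exact: L1_mnorm.
have [k1 k10 H] := kernel_small mL1 (fun s _ => mnorm_ge0 _ _ s) e0.
have t01 : 0 <= (1 : R) <= 1 by rewrite ler01 lexx.
have e_le : e <= (2 * (L * K ^+ 2 + 1))^-1 by rewrite ge_min lexx orbT.
have e1 : e <= 1 by rewrite ge_min lexx.
have Hsmall := small_constant (ltW e0) e_le t01.
pose C0 := qnorm P 0.
(* Bounds [mnorm] near 0: each coupling coefficient differs from its value at 0 by at most [eta'],
   which will be at most 1. *)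
pose M0 := 2 * n%:R * \sum_(j | sg j) \sum_(l | ~~ sg l) (cabs (P 0 j l) + 1).
have M00 : 0 <= M0.
  rewrite !mulr_ge0//; apply: sumr_ge0 => j _; apply: sumr_ge0 => l _.
  by rewrite addr_ge0 ?cabs_ge0.
pose C3 := 2 * K * (1 + K).
have C30 : 0 <= C3.
  by rewrite /C3 mulr_ge0 ?mulr_ge0 ?addr_ge0// ltW.
have K20 : 0 <= 2 * K ^+ 2 by rewrite mulr_ge0// exprn_ge0// ltW.
(* After multiplication by k, [Y1] collects the coefficients of [eta'] and [Y2] bounds those of k
   e^{-2kh}; [X] majorises the bracket of the far part. *)
pose Y1 := 1 + M0 * C3 + 2 * K ^+ 2 * M0.
have Y10 : 0 <= Y1.
  by have := mulr_ge0 M00 C30; have := mulr_ge0 K20 M00; rewrite /Y1; lra.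
pose X := (1 + C3 * L + 2 * K ^+ 2) * L + C0.
have C00 : 0 <= C0 by exact: qnorm_ge0.
have X0 : 0 <= X.
  apply: addr_ge0 => //; apply: mulr_ge0 => //; apply: addr_ge0 => //.
  by apply: addr_ge0 => //; exact: mulr_ge0.
pose Y2 := 2 * (2 * K ^+ 2 * L) + 2 * X + C0.
have Y20 : 0 <= Y2.
  by rewrite /Y2; have := mulr_ge0 K20 L0; lra.
pose eta' := Num.min 1 (eta / (2 * (Y1 + 1))).
have eta'0 : 0 < eta' by rewrite lt_min ltr01/= divr_gt0//; lra.
have eta'1 : eta' <= 1 by rewrite ge_min lexx.
have eta'2 : eta' * Y1 <= eta / 2.
  apply: (@le_trans _ _ (eta / (2 * (Y1 + 1)) * Y1)).
    by apply: ler_wpM2r => //; rewrite ge_min lexx orbT.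
  have h : 0 < 2 * (Y1 + 1) by lra.
  by rewrite mulrAC ler_pdivrMr//; nra.
have [d1 d10 Hd1] := Hcont eta'0.
have [d2 d20 Hd2] := Rint_small (L1_pnorm HP) eta'0.
pose h := Num.min (1 / 4) (Num.min (d1 / 4) (d2 / 4)).
have h0 : 0 < h by rewrite !lt_min; apply/and3P; split; lra.
have h1 : h <= 1 / 4 by rewrite ge_min lexx.
have hd1 : h <= d1 / 4 by rewrite !ge_min lexx orbT.
have hd2 : h <= d2 / 4 by rewrite !ge_min lexx !orbT.
(* One summand per demand: [k1] for the kernel, 1 for k >= 1, the third for 8 K / k <= eta at the
   right end, the last for k E Y2 <= Y2 / (k h^2) <= eta / 2. *)
exists (k1 + 1 + 8 * K / eta + 2 * Y2 / (h ^+ 2 * eta)).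
  by rewrite -addrA ltr_pwDl// ?addr_ge0// ?divr_ge0 ?mulr_ge0 ?exprn_ge0//; lra.
have q1 : 0 <= 8 * K / eta by rewrite divr_ge0 ?mulr_ge0//; lra.
have q2 : 0 <= 2 * Y2 / (h ^+ 2 * eta).
  by rewrite divr_ge0 ?mulr_ge0 ?exprn_ge0//; lra.
move=> k a y l0 kk Hd Hy sl0 y0 yt.
have k1k : k1 <= k by lra.
have k_gt0 : 0 < k by lra.
have k_ge1 : 1 <= k by lra.
have um0 : um sg y 0 = 1 by apply: um0E y0.
have He x : 0 <= x <= 1 -> Rint x 1 (fun s => expR (- (2 * k) * (s - x)) * mnorm sg P s) <= e.
  by move=> /andP[x0 x1]; apply: H.
split.
  move=> l sl.
  have := um_bound ler01 Hd Hy HP yt He Hsmall t01.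
  rewrite um0 !mulr1 -/L -/K => HH.
  have h2 : cabs (y l 1) <= 2 * K * expR (- k).
    rewrite expRN ler_pdivlMr ?expR_gt0// mulrC; apply: le_trans HH.
    apply: ler_wpM2l; first exact: expR_ge0.
    by apply: (ler_sum1 (f := fun j => cabs (y j 1))) => // i; exact: cabs_ge0.
  have h3 := mul_expRN_le k_gt0.
  apply: (@le_trans _ _ (2 * K * (4 / k))).
    apply: (@le_trans _ _ (k * (2 * K * expR (- k)))).
      by apply: ler_wpM2l => //; exact: ltW.
    rewrite mulrCA; apply: ler_wpM2l => //; lra.
  rewrite mulrA ler_pdivrMr//.
  have : 8 * K / eta <= k by lra.
  by rewrite ler_pdivrMr//; lra.
move=> j sj.
have Hc s : 0 <= s <= 2 * h -> cabs (P s j l0 - P 0 j l0) <= eta'.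
  by move=> /andP[s0 s1]; apply: Hd1 => //; rewrite s0/=; lra.
have Hm s : 0 <= s <= 2 * h -> mnorm sg P s <= M0.
  move=> /andP[s0 s1]; rewrite /mnorm /M0 ler_wpM2l ?mulr_ge0//.
  apply: ler_sum => i si; apply: ler_sum => l sl.
  have := Hd1 s i l _ si sl => HH.
  have {}HH : cabs (P s i l - P 0 i l) <= 1.
    by apply: le_trans eta'1; apply: HH; rewrite s0/=; lra.
  rewrite -[P s i l](subrK (P 0 i l)); apply: (le_trans (cabsD _ _)); lra.
have HL : Rint 0 (2 * h) (pnorm P) <= eta'.
  rewrite (@eq_Rint _ _ _ _ (fun s => `|pnorm P s|)).
    by apply/ltW; apply: Hd2 => //; lra.
  by move=> s _; rewrite ger0_norm// pnorm_ge0.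
have h2 : 2 * h <= 1 by lra.
have := refined_asymptotics ler01 Hd Hy HP yt He Hsmall sl0 sj k_gt0 e1 y0 h0 h2
   (ltW eta'0) Hc Hm HL.
rewrite -/L -/K -/C3.
have cP : cabs (P 0 j l0) <= C0.
  apply: le_trans (qnorm_row P j 0).
  by apply: (ler_sum1 (f := fun l => cabs (P 0 j l))) => // i; exact: cabs_ge0.
have kh : 0 < 2 * k * h by rewrite !mulr_gt0.
have E2 := mul_expRN_le kh.
have {E2} : k * expR (- (2 * k) * h) <= (k * h ^+ 2)^-1.
  rewrite mulNr -(ler_pM2l (_ : 0 < 2 * h)); last lra.
  have -> : 2 * h * (k * expR (- (2 * k * h))) = 2 * k * h * expR (- (2 * k * h)) by ring.
  apply: (le_trans E2); rewrite le_eqVlt; apply/orP; left; apply/eqP.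
  by field; rewrite !gt_eqF.
have := expR_ge0 (- (2 * k) * h).
set E := expR _ => E0 kE HH.
have kE2 : k * E * Y2 <= eta / 2.
  apply: (@le_trans _ _ ((k * h ^+ 2)^-1 * Y2)); first exact: ler_wpM2r.
  have kh2 : 0 < k * h ^+ 2 by rewrite mulr_gt0// exprn_gt0.
  rewrite mulrC ler_pdivrMr//.
  have : 2 * Y2 / (h ^+ 2 * eta) <= k by lra.
  rewrite ler_pdivrMr ?mulr_gt0 ?exprn_gt0//; lra.
have EkE : E <= k * E by rewrite ler_peMl.
apply: (@le_trans _ _ (k * (2 * ((eta' + M0 * (C3 * eta')) / (2 * k) +
    2 * K ^+ 2 * (M0 / (2 * k) + E * L) * eta' + E * X) + C0 / (2 * k) * E))).
  apply: ler_wpM2l; first exact: ltW.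
  apply: (le_trans HH); apply: lerD.
    apply: ler_wpM2l => //; rewrite lerD2l; apply: ler_wpM2l => //.
    by rewrite mulr1 /X lerD2l.
  apply: ler_wpM2r => //; apply: ler_wpM2r => //.
  by rewrite invr_ge0; lra.
have -> : k * (2 * ((eta' + M0 * (C3 * eta')) / (2 * k) +
    2 * K ^+ 2 * (M0 / (2 * k) + E * L) * eta' + E * X) + C0 / (2 * k) * E) =
  eta' * Y1 + (k * E * (2 * (2 * K ^+ 2 * L) * eta' + 2 * X) + C0 / 2 * E).
  by rewrite /Y1; field; rewrite gt_eqF.
have -> : eta = eta / 2 + eta / 2 by lra.
apply: lerD => //; apply: le_trans kE2.
have -> : k * E * Y2 = k * E * (2 * (2 * K ^+ 2 * L) + 2 * X) + C0 * (k * E).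
  by rewrite /Y2; ring.
have kE0 : 0 <= k * E by rewrite mulr_ge0// ltW.
apply: lerD; first apply: ler_wpM2l => //.
  rewrite lerD2r; apply: ler_piMr => //.
  by apply: mulr_ge0 => //; exact: mulr_ge0.
apply: ler_pM => //; lra.
Qed.

End large_k.

(** * The fundamental matrix *)

Section complex_integrability.
Context {R : realType}.
Local Notation C := R[i].
Local Notation mu := (@lebesgue_measure R).
Local Notation Re := complex.Re.
Local Notation Im := complex.Im.
Implicit Types (f g : R -> C) (a b : R).

Lemma cintegrableP a b f : cintegrable `[a, b] f <->
  L1 a b (fun t => Re (f t)) /\ L1 a b (fun t => Im (f t)).
Proof. by []. Qed.

Lemma L1_cabs a b f : cintegrable `[a, b] f -> L1 a b (fun t => cabs (f t)).
Proof.
move=> [H1 H2].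
have m1 : measurable_fun `[a, b] (fun t => Re (f t)).
  by apply/measurable_EFinP; exact: (measurable_int _ H1).
have m2 : measurable_fun `[a, b] (fun t => Im (f t)).
  by apply/measurable_EFinP; exact: (measurable_int _ H2).
apply: (le_integrable _ _ _ (L1D (L1_norm H1) (L1_norm H2))) => //.
  apply/measurable_EFinP.
  have -> : (fun t => cabs (f t)) =
      Num.sqrt \o (fun t => Re (f t) ^+ 2 + Im (f t) ^+ 2).
    by apply/funext => t /=; case: (f t) => u v.
  apply: measurableT_comp.
    by apply: continuous_measurable_fun; exact: sqrt_continuous.
  by apply: measurable_funD; exact: measurable_funX.
move=> t _ /=; rewrite lee_fin ger0_norm ?cabs_ge0//.
by rewrite ger0_norm ?addr_ge0// cabs_le.
Qed.

Lemma cintegrableD a b f g : cintegrable `[a, b] f -> cintegrable `[a, b] g ->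
  cintegrable `[a, b] (fun t => f t + g t).
Proof.
move=> [H1 H2] [K1 K2]; apply/cintegrableP; split.
  by apply: eq_L1 (L1D H1 K1) => t _; rewrite ReD.
by apply: eq_L1 (L1D H2 K2) => t _; rewrite ImD.
Qed.

Lemma cintegrable0 a b : cintegrable `[a, b] (fun=> 0 : C).
Proof. by apply/cintegrableP; split; exact: L1_cst. Qed.

Lemma cintegrable_sum a b (I : finType) (F : I -> R -> C) :
  (forall i, cintegrable `[a, b] (F i)) ->
  cintegrable `[a, b] (fun t => \sum_i F i t).
Proof.
move=> H; elim: (index_enum I) => [|i s IH].
  rewrite (_ : (fun _ => _) = fun=> 0); first exact: cintegrable0.
  by apply/funext => t; rewrite big_nil.
rewrite (_ : (fun _ => _) = fun t => F i t + \sum_(j <- s) F j t).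
  exact: cintegrableD.
by apply/funext => t; rewrite big_cons.
Qed.

Lemma cintegrableM a b f g g' : a <= b -> cintegrable `[a, b] f -> cac a b g g' ->
  cintegrable `[a, b] (fun t => f t * g t).
Proof.
move=> ab [H1 H2] [/(ac_cont ab) K1 /(ac_cont ab) K2]; apply/cintegrableP; split.
  apply: eq_L1 (L1B (L1Mcont K1 H1) (L1Mcont K2 H2)) => t _.
  by rewrite ReM [Re (g t) * _]mulrC [Im (g t) * _]mulrC.
apply: eq_L1 (L1D (L1Mcont K2 H1) (L1Mcont K1 H2)) => t _.
by rewrite ImM [Re (g t) * _]mulrC [Im (g t) * _]mulrC.
Qed.

Lemma cintegrable_cst a b (c : C) : cintegrable `[a, b] (fun=> c).
Proof. by apply/cintegrableP; split; exact: L1_cst. Qed.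

Lemma cintegrableZ a b c f : a <= b -> cintegrable `[a, b] f ->
  cintegrable `[a, b] (fun t => c * f t).
Proof.
move=> ab hf; rewrite (_ : (fun _ => _) = fun t => f t * c).
  exact: (cintegrableM ab hf (cac_cst c ab)).
by apply/funext => t; rewrite mulrC.
Qed.

(** The differential equation holds only almost everywhere; this lets its right-hand side serve as
    the density at every point. *)
Lemma ac_ae a b (f f' g : R -> R) : ac a b f f' -> L1 a b g ->
  {ae mu, forall x, a <= x <= b -> f' x = g x} -> ac a b f g.
Proof.
move=> [hf' hf] hg fg; split=> // x xab; rewrite hf//; congr (_ + _).
have /andP[ax xb] := xab.
rewrite /Rint /Rintegral; congr fine; apply: ae_eq_integral => //.
- exact: (measurable_int _ (L1_sub (lexx a) xb hf')).
- exact: (measurable_int _ (L1_sub (lexx a) xb hg)).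
apply: filterS fg; first exact: (ae_filter_ringOfSetsType mu).
move=> t H /=; rewrite in_itv/= => /andP[at_ tx].
by rewrite H// at_ (le_trans tx).
Qed.

Lemma cac_ae a b f f' g : cac a b f f' -> cintegrable `[a, b] g ->
  {ae mu, forall x, a <= x <= b -> f' x = g x} -> cac a b f g.
Proof.
move=> [H1 H2] [K1 K2] fg; split.
  by apply: ac_ae H1 K1 _; apply: filterS fg => [|t H /H -> //];
    exact: (ae_filter_ringOfSetsType mu).
by apply: ac_ae H2 K2 _; apply: filterS fg => [|t H /H -> //];
    exact: (ae_filter_ringOfSetsType mu).
Qed.

Lemma cac_cintegral a b f : a <= b -> cintegrable `[a, b] f ->
  cac a b (fun x => cintegral `[a, x] f) f.
Proof. by move=> ab [H1 H2]; split; exact: ac_int. Qed.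

End complex_integrability.

Section fundamental_matrices.
Context {R : realType} (n : nat) (b : 'rV[R[i]]_n) (Q : R -> 'M[R[i]]_n).
Hypotheses (b_unit : diag_mx b \in unitmx)
  (HQ : forall j k, cintegrable `[0, 1] (fun t => Q t j k)).

(** With [coef], the data of the system solved for the derivative, y' = i lam B y - i B Q y. *)
Definition rate (lam : R[i]) (j : 'I_n) : R[i] := 'i%C * b 0 j * lam.
Definition coef (s : R) (j l : 'I_n) : R[i] := - ('i%C * b 0 j * Q s j l).

Lemma cintegrable_coef j l : cintegrable `[0, 1] (fun s => coef s j l).
Proof.
rewrite (_ : (fun s => coef s j l) = fun s => - ('i%C * b 0 j) * Q s j l).
  exact: cintegrableZ.
by apply/funext => s; rewrite /coef mulNr.
Qed.

Lemma system_solved (lam : R[i]) (Qx Yx Y'x : 'M[R[i]]_n) j k :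
  - 'i%C *: (invmx (diag_mx b) *m Y'x) + Qx *m Yx = lam *: Yx ->
  Y'x j k = rate lam j * Yx j k + \sum_l - ('i%C * b 0 j * Qx j l) * Yx l k.
Proof.
move=> H.
have i2 : 'i%C * 'i%C = -1 :> R[i] by rewrite -expr2 sqr_i.
have : diag_mx b *m (- 'i%C *: (invmx (diag_mx b) *m Y'x) + Qx *m Yx) =
    diag_mx b *m (lam *: Yx) by rewrite H.
rewrite mulmxDr -scalemxAr mulKVmx// mulmxA => /matrixP /(_ j k).
rewrite -mulmxA mul_diag_mx mul_diag_mx !mxE => E.
have -> : Y'x j k = 'i%C * (- 'i%C * Y'x j k + b 0 j * \sum_l Qx j l * Yx l k)
    - 'i%C * b 0 j * \sum_l Qx j l * Yx l k.
  rewrite mulrDr (_ : 'i%C * (- 'i%C * Y'x j k) = Y'x j k); first by ring.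
  by rewrite mulNr mulrN mulrA i2 mulN1r opprK.
rewrite E (_ : \sum_l - ('i%C * b 0 j * Qx j l) * Yx l k =
   - ('i%C * b 0 j * \sum_l Qx j l * Yx l k)); first by rewrite /rate; ring.
by rewrite mulr_sumr -sumrN; apply: eq_bigr => l _; ring.
Qed.

Lemma fundamental_cac lam Y : fundamental_matrix b Q lam Y ->
  forall j k, cac 0 1 (fun s => Y s j k)
    (fun s => rate lam j * Y s j k + \sum_l coef s j l * Y s l k).
Proof.
move=> [Y0 [Y' [HY' HY Hae]]] j k.
have H l m : cac 0 1 (fun s => Y s l m) (fun s => Y' s l m).
  have H1 := cacD (cac_cst (Y 0 l m) ler01) (cac_cintegral ler01 (HY' l m)).
  apply: (cac_eq _ (cac_eq_der _ H1)) => s s01; last by rewrite add0r.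
  by rewrite (HY s)// !mxE.
apply: (cac_ae (H j k)).
  apply: cintegrableD.
    exact: (cintegrableM ler01 (cintegrable_cst 0 1 (rate lam j)) (H j k)).
  apply: cintegrable_sum => l.
  exact: (cintegrableM ler01 (cintegrable_coef j l) (H l k)).
apply: filterS Hae; first exact: (ae_filter_ringOfSetsType lebesgue_measure).
by move=> s Hs s01; apply: system_solved; exact: Hs.
Qed.

Lemma cac_linear_comb lam Y (c : 'I_n -> R[i]) t : 0 <= t <= 1 ->
  fundamental_matrix b Q lam Y ->
  solution t (rate lam) coef (fun j s => \sum_k Y s j k * c k).
Proof.
move=> /andP[t0 t1] HY j.
have Hk k := cac_sub (lexx 0) t1 (fundamental_cac HY j k).
have H := cac_sum predT t0 (fun k => cacZ (c k) t0 (Hk k)).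
apply: (cac_eq _ (cac_eq_der _ H)) => s _.
  by apply: eq_bigr => k _; rewrite mulrC.
have -> : \sum_l coef s j l * (\sum_k Y s l k * c k) =
    \sum_k \sum_l coef s j l * (Y s l k * c k).
  by rewrite exchange_big; apply: eq_bigr => l _; rewrite mulr_sumr.
rewrite mulr_sumr -big_split/=; apply: eq_bigr => k _.
rewrite mulrDr mulr_sumr mulrCA [c k * _]mulrC; congr (_ + _).
by apply: eq_bigr => l _; rewrite mulrCA [c k * _]mulrC.
Qed.

End fundamental_matrices.

(** * Determinants *)

Section determinants.
Context {K : comNzRingType} (n : nat).
Implicit Types (M F : 'M[K]_n).

(** Both sides are the derivative of the determinant at M in the direction F. Grouping by the varied
    row k gives the determinant of M with row k taken from F, and the cofactors along that row are
    those of M. *)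
Lemma det_variation M F :
  \sum_(s : 'S_n) (-1) ^+ s * \sum_k F k (s k) * \prod_(i | i != k) M i (s i) =
  \sum_k \sum_l F k l * cofactor M k l.
Proof.
under eq_bigr do rewrite mulr_sumr.
rewrite exchange_big/=; apply: eq_bigr => k _.
pose Mk : 'M[K]_n := \matrix_(i, l) if i == k then F k l else M i l.
have -> : \sum_(s : 'S_n) (-1) ^+ s * (F k (s k) * \prod_(i | i != k) M i (s i)) = \det Mk.
  rewrite /determinant; apply: eq_bigr => s _; congr (_ * _).
  rewrite [RHS](bigD1 k)//= mxE eqxx; congr (_ * _).
  by apply: eq_bigr => i ik; rewrite mxE (negbTE ik).
rewrite (expand_det_row _ k); apply: eq_bigr => l _; rewrite mxE eqxx; congr (_ * _).
rewrite /cofactor; congr (_ * \det _); apply/matrixP => i j; rewrite !mxE.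
by rewrite eq_sym (negbTE (neq_lift _ _)).
Qed.

End determinants.

Section determinant_calculus.
Context {R : realType} (n : nat).

Lemma cac_det a b (M M' : R -> 'M[R[i]]_n) : a <= b ->
  (forall i j, cac a b (fun t => M t i j) (fun t => M' t i j)) ->
  cac a b (fun t => \det (M t)) (fun t => \sum_k \sum_l M' t k l * cofactor (M t) k l).
Proof.
move=> ab H.
have H1 (s : 'S_n) := cacZ ((-1) ^+ s) ab (cac_prod ab (fun i => H i (s i))).
apply: (cac_eq _ (cac_eq_der _ (cac_sum predT ab H1))) => // t _.
exact: (det_variation (M t) (M' t)).
Qed.

End determinant_calculus.

Section first_order.
Context {K : numFieldType} (n : nat) {T : Type} {F : set_system T} {FF : Filter F}.
Local Notation C := (K^o).

Lemma cvg_finsum (I : finType) (f : I -> T -> C) (l : I -> C) :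
  (forall i, f i x @[x --> F] --> l i) ->
  (\sum_i f i x) @[x --> F] --> (\sum_i l i : C).
Proof.
move=> H; elim: (index_enum I) => [|i s IH].
  rewrite big_nil (_ : (fun _ => _) = fun=> 0); first exact: cvg_cst.
  by apply/funext => x; rewrite big_nil.
rewrite big_cons (_ : (fun _ => _) = fun x => f i x + \sum_(j <- s) f j x).
  exact: cvgD.
by apply/funext => x; rewrite big_cons.
Qed.

Lemma cvg_lin_comb (I : finType) (c : I -> K) (f : I -> T -> C) (l : I -> C) :
  (forall i, f i x @[x --> F] --> l i) ->
  (\sum_i c i * f i x : C) @[x --> F] --> (\sum_i c i * l i : C).
Proof. by move=> H; apply: cvg_finsum => i; apply: cvgM => //; exact: cvg_cst. Qed.

Lemma cvg_perturb (f g : T -> C) (l : C) :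
  f x @[x --> F] --> (0 : C) -> g x @[x --> F] --> l ->
  ((1 + f x) * g x - l : C) @[x --> F] --> (0 : C).
Proof.
move=> Hf Hg.
have -> : (0 : C) = (1 + 0) * l - l by rewrite addr0 mul1r subrr.
apply: cvgB; last exact: cvg_cst.
by apply: cvgM => //; apply: cvgD => //; exact: cvg_cst.
Qed.

(** Since z^{-1} tends to 0 and z e_i converges, each e_i tends to 0; in the product rule the terms
    with two or more perturbations therefore disappear in the limit. *)
Lemma prod_first_order (I : finType) (z : T -> C) (t : I -> C) (e : I -> T -> C)
  (e1 : I -> C) : (z x)^-1 @[x --> F] --> (0 : C) ->
  (\forall x \near F, z x != 0) ->
  (forall i, (z x * e i x) @[x --> F] --> e1 i) ->
  (z x * (\prod_i (t i + e i x) - \prod_i t i)) @[x --> F] -->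
  (\sum_k e1 k * \prod_(i | i != k) t i : C).
Proof.
move=> z0 znz He.
have He0 i : e i x @[x --> F] --> (0 : C).
  have : ((z x)^-1 * (z x * e i x)) @[x --> F] --> (0 * e1 i : C) by apply: cvgM.
  rewrite mul0r; apply: cvg_trans; apply: near_eq_cvg.
  by apply: filterS znz => x zx; rewrite mulKf.
suff H (s : seq I) : uniq s ->
    (z x * (\prod_(i <- s) (t i + e i x) - \prod_(i <- s) t i)) @[x --> F] -->
    (\sum_(k <- s) e1 k * \prod_(i <- s | i != k) t i : C).
  exact: (H _ (index_enum_uniq I)).
elim: s => [_|i s IH /= /andP[si us]].
  under eq_fun do rewrite !big_nil subrr mulr0.
  rewrite (_ : \sum_(k <- [::]) _ = 0); first exact: cvg_cst.
  by rewrite big_nil.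
have {}IH := IH us.
rewrite (_ : (fun _ => _) = fun x => z x * e i x * \prod_(j <- s) t j +
    (t i + e i x) * (z x * (\prod_(i <- s) (t i + e i x) - \prod_(i <- s) t i))); last first.
  by apply/funext => x; rewrite !big_cons; ring.
have -> : \sum_(k <- i :: s) e1 k * \prod_(j <- i :: s | j != k) t j =
    e1 i * \prod_(j <- s) t j + (t i + 0) * \sum_(k <- s) e1 k * \prod_(j <- s | j != k) t j.
  rewrite big_cons big_cons eqxx/=; congr (_ * _ + _).
    rewrite [LHS]big_seq_cond [RHS]big_seq; apply: eq_bigl => j.
    by case: (boolP (j \in s)) => //= js; apply/negP => /eqP ji; rewrite -ji js in si.
  rewrite addr0 big_distrr/= !big_seq; apply: eq_bigr => k ks.
  rewrite big_cons; case: eqP => [ik|_]; first by rewrite ik ks in si.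
  by rewrite mulrCA.
apply: cvgD; first by apply: cvgM => //; exact: cvg_cst.
apply: cvgM => //; apply: cvgD => //; exact: cvg_cst.
Qed.

Lemma det_first_order (z : T -> C) (M : 'M[K]_n) (E : T -> 'M[K]_n)
  (E1 : 'M[K]_n) : (z x)^-1 @[x --> F] --> (0 : C) ->
  (\forall x \near F, z x != 0) ->
  (forall i j, (z x * E x i j : C) @[x --> F] --> (E1 i j : C)) ->
  (z x * (\det (M + E x) - \det M) : C) @[x --> F] -->
  (\sum_k \sum_l E1 k l * cofactor M k l : C).
Proof.
move=> z0 znz HE; rewrite -det_variation.
rewrite (_ : (fun _ => _) = fun x => \sum_(s : 'S_n) (-1) ^+ s *
    (z x * (\prod_i (M i (s i) + E x i (s i)) - \prod_i M i (s i)))); last first.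
  apply/funext => x; rewrite -sumrB mulr_sumr; apply: eq_bigr => s _.
  rewrite -mulrBr mulrCA; congr (_ * (_ * (_ - _))).
  by apply: eq_bigr => i _; rewrite mxE.
apply: cvg_finsum => s; apply: cvgM; first exact: cvg_cst.
exact: (prod_first_order (t := fun i => M i (s i)) z0 znz (fun i => HE i (s i))).
Qed.

End first_order.

Section growing_minor.
Context {R : realType} (n : nat) (b : 'rV[R[i]]_n) (Q : R -> 'M[R[i]]_n)
  (Phi : R -> R[i] -> 'M[R[i]]_n) (sg : pred 'I_n).
Hypotheses (b_unit : diag_mx b \in unitmx)
  (HQ : forall j k, cintegrable `[0, 1] (fun t => Q t j k))
  (HPhi : forall lam, fundamental_matrix b Q lam (Phi ^~ lam)).
Local Notation rate := (rate b).
Local Notation coef := (coef b Q).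

(* The rows of the identity in the decaying directions, completed by the rows of
   the fundamental matrix in the growing ones; its determinant is the principal
   minor of [Phi t lam] carried by the growing directions. *)
Definition dominant_mx (t : R) (lam : R[i]) : 'M[R[i]]_n :=
  \matrix_(j, k) if sg j then Phi t lam j k else (j == k)%:R.

Definition columns_sol (lam : R[i]) (N : 'M[R[i]]_n) (l j : 'I_n) (s : R) : R[i] :=
  \sum_k Phi s lam j k * N k l.

Lemma injective_unitmx (A : 'M[R[i]]_n) :
  (forall c : 'I_n -> R[i], (forall j, \sum_k A j k * c k = 0) -> forall k, c k = 0) ->
  A \in unitmx.
Proof.
move=> H; rewrite -unitmx_tr -row_free_unit -kermx_eq0; apply/eqP/matrixP => i k.
rewrite [RHS]mxE; apply: (H (fun k => kermx A^T i k)) => j.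
transitivity ((kermx A^T *m A^T) i j); last by rewrite mulmx_ker mxE.
by rewrite [RHS]mxE; apply: eq_bigr => l _; rewrite [A^T l j]mxE mulrC.
Qed.

Lemma L1_coef j l : L1 0 1 (fun s => cabs (coef s j l)).
Proof. by apply: L1_cabs; exact: cintegrable_coef. Qed.

Lemma Phi0 lam : Phi 0 lam = 1%:M.
Proof. by case: (HPhi lam). Qed.

Lemma columns_sol0 lam N l j : columns_sol lam N l j 0 = N j l.
Proof.
rewrite /columns_sol Phi0 (bigD1 j)//= mxE eqxx mul1r big1 ?addr0// => k kj.
by rewrite mxE eq_sym (negbTE kj) mul0r.
Qed.

Lemma columns_solution lam N l t : 0 <= t <= 1 ->
  solution t (rate lam) coef (columns_sol lam N l).
Proof. by move=> t01; exact: cac_linear_comb (fun k => N k l) t t01 (HPhi lam). Qed.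

Lemma dominant_mulE t lam (N : 'M[R[i]]_n) j l : (dominant_mx t lam *m N) j l =
  if sg j then columns_sol lam N l j t else columns_sol lam N l j 0.
Proof.
rewrite mxE columns_sol0; case: ifPn => sj.
  by apply: eq_bigr => k _; rewrite mxE sj.
rewrite (bigD1 j)//= mxE (negbTE sj) eqxx mul1r big1 ?addr0// => k kj.
by rewrite mxE (negbTE sj) eq_sym (negbTE kj) mul0r.
Qed.

(** A null vector [c] gives the solution Phi c, with no decaying component at 0 and no growing
    component at [t]; by [cone] such a solution vanishes. The threshold is the same for all [t]. *)
Lemma dominant_unit : exists2 k0 : R, 0 < k0 & forall k lam t,
  k0 <= k -> 0 <= t <= 1 -> dichotomy sg k (rate lam) ->
  dominant_mx t lam \in unitmx.
Proof.
have [k0 k00 H] := cone sg L1_coef (@ltr01 R).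
exists k0 => // k lam t kk t01 Hd; apply: injective_unitmx => c Hc.
(* All columns equal [c], so that the facts about [columns_sol] apply to a single vector. *)
pose N : 'M[R[i]]_n := \matrix_(i, j) c i.
have E j l : (dominant_mx t lam *m N) j l = 0.
  by rewrite -(Hc j) mxE; apply: eq_bigr => k' _; rewrite [X in _ * X]mxE.
move=> l.
have y0 j : ~~ sg j -> columns_sol lam N l j 0 = 0.
  by move=> sj; have := E j l; rewrite dominant_mulE (negbTE sj).
have [_ Hup] := H k t _ _ kk t01 Hd (columns_solution lam N l t01) y0.
have : columns_sol lam N l l 0 = 0.
  apply: Hup; apply: big1 => j sj.
  by have := E j l; rewrite dominant_mulE sj => ->; rewrite cabs0.
by rewrite columns_sol0 mxE.
Qed.

Lemma dominant_inv t lam l j : dominant_mx t lam \in unitmx ->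
  let y := columns_sol lam (invmx (dominant_mx t lam)) l in
  (~~ sg j -> y j 0 = (j == l)%:R) /\ (sg j -> y j t = (j == l)%:R).
Proof.
move=> Au y; have := dominant_mulE t lam (invmx (dominant_mx t lam)) j l.
by rewrite mulmxV// mxE -/y; case: ifP => sj H; split=> // _; rewrite -H.
Qed.

Let trP (lam : R[i]) := \sum_(k | sg k) (rate lam k + cintegral `[0, 1] (fun s => coef s k k)).

Let dP t lam (k l : 'I_n) : R[i] :=
  if sg k then rate lam k * Phi t lam k l + \sum_m coef t k m * Phi t lam m l else 0.

Lemma cac_dominant lam : cac 0 1 (fun t => \det (dominant_mx t lam))
  (fun t => \sum_k \sum_l dP t lam k l * cofactor (dominant_mx t lam) k l).
Proof.
have H i j : cac 0 1 (fun t => dominant_mx t lam i j)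
    (fun t => (\matrix_(k, l) dP t lam k l : 'M[R[i]]_n) i j).
  case si : (sg i).
    apply: (cac_eq _ (cac_eq_der _ (fundamental_cac b_unit HQ (HPhi lam) i j))).
      by move=> s _; rewrite mxE si.
    by move=> s _; rewrite mxE /dP si.
  apply: (cac_eq _ (cac_eq_der _ (cac_cst (i == j)%:R ler01))) => s _.
    by rewrite mxE si.
  by rewrite mxE /dP si.
apply: cac_eq_der (cac_det ler01 H) => t _.
by apply: eq_bigr => k _; apply: eq_bigr => l _; rewrite mxE.
Qed.

(** By cofactor A k l = det A * N l k with N the inverse of A, the sum is det A times the trace of
    Phi' N over the growing rows. At [t] the growing components of column k of Phi N form a unit
    vector, so only its decaying components remain as an error. *)
Lemma dominant_der t lam : dominant_mx t lam \in unitmx ->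
  \sum_k \sum_l dP t lam k l * cofactor (dominant_mx t lam) k l =
  \det (dominant_mx t lam) * \sum_(k | sg k) (rate lam k + coef t k k +
    \sum_(m | ~~ sg m) coef t k m *
      columns_sol lam (invmx (dominant_mx t lam)) k m t).
Proof.
move=> Au; set A := dominant_mx t lam; set N := invmx A.
have cofE k l : cofactor A k l = \det A * N l k.
  by rewrite /N /invmx Au !mxE mulrA divff ?mul1r// -unitfE -unitmxE.
rewrite mulr_sumr [RHS]big_mkcond/=; apply: eq_bigr => k _; rewrite /dP.
case: ifPn => sk; last by rewrite big1// => l _; rewrite mul0r.
have yk m : sg m -> columns_sol lam N k m t = (m == k)%:R.
  by move=> sm; have [_ H] := dominant_inv k m Au; exact: H.
rewrite -addrA; have -> : coef t k k + \sum_(m | ~~ sg m) coef t k m * columns_sol lam N k m t =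
    \sum_m coef t k m * columns_sol lam N k m t.
  rewrite [RHS](bigID sg)/=; congr (_ + _).
  rewrite (bigD1 k)//= yk// eqxx mulr1 big1 ?addr0// => m /andP[sm mk].
  by rewrite yk// (negbTE mk) mulr0.
rewrite -{2}[rate lam k]mulr1.
have <- : columns_sol lam N k k t = 1 by rewrite yk// eqxx.
rewrite /columns_sol.
have -> : \sum_m coef t k m * (\sum_l Phi t lam m l * N l k) =
    \sum_l (\sum_m coef t k m * Phi t lam m l) * N l k.
  under eq_bigr do rewrite mulr_sumr.
  rewrite exchange_big/=; apply: eq_bigr => l _; rewrite mulr_suml.
  by apply: eq_bigr => m _; rewrite mulrA.
rewrite mulr_sumr -big_split/= mulr_sumr; apply: eq_bigr => l _.
by rewrite cofE; ring.
Qed.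

(* Liouville's formula for the dominant minor: up to the thin-cone error its
   logarithmic derivative is [\sum_(k | sg k) (rate lam k + coef t k k)]. *)
Lemma dominant_asymptotics (eps : R) : 0 < eps -> exists2 k0 : R, 0 < k0 &
  forall k lam, k0 <= k -> dichotomy sg k (rate lam) ->
  cabs (\det (dominant_mx 1 lam) * cexp (- trP lam) - 1) <= eps.
Proof.
move=> eps0; pose L := Rint 0 1 (qnorm coef).
have L1q : L1 0 1 (qnorm coef) by apply: L1_qnorm; exact: L1_coef.
have L0 : 0 <= L by apply: Rint_ge0 => s _; exact: qnorm_ge0.
(* With eta <= 1 Gronwall yields |h| <= e^{2L} whatever [eps] is; the second bound then makes |h(1)
   - 1| <= 2 eta L e^{2L} at most [eps]. *)
pose eta := Num.min 1 (eps / (2 * (L * expR (2 * L) + 1))).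
have X0 : 0 <= L * expR (2 * L) by rewrite mulr_ge0 ?expR_ge0.
have eta0 : 0 < eta by rewrite lt_min ltr01/= divr_gt0//; lra.
have eta1 : eta <= 1 by rewrite ge_min lexx.
have eta2 : eta * (L * expR (2 * L)) * 2 <= eps.
  have : eta <= eps / (2 * (L * expR (2 * L) + 1)) by rewrite ge_min lexx orbT.
  rewrite ler_pdivlMr; last by lra.
  by lra.
have [k1 k10 H1] := dominant_unit.
have [k2 k20 H2] := cone sg L1_coef eta0.
exists (k1 + k2) => [|k lam kk Hd]; first exact: addr_gt0.
have kk1 : k1 <= k by lra.
have kk2 : k2 <= k by lra.
pose G t : R[i] := - \sum_(j | sg j) (rate lam j * t%:C + cintegral `[0, t] (fun s => coef s j j)).
pose G' t : R[i] := - \sum_(j | sg j) (rate lam j + coef t j j).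
have HG : cac 0 1 G G'.
  apply: cacN; apply: cac_sum => // j.
  apply: cacD; last by apply: cac_cintegral => //; exact: cintegrable_coef.
  apply: cac_eq_der (cacZ (rate lam j) ler01 (cac_id ler01)) => s _.
  by rewrite mulr1.
pose dt t := \det (dominant_mx t lam).
(* The factor [cexp (G t)] removes the expected growth, which leaves h' = rho h with h(0) = 1. *)
pose h t := cexp (G t) * dt t.
pose rho t := \sum_(k | sg k) \sum_(m | ~~ sg m) coef t k m *
  columns_sol lam (invmx (dominant_mx t lam)) k m t.
have Hh : cac 0 1 h (fun t => rho t * h t).
  apply: cac_eq_der (cacM ler01 (cac_cexp ler01 HG) (cac_dominant lam)) => t t01.
  rewrite (dominant_der (H1 k lam t kk1 t01 Hd)) -/(dt t) /h /G'.
  have -> : \sum_(k0 | sg k0) (rate lam k0 + coef t k0 k0 +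
     \sum_(m | ~~ sg m) coef t k0 m * columns_sol lam (invmx (dominant_mx t lam)) k0 m t) =
     \sum_(j | sg j) (rate lam j + coef t j j) + rho t by rewrite -big_split.
  by ring.
have rho_le t : 0 <= t <= 1 -> cabs (rho t) <= eta * qnorm coef t.
  move=> t01; have Au := H1 k lam t kk1 t01 Hd.
  (* A column with growing index starts in the growing subspace and has growing part of size 1 at
     [t]; the cone with right end [t] therefore bounds its decaying part by [eta]. *)
  have ym j : sg j -> forall m, ~~ sg m ->
      cabs (columns_sol lam (invmx (dominant_mx t lam)) j m t) <= eta.
    move=> sj m sm; set y := columns_sol _ _ _.
    have y0 i : ~~ sg i -> y i 0 = 0.
      move=> si; have [H _] := dominant_inv j i Au.
      rewrite /y H//; case: eqP => // ij; by rewrite ij sj in si.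
    have [Hum _] := H2 k t (rate lam) y kk2 t01 Hd (columns_solution _ _ _ t01) y0.
    have upt : up sg y t = 1.
      rewrite /up (bigD1 j)//= big1 ?addr0.
        by have [_ H] := dominant_inv j j Au; rewrite /y H// eqxx cabs1.
      move=> i /andP[si ij]; have [_ H] := dominant_inv j i Au.
      by rewrite /y H// (negbTE ij) cabs0.
    rewrite upt mulr1 in Hum; apply: le_trans Hum.
    by apply: (ler_sum1 (f := fun m => cabs (y m t))) => // i; exact: cabs_ge0.
  rewrite /rho /qnorm mulr_sumr; apply: (le_trans (cabs_sum _ _)).
  apply: (@le_trans _ _ (\sum_(j | sg j) eta * \sum_l cabs (coef t j l))).
    apply: ler_sum => j sj; apply: (le_trans (cabs_sum _ _)).
    rewrite mulr_sumr; apply: (@le_trans _ _ (\sum_(m | ~~ sg m) eta * cabs (coef t j m))).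
      apply: ler_sum => m sm; rewrite cabsM mulrC.
      by apply: ler_wpM2r; [exact: cabs_ge0|exact: ym].
    by apply: ler_sum_all => m; rewrite mulr_ge0 ?cabs_ge0// ltW.
  apply: ler_sum_all => j; rewrite mulr_ge0// ?(ltW eta0)//.
  by apply: sumr_ge0 => l _; exact: cabs_ge0.
have ch : cont 0 1 (fun t => cabs (h t)) by exact: cac_cont ler01 Hh.
have h0 : h 0 = 1.
  rewrite /h /dt (_ : dominant_mx 0 lam = 1%:M); last first.
    by apply/matrixP => i j; rewrite mxE Phi0 mxE; case: ifP.
  rewrite det1 mulr1 /G big1 ?oppr0 ?cexp0// => j _.
  rewrite mulr0 add0r /cintegral !set_itv1 !Rintegral_set1.
  by [].
have L1qh : L1 0 1 (fun s => qnorm coef s * cabs (h s)).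
  by apply: eq_L1 (L1Mcont ch L1q) => s _; rewrite mulrC.
have incr x : 0 <= x <= 1 ->
    cabs (h x - 1) <= 2 * eta * Rint 0 x (fun s => qnorm coef s * cabs (h s)).
  move=> /andP[x0 x1].
  have L1x : L1 0 x (fun s => qnorm coef s * cabs (h s)) by apply: L1_sub L1qh.
  have := cac_incr Hh (lexx 0) x0 x1 (L1Z eta L1x).
  rewrite h0 RintZ// mulrA; apply=> s /andP[s0 sx].
  have s01 : 0 <= s <= 1 by rewrite s0 (le_trans sx).
  by rewrite cabsM mulrA; apply: ler_wpM2r; [exact: cabs_ge0|exact: rho_le].
have hb x : 0 <= x <= 1 -> cabs (h x) <= expR (2 * L).
  have L1p : L1 0 1 (fun s => 2 * qnorm coef s) by exact: L1Z.
  move=> x01; have /andP[x0 x1] := x01.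
  have step s : 0 <= s <= 1 ->
      cabs (h s) <= 1 + Rint 0 s (fun r => 2 * qnorm coef r * cabs (h r)).
    move=> s01; have /andP[s0 s1] := s01.
    rewrite -[h s](subrK 1) (le_trans (cabsD _ _))// cabs1 addrC lerD2l.
    apply: (le_trans (incr s s01)).
    have L1s : L1 0 s (fun s => qnorm coef s * cabs (h s)) by apply: L1_sub L1qh.
    rewrite [leRHS](@eq_Rint _ _ _ _ (fun r => 2 * (qnorm coef r * cabs (h r)))); last first.
      by move=> r _; rewrite mulrA.
    rewrite RintZ//; apply: ler_wpM2r; last by lra.
    by apply: Rint_ge0 => r _; rewrite mulr_ge0 ?qnorm_ge0 ?cabs_ge0.
  have p0 s : 0 <= s <= 1 -> 0 <= 2 * qnorm coef s by rewrite mulr_ge0 ?qnorm_ge0.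
  have := gronwall ler01 ch L1p p0 step x01.
  rewrite mul1r => H; apply: (le_trans H); rewrite ler_expR.
  have L1qx : L1 0 x (qnorm coef) by apply: L1_sub L1q.
  rewrite RintZ// ler_wpM2l//; apply: Rint_sub_le => // s _; exact: qnorm_ge0.
have t11 : 0 <= (1 : R) <= 1 by rewrite ler01 lexx.
have -> : \det (dominant_mx 1 lam) * cexp (- trP lam) = h 1.
  rewrite mulrC /h /dt /G /trP; congr (cexp (- _) * _).
  by apply: eq_bigr => j _; rewrite mulr1.
apply: (le_trans (incr 1 t11)); apply: le_trans eta2.
have -> : eta * (L * expR (2 * L)) * 2 = 2 * eta * (expR (2 * L) * L) by ring.
apply: ler_wpM2l; first by lra.
rewrite -RintZ//; apply: le_Rint => //; first exact: L1Z.
move=> s s01; rewrite mulrC; apply: ler_wpM2r; first exact: qnorm_ge0.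
exact: hb.
Qed.

End growing_minor.

(** * Asymptotics in a sector *)

Section sector_asymptotics.
Context {R : realType} (n : nat) (b : 'rV[R[i]]_n) (Q : R -> 'M[R[i]]_n)
  (C D : 'M[R[i]]_n) (Phi : R -> R[i] -> 'M[R[i]]_n) (sg : pred 'I_n)
  (S : set R[i]) (dl : R).
Hypotheses (b_unit : diag_mx b \in unitmx)
  (HQ : forall j k, cintegrable `[0, 1] (fun t => Q t j k))
  (HPhi : forall lam, fundamental_matrix b Q lam (Phi ^~ lam))
  (dl0 : 0 < dl)
  (HS : forall lam, S lam -> dichotomy sg (dl * cabs lam) (rate b lam))
  (Hb : forall j l, sg j -> ~~ sg l -> b 0 j != b 0 l)
  (Hcont0 : forall eta : R, 0 < eta -> exists2 d : R, 0 < d & forall (s : R) j l,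
     0 <= s <= d -> sg j -> ~~ sg l -> cabs (coef b Q s j l - coef b Q 0 j l) <= eta)
  (Hcont1 : forall eta : R, 0 < eta -> exists2 d : R, 0 < d & forall (s : R) j l,
     0 <= s <= d -> ~~ sg j -> sg l -> cabs (coef b Q (1 - s) j l - coef b Q 1 j l) <= eta).
Local Notation rate := (rate b).
Local Notation coef := (coef b Q).
Local Notation dominant_mx := (dominant_mx Phi sg).
Local Notation F := (infty_within S).
Local Notation Cx := (R[i]^o).

Let N lam := invmx (dominant_mx 1 lam).
Let Y lam := columns_sol Phi lam (N lam).

(* The boundary values, at 0 for the growing and at 1 for the decaying components,
   that are not prescribed for the solutions forming the columns. *)
Definition boundary_mx lam : 'M[R[i]]_n :=
  \matrix_(m, l) if sg m then N lam m l else Y lam l m 1.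

(** Limit of lam times [boundary_mx]. Within one class the entries are exponentially small, hence
    the zero blocks. Both denominators are growing minus decaying, as in [omega1]. *)
Definition boundary_lim : 'M[R[i]]_n := \matrix_(m, l)
  if sg m then if sg l then 0 else b 0 m * Q 0 m l / (b 0 m - b 0 l)
  else if sg l then - (b 0 m * Q 1 m l / (b 0 l - b 0 m)) else 0.

Lemma cvg_large (f : R[i] -> R[i]) :
  (forall eta : R, 0 < eta -> exists2 k0 : R, 0 < k0 & forall lam, S lam ->
    k0 <= dl * cabs lam -> cabs (f lam) <= eta) ->
  (f lam : Cx) @[lam --> F] --> (0 : Cx).
Proof.
move=> H; apply/cvgr0Pnorm_le => e e0.
(* In the order of [R[i]] a positive element is real, so a real tolerance may be used. *)
have [er eE] : exists r : R, e = r%:C by apply/complex_realP; exact: gtr0_real.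
have er0 : 0 < er by move: e0; rewrite eE ltcR.
rewrite eE.
have [k0 k00 Hk] := H er er0.
exists (k0 / dl) => // lam [Slam Hlam].
rewrite cabsE lecR; apply: Hk => //.
by move: Hlam; rewrite cabsE ltcR ltr_pdivrMr// mulrC => /ltW.
Qed.

Lemma cvg_large_sub (f : R[i] -> R[i]) l :
  (forall eta : R, 0 < eta -> exists2 k0 : R, 0 < k0 & forall lam, S lam ->
    k0 <= dl * cabs lam -> cabs (f lam - l) <= eta) ->
  (f lam : Cx) @[lam --> F] --> (l : Cx).
Proof.
by move=> /cvg_large /subr_cvg0.
Qed.

Lemma lam_large (lam : R[i]) (k0 : R) : 0 < k0 -> k0 <= dl * cabs lam -> lam != 0.
Proof.
by move=> k00; apply: contraTneq => ->; rewrite cabs0 mulr0 -ltNge.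
Qed.

Lemma inv_cvg0 : ((lam : R[i])^-1 : Cx) @[lam --> F] --> (0 : Cx).
Proof.
apply: cvg_large => eta eta0; exists (dl / eta); first exact: divr_gt0.
move=> lam _ Hl; have k0 : 0 < dl / eta by exact: divr_gt0.
have lam0 := lam_large k0 Hl.
have cl : 0 < cabs lam.
  rewrite lt_neqAle cabs_ge0 andbT eq_sym; apply/eqP => /cabs0_eq0 /eqP.
  exact/negP.
rewrite cabsV invf_ple ?posrE// -(ler_pM2l dl0).
by [].
Qed.

Lemma near_unit : \forall lam \near F, lam != 0 /\ dominant_mx 1 lam \in unitmx.
Proof.
have [k0 k00 H] := dominant_unit sg b_unit HQ HPhi.
exists (k0 / dl) => // lam [Slam Hlam].
have Hk : k0 <= dl * cabs lam.
  by move: Hlam; rewrite cabsE ltcR ltr_pdivrMr// mulrC => /ltW.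
split; first exact: lam_large k00 Hk.
by apply: H Hk _ (HS Slam); rewrite ler01 lexx.
Qed.

Let t11 : 0 <= (1 : R) <= 1. Proof. by rewrite ler01 lexx. Qed.

(* [dl * cabs lam] is the dichotomy constant, so an error bounded by [eta] after
   multiplication by it is [o(1 / lam)]. *)
Lemma cvg_entry (f : R[i] -> R[i]) (c : R[i]) :
  (forall eta : R, 0 < eta -> exists2 k0 : R, 0 < k0 & forall lam, S lam ->
    k0 <= dl * cabs lam -> dl * cabs lam * cabs (f lam - c / lam) <= eta) ->
  (lam * f lam : Cx) @[lam --> F] --> (c : Cx).
Proof.
move=> H; apply: cvg_large_sub => eta eta0.
have [k0 k00 Hk] := H (dl * eta) (mulr_gt0 dl0 eta0).
exists k0 => // lam Slam Hl; have lam0 := lam_large k00 Hl.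
have := Hk lam Slam Hl; rewrite -mulrA ler_pM2l// -cabsM.
by rewrite mulrBr mulrCA divff// mulr1.
Qed.

Let L1P := L1_coef b HQ.

Lemma rateE lam j : rate lam j = 'i%C * b 0 j * lam.
Proof. by []. Qed.

Lemma rate_ratio j l lam c : lam != 0 -> b 0 j != b 0 l ->
  - ('i%C * b 0 j * c) / (rate lam j - rate lam l) = - (b 0 j * c / (b 0 j - b 0 l) / lam).
Proof.
move=> lam0 bjl; have i0 : 'i%C != 0 :> R[i].
  by apply/eqP => /(congr1 (fun z => complex.Im z)) /= /eqP; rewrite oner_eq0.
have d0 : b 0 j - b 0 l != 0 by rewrite subr_eq0.
have -> : rate lam j - rate lam l = 'i%C * (b 0 j - b 0 l) * lam.
  by rewrite !rateE; ring.
by field; rewrite lam0 d0 i0.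
Qed.

(** A column with decaying [l] has its datum 1 at 0 and gives the first-order term directly. For
    growing [l] the datum sits at 1: time reversal makes [l] decaying and 0 the far end, where the
    solution is exponentially small. *)
Lemma cvg_N j l : sg j -> (lam * N lam j l : Cx) @[lam --> F] --> (boundary_lim j l : Cx).
Proof.
move=> sj; apply: cvg_entry => eta eta0.
have [k1 k10 H1] := dominant_unit sg b_unit HQ HPhi.
have [sl|sl] := boolP (sg l).
  have Hc1 : forall eta : R, 0 < eta -> exists2 d : R, 0 < d &
      forall s j l, 0 <= s <= d -> ~~ sg j -> ~~ ~~ sg l ->
      cabs (refl_coef 1 coef s j l - refl_coef 1 coef 0 j l) <= eta.
    move=> e e0; have [d d0 Hd] := Hcont1 e0; exists d => // s i m sI si sm.
    by rewrite /refl_coef subr0 -opprD cabsN; apply: Hd => //; rewrite -[sg m]negbK.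
  have [k2 k20 H2] := boundary_asymptotics (L1_refl_coef L1P) Hc1 eta0.
  exists (k1 + k2) => [|lam Slam kk]; first exact: addr_gt0.
  have kk1 : k1 <= dl * cabs lam by lra.
  have kk2 : k2 <= dl * cabs lam by lra.
  have Au := H1 _ lam 1 kk1 t11 (HS Slam).
  have Sol := solution_refl ler01 (columns_solution b_unit HQ HPhi lam (N lam) l t11).
  have [|||+ _] := H2 _ _ _ l kk2 (dichotomy_refl (HS Slam)) Sol _ _ _.
  - by rewrite negbK.
  - move=> m; rewrite negbK subr0 => sm.
    by have [_ K] := dominant_inv HPhi l m Au; exact: K.
  - move=> m sm; rewrite subrr; have [K _] := dominant_inv HPhi l m Au.
    by rewrite K//; case: eqP => // ml; rewrite ml sl in sm.
  move=> /(_ j); rewrite negbK subrr (columns_sol0 HPhi) => /(_ sj).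
  by rewrite mxE sj sl mul0r subr0.
have [k2 k20 H2] := boundary_asymptotics L1P Hcont0 eta0.
exists (k1 + k2) => [|lam Slam kk]; first exact: addr_gt0.
have kk1 : k1 <= dl * cabs lam by lra.
have kk2 : k2 <= dl * cabs lam by lra.
have lam0 := lam_large k20 kk2.
have Au := H1 _ lam 1 kk1 t11 (HS Slam).
have Sol := columns_solution b_unit HQ HPhi lam (N lam) l t11.
have [|||_ /(_ j sj)] := H2 _ _ _ l kk2 (HS Slam) Sol _ _ _ => //.
- by move=> m sm; have [K _] := dominant_inv HPhi l m Au; exact: K.
- move=> m sm; have [_ K] := dominant_inv HPhi l m Au.
  by rewrite K//; case: eqP => // ml; rewrite -ml sm in sl.
rewrite (columns_sol0 HPhi) mxE sj (negbTE sl) rate_ratio// ?Hb//.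
Qed.

(** Mirror image of [cvg_N]: the first-order term now comes from growing [l] through time reversal.
    Reversal changes the signs of both [coef] and [rate], so the same quotient appears, with Q taken
    at 1. *)
Lemma cvg_Y j l : ~~ sg j -> (lam * Y lam l j 1 : Cx) @[lam --> F] --> (boundary_lim j l : Cx).
Proof.
move=> sj; apply: cvg_entry => eta eta0.
have [k1 k10 H1] := dominant_unit sg b_unit HQ HPhi.
have [sl|sl] := boolP (sg l).
  have Hc1 : forall eta : R, 0 < eta -> exists2 d : R, 0 < d &
      forall s j l, 0 <= s <= d -> ~~ sg j -> ~~ ~~ sg l ->
      cabs (refl_coef 1 coef s j l - refl_coef 1 coef 0 j l) <= eta.
    move=> e e0; have [d d0 Hd] := Hcont1 e0; exists d => // s i m sI si sm.
    by rewrite /refl_coef subr0 -opprD cabsN; apply: Hd => //; rewrite -[sg m]negbK.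
  have [k2 k20 H2] := boundary_asymptotics (L1_refl_coef L1P) Hc1 eta0.
  exists (k1 + k2) => [|lam Slam kk]; first exact: addr_gt0.
  have kk1 : k1 <= dl * cabs lam by lra.
  have kk2 : k2 <= dl * cabs lam by lra.
  have lam0 := lam_large k20 kk2.
  have Au := H1 _ lam 1 kk1 t11 (HS Slam).
  have Sol := solution_refl ler01 (columns_solution b_unit HQ HPhi lam (N lam) l t11).
  have [|||_ /(_ j sj)] := H2 _ _ _ l kk2 (dichotomy_refl (HS Slam)) Sol _ _ _.
  - by rewrite negbK.
  - move=> m; rewrite negbK subr0 => sm.
    by have [_ K] := dominant_inv HPhi l m Au; exact: K.
  - move=> m sm; rewrite subrr; have [K _] := dominant_inv HPhi l m Au.
    by rewrite K//; case: eqP => // ml; rewrite ml sl in sm.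
  have bjl : b 0 j != b 0 l by rewrite eq_sym Hb.
  rewrite subr0 mxE (negbTE sj) sl /refl_coef subr0.
  have -> : - coef 1 j l / (- rate lam j - - rate lam l) =
      coef 1 j l / (rate lam j - rate lam l).
    by rewrite -opprD invrN mulrNN.
  rewrite rate_ratio// mulNr opprK -[b 0 l - b 0 j]opprB invrN mulrN mulNr.
  by [].
have [k2 k20 H2] := boundary_asymptotics L1P Hcont0 eta0.
exists (k1 + k2) => [|lam Slam kk]; first exact: addr_gt0.
have kk1 : k1 <= dl * cabs lam by lra.
have kk2 : k2 <= dl * cabs lam by lra.
have Au := H1 _ lam 1 kk1 t11 (HS Slam).
have Sol := columns_solution b_unit HQ HPhi lam (N lam) l t11.
have [|||/(_ j sj) + _] := H2 _ _ _ l kk2 (HS Slam) Sol _ _ _ => //.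
- by move=> m sm; have [K _] := dominant_inv HPhi l m Au; exact: K.
- move=> m sm; have [_ K] := dominant_inv HPhi l m Au.
  by rewrite K//; case: eqP => // ml; rewrite -ml sm in sl.
by rewrite mxE (negbTE sj) (negbTE sl) mul0r subr0.
Qed.

(* [limit_mx] is T_{izB}(C,D) for z in the sector. *)
Definition limit_mx : 'M[R[i]]_n := \matrix_(i, l) if sg l then D i l else C i l.
Definition colimit_mx : 'M[R[i]]_n := \matrix_(i, l) if sg l then C i l else D i l.

(** Write C + D Phi = (C N + D Phi N) A with N the inverse of A. Decaying rows of N and growing rows
    of Phi N are rows of the identity and produce T; the unprescribed rows form [boundary_mx], met
    by columns of C for growing and of D for decaying indices. *)
Lemma char_det_factor lam : dominant_mx 1 lam \in unitmx ->
  char_det C D Phi lam =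
  \det (limit_mx + colimit_mx *m boundary_mx lam) * \det (dominant_mx 1 lam).
Proof.
move=> Au; rewrite /char_det -det_mulmx; congr (\det _).
rewrite -[LHS](mulmxKV Au); congr (_ *m _); apply/matrixP => i l.
rewrite mulmxDl -mulmxA [LHS]mxE [RHS]mxE addrC.
have -> : limit_mx i l = \sum_k limit_mx i k * (k == l)%:R.
  rewrite (bigD1 l)//= eqxx mulr1 big1 ?addr0// => k kl.
  by rewrite (negbTE kl) mulr0.
rewrite [X in X + _]mxE [X in _ + X]mxE [X in _ = _ + X]mxE -!big_split/=.
apply: eq_bigr => k _; rewrite !mxE -/(columns_sol Phi lam (N lam) l k 1).
have [H0 H1] := dominant_inv HPhi l k Au.
case: ifPn => sk; last first.
  by rewrite addrC -H0// (columns_sol0 HPhi).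
by congr (_ * _ + _); rewrite -H1.
Qed.

Lemma cvg_boundary m l :
  (lam * boundary_mx lam m l : Cx) @[lam --> F] --> (boundary_lim m l : Cx).
Proof.
have [sm|sm] := boolP (sg m).
  by under eq_fun do rewrite mxE sm; exact: cvg_N.
by under eq_fun do rewrite mxE (negbTE sm); exact: cvg_Y.
Qed.

Definition first_coef : R[i] := \sum_(j | ~~ sg j) \sum_(k | sg k)
  (\det (replace_col limit_mx j C k) * b 0 k * Q 0 k j
   - \det (replace_col limit_mx k D j) * b 0 j * Q 1 j k) / (b 0 k - b 0 j).

Lemma det_replace_col (M G : 'M[R[i]]_n) j k :
  \det (replace_col M j G k) = \sum_i G i k * cofactor M i j.
Proof.
rewrite (expand_det_col _ j); apply: eq_bigr => i _; rewrite mxE eqxx; congr (_ * _).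
rewrite /cofactor; congr (_ * \det _); apply/matrixP => u v; rewrite !mxE.
by rewrite eq_sym (negbTE (neq_lift _ _)).
Qed.

(** Expansion along columns turns the cofactor sums into determinants with one replaced column,
    taken from C for growing [m] and from D for decaying [m]. Only the two blocks coupling different
    classes survive; exchanging the sums in one of them gives common index pairs. *)
Lemma first_coefE : \sum_i \sum_l (colimit_mx *m boundary_lim) i l *
  cofactor limit_mx i l = first_coef.
Proof.
transitivity (\sum_l \sum_m boundary_lim m l * \det (replace_col limit_mx l colimit_mx m)).
  rewrite exchange_big/=; apply: eq_bigr => l _.
  under [RHS]eq_bigr do rewrite det_replace_col mulr_sumr.
  rewrite exchange_big/=; apply: eq_bigr => i _; rewrite mxE mulr_suml.
  by apply: eq_bigr => m _; ring.
have rcE l m (G : 'M[R[i]]_n) : (forall i, colimit_mx i m = G i m) ->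
    replace_col limit_mx l colimit_mx m = replace_col limit_mx l G m.
  by move=> H; apply/matrixP => u v; rewrite !mxE; case: eqP => // _; rewrite -H mxE.
have -> : first_coef = \sum_(l | ~~ sg l) \sum_(m | sg m)
      \det (replace_col limit_mx l C m) * b 0 m * Q 0 m l / (b 0 m - b 0 l) +
    \sum_(l | sg l) \sum_(m | ~~ sg m)
      - (\det (replace_col limit_mx l D m) * b 0 m * Q 1 m l / (b 0 l - b 0 m)).
  rewrite [X in _ = _ + X]exchange_big/= -big_split/=; apply: eq_bigr => j _.
  by rewrite -big_split/=; apply: eq_bigr => k _; rewrite mulrBl.
rewrite (bigID sg)/= addrC; congr (_ + _); apply: eq_bigr => l sl.
  rewrite (bigID sg)/= [X in _ + X]big1 ?addr0 => [|m sm]; last first.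
    by rewrite mxE (negbTE sm) (negbTE sl) mul0r.
  apply: eq_bigr => m sm; rewrite mxE sm (negbTE sl) (rcE _ _ C).
    by ring.
  by move=> i; rewrite mxE sm.
rewrite (bigID sg)/= [X in X + _]big1 ?add0r => [|m sm]; last first.
  by rewrite mxE sm sl mul0r.
apply: eq_bigr => m sm; rewrite mxE (negbTE sm) sl (rcE _ _ D).
  by ring.
by move=> i; rewrite mxE (negbTE sm).
Qed.

Definition log_dominant (lam : R[i]) : R[i] :=
  \sum_(k | sg k) (rate lam k + cintegral `[0, 1] (fun s => coef s k k)).

Lemma sector_expansion : exists o0 o1 : R[i] -> Cx,
  [/\ o0 lam @[lam --> F] --> (0 : Cx), o1 lam @[lam --> F] --> (0 : Cx) &
      \forall lam \near F, char_det C D Phi lam =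
        (\det limit_mx * (1 + o0 lam) + (first_coef + o1 lam) / lam) *
        cexp (log_dominant lam)].
Proof.
pose o0 lam : Cx := \det (dominant_mx 1 lam) * cexp (- log_dominant lam) - 1.
pose w lam := \det (limit_mx + colimit_mx *m boundary_mx lam).
pose g lam : Cx := lam * (w lam - \det limit_mx).
have o00 : o0 lam @[lam --> F] --> (0 : Cx).
  apply: cvg_large => eta eta0.
  have [k0 k00 H] := dominant_asymptotics sg b_unit HQ HPhi eta0.
  by exists k0 => // lam Slam Hl; apply: H Hl (HS Slam).
have gl : g lam @[lam --> F] --> (first_coef : Cx).
  rewrite -first_coefE; apply: det_first_order.
  - exact: inv_cvg0.
  - by apply: filterS near_unit => lam [].
  - move=> i l; rewrite [X in _ --> (X : Cx)]mxE.
    rewrite (_ : (fun lam => _) = fun lam =>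
        \sum_m colimit_mx i m * (lam * boundary_mx lam m l) : Cx).
      by apply: cvg_lin_comb => m; exact: cvg_boundary.
    apply/funext => lam; rewrite mxE mulr_sumr.
    by apply: eq_bigr => m _; rewrite mulrCA.
(* The relative error of det A(1) multiplies both terms of det(T + E); on the second one it is
   absorbed into o1, which makes the formula exact for nonzero [lam]. *)
exists o0, (fun lam => (1 + o0 lam) * g lam - first_coef).
have o10 := cvg_perturb o00 gl.
split; [exact: o00 | exact: o10 |].
apply: filterS near_unit => lam [lam0 Au].
rewrite char_det_factor// -/(w lam).
have dE : \det (dominant_mx 1 lam) = (1 + o0 lam) * cexp (log_dominant lam).
  rewrite /o0 addrC subrK -mulrA -cexpD addNr cexp0 mulr1.
  by [].
rewrite dE /g.
by field.
Qed.

End sector_asymptotics.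

(** * Geometry of the sectors *)

Section one_sided_limits.
Context {R : realType}.
Implicit Types (f : R -> R[i]) (c : R[i]).

Lemma cintegralZ a b c f : cintegrable `[a, b] f ->
  cintegral `[a, b] (fun t => c * f t) = c * cintegral `[a, b] f.
Proof.
move=> [H1 H2]; apply: complex_ext; rewrite ?ReM ?ImM/= -!/(Rint a b _).
  under eq_fun do rewrite ReM.
  by rewrite RintB ?RintZ//; exact: L1Z.
under eq_fun do rewrite ImM.
by rewrite RintD ?RintZ//; exact: L1Z.
Qed.

Lemma cvg_right_small f c : ((f t : R[i]^o) @[t --> 0^'+] --> (f 0 : R[i]^o)) ->
  forall eta : R, 0 < eta -> \forall d \near (0 : R)^'+, forall s, 0 <= s <= d ->
  cabs (c * f s - c * f 0) <= eta.
Proof.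
move=> H eta eta0.
have c0 := cabs_ge0 c.
(* The added 1 guards against c = 0. *)
have e0 : 0 < eta / (cabs c + 1) by rewrite divr_gt0//; lra.
have E0 : (0 : R[i]) < (eta / (cabs c + 1))%:C by rewrite ltcR.
move/cvgrPdist_le : H => /(_ _ E0) [r /= r0 Hr].
exists r => // d /= dr d0 s /andP[s0 sd].
(* The right-hand filter omits 0 itself, where the difference is zero. *)
move: s0; rewrite le_eqVlt => /predU1P[<-|s0].
  by rewrite subrr cabs0 ltW.
have := Hr s; rewrite /= sub0r normrN gtr0_norm//.
have sr : s < r.
  by apply: (le_lt_trans sd); move: dr; rewrite sub0r normrN gtr0_norm.
move=> /(_ sr s0); rewrite cabsE lecR -mulrBr cabsM -opprB cabsN => h.
apply: (@le_trans _ _ ((cabs c + 1) * (eta / (cabs c + 1)))).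
  by rewrite ler_pM ?cabs_ge0// lerDl.
by rewrite mulrCA divff ?mulr1//; apply: lt0r_neq0; lra.
Qed.

Lemma cvg_left_small f c : ((f t : R[i]^o) @[t --> 1^'-] --> (f 1 : R[i]^o)) ->
  forall eta : R, 0 < eta -> \forall d \near (0 : R)^'+, forall s, 0 <= s <= d ->
  cabs (c * f (1 - s) - c * f 1) <= eta.
Proof.
move=> H; have := @cvg_right_small (fun s => f (1 - s)) c.
rewrite /= subr0; apply; apply/cvgrPdist_le => e e0.
move/cvgrPdist_le : H => /(_ _ e0) [r /= r0 Hr].
exists r => // s /= sr s0; apply: Hr => /=; last by rewrite ltrBlDr ltrDl.
by rewrite opprB addrCA subrr addr0; move: sr; rewrite sub0r normrN.
Qed.

Lemma near_right_ex (P : R -> Prop) : (\forall d \near (0 : R)^'+, P d) ->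
  exists2 d : R, 0 < d & P d.
Proof.
move=> H; have [d [d0 Pd]] : exists d : R, 0 < d /\ P d.
  apply: (@filter_ex _ ((0 : R)^'+)); apply: filterS2 H; last exact: nbhs_right_gt.
  by [].
by exists d.
Qed.

Lemma near_right_ex2 (I : finType) (P : R -> I -> I -> Prop) :
  (forall j l, \forall d \near (0 : R)^'+, forall s : R, 0 <= s <= d -> P s j l) ->
  exists2 d : R, 0 < d & forall (s : R) j l, 0 <= s <= d -> P s j l.
Proof.
move=> H; have [|d d0 Hd] := @near_right_ex (fun d => forall j l s, 0 <= s <= d -> P s j l).
  by apply: filter_forall => j; apply: filter_forall => l; exact: H.
by exists d => // s j l; exact: Hd.
Qed.

End one_sided_limits.

(** * Signs and lower bounds of Re(i b_j z) on a sector *)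

Section sectors.
Context {R : realType} (n : nat) (b : 'rV[R[i]]_n).

Definition cis (th : R) : R[i] := cos th +i* sin th.

Lemma re_ibz_polar j r th : re_ibz b j (r%:C * cis th) = r * re_ibz b j (cis th).
Proof. by rewrite /re_ibz !(ReM, ImM)/=; ring. Qed.

Lemma cabs_polar r th : 0 < r -> cabs (r%:C * cis th) = r.
Proof.
by move=> r0; rewrite cabsM cabsR gtr0_norm// /cabs/= cos2Dsin2 sqrtr1 mulr1.
Qed.

Lemma continuous_re_ibz j : continuous (fun th => re_ibz b j (cis th)).
Proof.
pose u := complex.Re ('i%C * b 0 j); pose v := complex.Im ('i%C * b 0 j).
rewrite (_ : (fun _ => _) = fun th => u * cos th - v * sin th); last first.
  by apply/funext => th; rewrite /re_ibz ReM.
move=> th; apply: cvgB; apply: cvgM; try exact: cvg_cst.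
  exact: continuous_cos.
exact: continuous_sin.
Qed.

Context (phi1 phi2 : R).
Hypothesis Hsec : is_sector b phi1 phi2.

Lemma re_ibz_neq0 j th : phi1 < th < phi2 -> re_ibz b j (cis th) != 0.
Proof.
move=> /andP[h1 h2]; apply/eqP => H0.
have [z Hz E] := Hsec.
have : sector phi1 phi2 (cis th).
  by exists 1, th; split => //; rewrite mul1r.
by rewrite E => /connected_component_sub; apply; right; exists j.
Qed.

Lemma re_ibz_sign j th th' : phi1 < th < phi2 -> phi1 < th' < phi2 ->
  (0 < re_ibz b j (cis th)) = (0 < re_ibz b j (cis th')).
Proof.
suff main t t' : phi1 < t < phi2 -> phi1 < t' < phi2 -> t <= t' ->
    (0 < re_ibz b j (cis t)) = (0 < re_ibz b j (cis t')).
  move=> h h'; have [tt|/ltW tt] := leP th th'; first exact: main.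
  by symmetry; exact: main.
move=> h h' tt; apply/eqP/negPn/negP => neq.
have [||x + x0] := @IVT R (fun th => re_ibz b j (cis th)) t t' 0 tt.
- by apply: continuous_subspaceT; exact: continuous_re_ibz.
- have := re_ibz_neq0 j h; have := re_ibz_neq0 j h'.
  move: neq; rewrite ge_min le_max.
  by case: (ltgtP (re_ibz b j (cis t)) 0) => //; case: (ltgtP (re_ibz b j (cis t')) 0).
rewrite in_itv/= => /andP[tx xt].
have : phi1 < x < phi2 by move: h h' => /andP[a _] /andP[_ c]; lra.
by move/(re_ibz_neq0 j); rewrite x0 eqxx.
Qed.

(** This is where shrinking by [eps] enters: the closed arc of directions is compact and free of
    zeros, whereas Re(i b_j z) may vanish at the edges of the sector. For an empty arc any [dl] will
    do. *)
Lemma re_ibz_lower eps : 0 < eps -> exists2 dl : R, 0 < dl &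
  forall j th, phi1 + eps <= th <= phi2 - eps -> dl <= `|re_ibz b j (cis th)|.
Proof.
move=> eps0; have [ab|ba] := leP (phi1 + eps) (phi2 - eps); last first.
  by exists 1 => // j th; lra.
suff : \forall d \near (0 : R)^'+, forall j th, phi1 + eps <= th <= phi2 - eps ->
    d <= `|re_ibz b j (cis th)|.
  exact: near_right_ex.
apply: filter_forall => j.
have [|c + Hc] := @EVT_min R (fun th => `|re_ibz b j (cis th)|) _ _ ab.
  apply: continuous_subspaceT => x.
  by apply: (continuous_comp (@continuous_re_ibz j x)); exact: norm_continuous.
rewrite in_itv/= => cI.
have c0 : 0 < `|re_ibz b j (cis c)|.
  by rewrite normr_gt0 re_ibz_neq0//; lra.
near=> d => th thI; apply: (@le_trans _ _ `|re_ibz b j (cis c)|).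
  by near: d; exact: nbhs_right_le.
by apply: Hc; rewrite in_itv.
Unshelve. all: by end_near. Qed.

(** Re(i b_j lam) is |lam| times its value in the direction of lam; the sign is that at [zp], since
    a change of sign would force a zero inside the sector. *)
Lemma sector_dichotomy eps zp : 0 < eps ->
  sector (phi1 + eps) (phi2 - eps) zp -> exists2 dl : R, 0 < dl &
  forall lam, sector (phi1 + eps) (phi2 - eps) lam ->
  dichotomy (fun j => 0 < re_ibz b j zp) (dl * cabs lam) (rate b lam).
Proof.
move=> eps0 [r0 [th0 [r00 l0 g0 ->]]]; have [dl dl0 Hdl] := re_ibz_lower eps0.
exists dl => // _ [r [th [rr l g ->]]]; rewrite -!/(cis _).
have sgE j : (0 < re_ibz b j (r0%:C * cis th0)) = (0 < re_ibz b j (cis th)).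
  by rewrite re_ibz_polar pmulr_rgt0//; apply: re_ibz_sign; lra.
have thI : phi1 + eps <= th <= phi2 - eps by lra.
rewrite cabs_polar//; split; first by rewrite mulr_ge0 ?ltW.
  move=> j; rewrite sgE -leNgt => h.
  rewrite -[complex.Re _]/(re_ibz b j (r%:C * cis th)) re_ibz_polar.
  by have := Hdl j th thI; rewrite ler0_norm// => ?; nra.
move=> j; rewrite sgE => h.
rewrite -[complex.Re _]/(re_ibz b j (r%:C * cis th)) re_ibz_polar.
by have := Hdl j th thI; rewrite gtr0_norm// => ?; nra.
Qed.

Lemma re_ibz_sector_lt0 eps zp j : 0 < eps ->
  sector (phi1 + eps) (phi2 - eps) zp ->
  (re_ibz b j zp < 0) = ~~ (0 < re_ibz b j zp).
Proof.
move=> eps0 [r0 [th0 [r00 l0 g0 ->]]]; rewrite -/(cis _) re_ibz_polar.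
rewrite pmulr_rgt0// pmulr_rlt0// -leNgt lt_neqAle re_ibz_neq0//; lra.
Qed.

End sectors.

Theorem proposition3p4 (R : realType) (n : nat) (b : 'rV[R[i]]_n)
    (Q : R -> 'M[R[i]]_n) (C D : 'M[R[i]]_n) (Phi : R -> R[i] -> 'M[R[i]]_n)
    (phi1 phi2 : R) :
  (0 < n)%N ->
  diag_mx b \in unitmx ->
  \rank (row_mx C D) = n ->
  (forall j k, cintegrable `[0, 1] (fun t => Q t j k)) ->
  (forall j k, b 0 j != b 0 k ->
     ((Q t j k : R[i]^o) @[t --> 0^'+] --> (Q 0 j k : R[i]^o)) /\
     ((Q t j k : R[i]^o) @[t --> 1^'-] --> (Q 1 j k : R[i]^o))) ->
  (forall lam, fundamental_matrix b Q lam (Phi ^~ lam)) ->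
  is_sector b phi1 phi2 ->
  \forall eps \near 0^'+, forall zp : R[i],
    sector (phi1 + eps) (phi2 - eps) zp ->
    exists o0 o1 : R[i] -> R[i]^o,
      [/\ o0 lam @[lam --> infty_within (sector (phi1 + eps) (phi2 - eps))]
            --> (0 : R[i]^o),
          o1 lam @[lam --> infty_within (sector (phi1 + eps) (phi2 - eps))]
            --> (0 : R[i]^o) &
          \forall lam \near infty_within (sector (phi1 + eps) (phi2 - eps)),
            char_det C D Phi lam =
            gamma b Q zp *
            (omega0 b C D zp * (1 + o0 lam)
             + (omega1 b Q C D zp + o1 lam) / lam) *
            cexp ('i%C * tau b zp * lam)].
Proof.
move=> _ b_unit _ HQ Hlim HPhi Hsec.
near=> eps => zp zpS.
have eps0 : 0 < eps by near: eps; exact: nbhs_right_gt.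
pose sg : pred 'I_n := fun j => 0 < re_ibz b j zp.
have sgN j : (re_ibz b j zp < 0) = ~~ sg j by exact: re_ibz_sector_lt0 zpS.
(* The class of j depends on the value b_j alone, so every coupling coefficient falls under the
   continuity hypothesis and the denominators do not vanish. *)
have Hb j l : sg j -> ~~ sg l -> b 0 j != b 0 l.
  by move=> sj; apply: contra => /eqP bE; rewrite /sg /re_ibz -bE.
have [dl dl0 HS] := sector_dichotomy Hsec eps0 zpS.
have Hcont0 (eta : R) : 0 < eta -> exists2 d : R, 0 < d & forall (s : R) j l,
    0 <= s <= d -> sg j -> ~~ sg l -> cabs (coef b Q s j l - coef b Q 0 j l) <= eta.
  move=> eta0; apply: (@near_right_ex2 R 'I_n (fun s j l => sg j -> ~~ sg l ->
    cabs (coef b Q s j l - coef b Q 0 j l) <= eta)) => j l.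
  case: (boolP (sg j && ~~ sg l)) => [/andP[sj sl]|/negP H]; last first.
    by near=> d => s _ sj sl; case: H; rewrite sj sl.
  have [/(@cvg_right_small _ (fun t => Q t j l) (- ('i%C * b 0 j)))] := Hlim j l (Hb j l sj sl).
  move=> /(_ eta eta0) H _; apply: filterS H => d H s sd _ _.
  by have := H s sd; rewrite /coef !mulNr.
have Hcont1 (eta : R) : 0 < eta -> exists2 d : R, 0 < d & forall (s : R) j l,
    0 <= s <= d -> ~~ sg j -> sg l ->
    cabs (coef b Q (1 - s) j l - coef b Q 1 j l) <= eta.
  move=> eta0; apply: (@near_right_ex2 R 'I_n (fun s j l => ~~ sg j -> sg l ->
    cabs (coef b Q (1 - s) j l - coef b Q 1 j l) <= eta)) => j l.
  case: (boolP (~~ sg j && sg l)) => [/andP[sj sl]|/negP H]; last first.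
    by near=> d => s _ sj sl; case: H; rewrite sj sl.
  have bjl : b 0 j != b 0 l by rewrite eq_sym; exact: Hb.
  have [_ /(@cvg_left_small _ (fun t => Q t j l) (- ('i%C * b 0 j)))] := Hlim j l bjl.
  move=> /(_ eta eta0) H; apply: filterS H => d H s sd _ _.
  by have := H s sd; rewrite /coef !mulNr.
have [u0 [u1 [H0 H1 H]]] :=
  sector_expansion C D b_unit HQ HPhi dl0 HS Hb Hcont0 Hcont1.
exists u0, u1; split; [exact: H0|exact: H1|].
have TE : limit_mx C D sg = Tmx b C D zp.
  by apply/matrixP => i k; rewrite !mxE sgN; case: ifP.
(* The rates sum to i tau lam, and the integrals of the diagonal coefficients -i b_j q_jj give the
   exponent of gamma. *)
have gE lam : cexp (log_dominant b Q sg lam) = gamma b Q zp * cexp ('i%C * tau b zp * lam).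
  rewrite /gamma -cexpD /log_dominant big_split/= addrC; congr cexp; congr (_ + _).
    rewrite -sumrN; apply: eq_bigr => j _; rewrite -mulNr -cintegralZ//.
    by congr cintegral; apply/funext => t; rewrite /coef mulNr.
  rewrite /tau mulr_sumr mulr_suml.
  by [].
have wE : first_coef b Q C D sg = omega1 b Q C D zp.
  rewrite /first_coef /omega1 TE; apply: eq_bigl => j; by rewrite sgN.
apply: filterS H => lam ->; rewrite gE TE wE /omega0.
by rewrite mulrCA mulrA.
Unshelve. all: by end_near. Qed.
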